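(* Let the data $(f,g,\xi,u,\kappa)$ satisfy assumptions (A1)--(A4) listed in the context, where $\kappa$ is a real $\mathbb F$-adapted, continuous, non-decreasing process with $\kappa_0=0$. Let $(Y,Z,K)\in S^2\times H^2\times A_d^2$ be a solution of the mean-reflected equation, i.e. $\mathbb P$-a.s. for all $0\le t\le T$, $$Y_t=\xi+\int_t^T f(s,Y_s,Z_s,\nu_s)\,ds+\int_t^T g(s,Y_s)\,d\kappa_s-\int_t^T Z_s\,dB_s+K_T-K_t,\qquad \nu_s:=\mathcal L[(Y_s,Z_s)],$$ together with $\mathbb E[Y_t]\ge u_t$ for all $t\in[0,T]$ and $\int_0^T(\mathbb E[Y_t]-u_t)\,dK_t=0$. Then there exists a constant $C>0$ (depending on $L_f,\beta,T$) such that $$\mathbb E\Big[\sup_{0\le t\le T}|Y_t|^2+\int_0^T|Z_s|^2ds\Big]\le C\Big(\mathbb E|\xi|^2+\mathbb E\Big[\int_0^T|f(s,0,0,\delta_0)|^2ds\Big]+\mathbb E\Big[\int_0^T|\psi_s|^2d\kappa_s\Big]+K_T^2\Big).$$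
   Context: $(\Omega,\mathcal F,\mathbb P)$ is a complete probability space carrying a $d$-dimensional standard Brownian motion $B$; $\mathbb F=(\mathcal F_t)_{0\le t\le T}$ is its natural filtration augmented by all $\mathbb P$-null sets; $T\in(0,\infty)$ is fixed. Spaces. $S^2$: real-valued continuous $\mathbb F$-adapted processes $Y$ on $[0,T]$ with $\mathbb E[\sup_{0\le t\le T}|Y_t|^2]<\infty$. $H^2$: $\mathbb R^{1\times d}$-valued $\mathbb F$-predictable processes $Z$ with $\mathbb E\int_0^T|Z_t|^2dt<\infty$. $A_d^2$: deterministic, continuous, non-decreasing functions $K:[0,T]\to\mathbb R$ with $K_0=0$ and $K_T<\infty$. $\mathcal P_2(\mathbb R\times\mathbb R^{1\times d})$: probability measures with finite second moment, with the 2-Wasserstein distance $W_2$; $\delta_0$ is the Dirac mass at the origin. $\mathcal L[X]$ denotes the law of $X$ under $\mathbb P$. Assumptions. (A1) $f:\Omega\times[0,T]\times\mathbb R\times\mathbb R^{1\times d}\times\mathcal P_2(\mathbb R\times\mathbb R^{1\times d})\to\mathbb R$; for each $(y,z,\nu)$ the process $f(\cdot,y,z,\nu)$ is $\mathbb F$-progressively measurable; for every $\mu>0$, $\mathbb E\int_0^T e^{\mu\kappa_t}|f(t,0,0,\delta_0)|^2dt<\infty$; and there is $L_f\ge0$ such that for all $t$ and all $(y_i,z_i,\nu_i)$, $i=1,2$, $|f(t,y_1,z_1,\nu_1)-f(t,y_2,z_2,\nu_2)|\le L_f(|y_1-y_2|+|z_1-z_2|+W_2(\nu_1,\nu_2))$.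 (A2) $g:\Omega\times[0,T]\times\mathbb R\to\mathbb R$ is $\mathbb F$-progressively measurable, $y\mapsto g(t,y)$ is continuous for all $t$; there is $\beta<0$ with $(y_1-y_2)(g(t,y_1)-g(t,y_2))\le\beta(y_1-y_2)^2$ for all $t,y_1,y_2$; and there are an $\mathbb F$-adapted $[0,\infty)$-valued process $\psi$ and $L_g>0$ with $|g(t,y)|\le\psi_t+L_g|y|$ for all $t,y$, and $\mathbb E\int_0^Te^{\mu\kappa_t}|\psi_t|^2d\kappa_t<\infty$ for every $\mu>0$. (A3) $\xi$ is a real $\mathcal F_T$-measurable random variable with $\mathbb E[e^{\mu\kappa_T}|\xi|^2]<\infty$ for every $\mu>0$, and $\mathbb E[\xi]\ge u_T$. (A4) $u:[0,T]\to\mathbb R$ is a deterministic continuous function. *)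

(* Defs.v *)
From HB Require Import structures.
From mathcomp Require Import all_boot all_order all_algebra.
From mathcomp Require Import all_classical all_reals all_analysis.
From mathcomp Require Import measurable_realfun.

Set Implicit Arguments.
Unset Strict Implicit.
Unset Printing Implicit Defensive.
Import Order.TTheory GRing.Theory Num.Theory.
Import numFieldNormedType.Exports.

Local Open Scope classical_set_scope.
Local Open Scope ring_scope.

(* Vectors of R^{1 x d} are d-tuples: the library puts the product (= Borel)
   sigma-algebra on tuples, and the norm it puts on matrices is the sup norm. *)
Section vectors.
Context {R : realType} {d : nat}.
Implicit Types z : d.-tuple R.

Definition vec0 : d.-tuple R := [tuple 0 | i < d].

Definition vdist z1 z2 : R :=
  Num.sqrt (\sum_(i < d) (tnth z1 i - tnth z2 i) ^+ 2).

Definition vnorm z : R := Num.sqrt (\sum_(i < d) tnth z i ^+ 2).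

End vectors.

Notation state R d := (R * d.-tuple R)%type.

Section wasserstein.
Context (R : realType) (d : nat).

Definition state0 : state R d := (0, vec0).

Definition sqdist (x y : state R d) : R :=
  (x.1 - y.1) ^+ 2 + \sum_(i < d) (tnth x.2 i - tnth y.2 i) ^+ 2.

Definition finite_moment2 (nu : probability (state R d) R) : Prop :=
  (\int[nu]_x (sqdist x state0)%:E < +oo)%E.

Record P2 := mkP2 {
  P2_prob :> probability (state R d) R ;
  P2_moment : finite_moment2 P2_prob }.

Definition coupling (nu1 nu2 : P2) :
    set (probability (state R d * state R d)%type R) :=
  [set pi | forall A, measurable A ->
     pi (A `*` setT) = nu1 A /\ pi (setT `*` A) = nu2 A].

Definition W2 (nu1 nu2 : P2) : R :=
  Num.sqrt (fine (ereal_inf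
    [set (\int[pi]_x (sqdist x.1 x.2)%:E)%E | pi in coupling nu1 nu2])).

Lemma measurable_sqdist0 :
  measurable_fun [set: state R d] (fun x => sqdist x state0).
Proof.
rewrite /sqdist; apply: measurable_funD.
  apply: (@measurable_funX _ _ _ _ (fun x : state R d => x.1 - state0.1)).
  by apply: measurable_funB => //; exact: measurable_fst.
apply: measurable_sum => i.
apply: (@measurable_funX _ _ _ _
  (fun x : state R d => tnth x.2 i - tnth state0.2 i)).
apply: measurable_funB => //.
apply: (@measurableT_comp _ _ _ _ _ _ (fun z : d.-tuple R => tnth z i)).
  exact: measurable_tnth.
exact: measurable_snd.
Qed.

Lemma finite_moment2_dirac0 : finite_moment2 (dirac state0).
Proof.
rewrite /finite_moment2 integral_dirac//; last first.
  by apply/measurable_EFinP; exact: measurable_sqdist0.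
by rewrite diracT mul1e ltry.
Qed.

Definition delta0 : P2 := mkP2 finite_moment2_dirac0.

End wasserstein.
Arguments delta0 {R d}.

Section increasing_paths.
Context {R : realType}.

Definition cont_on (T : R) (h : R -> R) : Prop :=
  {within `[0, T], continuous h}.

Record incr_path (T : R) := mkIncrPath {
  incr_fun :> R -> R ;
  incr_cont : cont_on T incr_fun ;
  incr_nd : {in `[0, T] &, {homo incr_fun : s t / s <= t}} ;
  incr_0 : incr_fun 0 = 0 }.

Definition clamp (T t : R) : R := Num.max 0 (Num.min t T).

(* The path is frozen outside [0, T], so that its Lebesgue-Stieltjes measure
   does not charge the complement of [0, T]. *)
Definition frozen (T : R) (k : incr_path T) (t : R) : R := k (clamp T t).

Lemma clamp_nd T : {homo clamp T : s t / s <= t}.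
Proof. by move=> s t st; rewrite /clamp le_max2// le_min2. Qed.

Lemma clamp_continuous T : continuous (clamp T).
Proof.
move=> x; apply: (@continuous_max R R (fun=> 0) (fun t => Num.min t T)).
  exact: cst_continuous.
apply: (@continuous_min R R id (fun=> T)).
  exact: cvg_id.
exact: cst_continuous.
Qed.

Lemma clamp_itv T t : 0 <= T -> clamp T t \in `[0, T].
Proof.
by move=> T0; rewrite in_itv/= /clamp le_max lexx/= ge_max T0 ge_min lexx orbT.
Qed.

Lemma clamp_id T t : t \in `[0, T] -> clamp T t = t.
Proof.
rewrite in_itv/= => /andP[t0 tT].
by rewrite /clamp (min_idPl tT) (max_idPr t0).
Qed.

Lemma clamp_neg T t : T < 0 -> clamp T t = 0.
Proof.
by move=> T0; apply/max_idPl; rewrite ge_min (ltW T0) orbT.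
Qed.

Section frozen_cumulative.
Variables (T : R) (k : incr_path T).

Let frozen_nd : nondecreasing (frozen k).
Proof.
move=> s t st; rewrite /frozen; have [T0|T0] := leP 0 T.
  by apply: incr_nd; rewrite ?clamp_itv//; exact: clamp_nd.
by rewrite !clamp_neg.
Qed.

Let frozen_continuous : continuous (frozen k).
Proof.
have [T0|T0] := leP 0 T; last first.
  have -> : frozen k = fun=> k 0.
    by apply/funext => t; rewrite /frozen clamp_neg.
  exact: cst_continuous.
move=> x.
have /subspace_continuousP := @incr_cont _ k.
move=> /(_ _ (clamp_itv x T0)) kc.
apply: (@cvg_comp _ _ _ (clamp T) k _ (within `[0, T] (nbhs (clamp T x)))).
  move=> A /= wA.
  have := @clamp_continuous T x _ wA; rewrite nbhs_simpl/=.
  by apply: (@filterS _ (nbhs x)) => y; apply; exact: clamp_itv.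
exact: kc.
Qed.

Let frozen_rc : right_continuous (frozen k).
Proof. exact: right_continuousW. Qed.

HB.instance Definition _ :=
  isCumulative.Build R _ R (frozen k) frozen_nd frozen_rc.

End frozen_cumulative.

Definition stieltjes (T : R) (k : incr_path T) :
    {measure set (measurableTypeR R) -> \bar R} :=
  lebesgue_stieltjes_measure (frozen k).

End increasing_paths.

Section setting.
Context {R : realType} {dsp : measure_display} {Omega : measurableType dsp}.
Context (P : probability Omega R) {d : nat} (T : R).

Definition increment (X : R -> {RV P >-> d.-tuple R}) (s t : R) (w : Omega) :
    d.-tuple R :=
  [tuple tnth (X t w) i - tnth (X s w) i | i < d].

(* Generator of the filtration sigma(X_s, s <= t). *)
Definition past (X : R -> {RV P >-> d.-tuple R}) (t : R) : set (set Omega) :=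
  [set A | exists s U,
     [/\ 0 <= s <= t, measurable U & A = X s @^-1` U]].

Record brownian (B : R -> {RV P >-> d.-tuple R}) : Prop := {
  bm_paths : {ae P, forall w, B 0 w = vec0 /\
    forall i, cont_on T (fun t => tnth (B t w) i)} ;
  bm_indep : forall s t, 0 <= s -> s < t -> t <= T ->
    forall A U, <<s past B s >> A -> measurable U ->
    P (A `&` increment B s t @^-1` U) =
      (P A * P (increment B s t @^-1` U))%E ;
  bm_gauss : forall s t, 0 <= s -> s < t -> t <= T ->
    forall U : 'I_d -> set R, (forall i, measurable (U i)) ->
    P [set w | forall i, U i (tnth (increment B s t w) i)] =
      (\prod_(i < d) normal_prob 0 (Num.sqrt (t - s)) (U i))%E }.

Variable B : R -> {RV P >-> d.-tuple R}.

(* Omega with the sigma-algebra F_t of the augmented Brownian filtration. *)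
Definition at_time (t : R) : Type :=
  g_sigma_algebraType (past B t `|` negligible P).
HB.instance Definition _ t := Measurable.on (at_time t).

Definition adapted d' (S : measurableType d') (X : R -> Omega -> S) : Prop :=
  forall t, t \in `[0, T] -> measurable_fun setT (X t : at_time t -> S).

Definition progressive (X : R -> Omega -> R) : Prop :=
  forall t, t \in `[0, T] ->
  measurable_fun (`[0, t] `*` setT)
    ((fun p => X p.1 p.2) : R * at_time t -> R).

Definition predictable_rect : set (set (R * Omega)) :=
  [set C | (exists A : set (at_time 0),
              measurable A /\ C = [set 0] `*` A) \/
           (exists s t (A : set (at_time s)),
              [/\ 0 <= s, s < t, t <= T, measurable A & C = `]s, t] `*` A])].

Definition predictable (X : R -> Omega -> d.-tuple R) : Prop :=
  @measurable_fun _ _ (g_sigma_algebraType predictable_rect) (d.-tuple R)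
    (`[0, T] `*` setT) (fun p => X p.1 p.2).

Definition space_S2 (Y : R -> {RV P >-> R}) : Prop :=
  [/\ forall w, cont_on T (fun t => Y t w),
      adapted (fun t => Y t : Omega -> R) &
      (\int[P]_w ereal_sup [set (`|Y t w| ^+ 2)%:E | t in `[0%R, T]%classic]
        < +oo)%E].

Definition norm2_H2 (Z : R -> Omega -> d.-tuple R) : \bar R :=
  (\int[P]_w \int[lebesgue_measure]_(t in `[0%R, T]) (vnorm (Z t w) ^+ 2)%:E)%E.

Definition space_H2 (Z : R -> {RV P >-> d.-tuple R}) : Prop :=
  predictable (fun t => Z t : Omega -> d.-tuple R) /\
  (norm2_H2 (fun t => Z t : Omega -> d.-tuple R) < +oo)%E.

(* Sum over i < sp_size of sp_coef i * 1_(sp_grid i, sp_grid i.+1]. *)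
Record simple_process := SimpleProcess {
  sp_size : nat ;
  sp_grid : nat -> R ;
  sp_coef : nat -> Omega -> d.-tuple R ;
  sp_grid_itv : forall i, (i <= sp_size)%N -> sp_grid i \in `[0, T] ;
  sp_grid_le : forall i, (i < sp_size)%N -> sp_grid i <= sp_grid i.+1 ;
  sp_coef_meas : forall i, (i < sp_size)%N ->
    measurable_fun setT (sp_coef i : at_time (sp_grid i) -> d.-tuple R) ;
  sp_coef_bounded : exists M : R, forall i w, (i < sp_size)%N ->
    vnorm (sp_coef i w) <= M }.

Definition sp_value (H : simple_process) (t : R) (w : Omega) : d.-tuple R :=
  [tuple \sum_(i < sp_size H)
     (if sp_grid H i < t <= sp_grid H i.+1 then tnth (sp_coef H i w) j else 0)
   | j < d].

Definition sp_integral (H : simple_process) (t : R) (w : Omega) : R :=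
  \sum_(i < sp_size H) \sum_(j < d)
    tnth (sp_coef H i w) j *
    tnth (increment B (Num.min (sp_grid H i) t) (Num.min (sp_grid H i.+1) t) w)
      j.

(* M is (a version with continuous paths of) the Ito integral process
   int_0^t Z_s dB_s: the L^2 limit of the integrals of simple processes that
   approximate Z in H^2.  It is unique up to indistinguishability. *)
Definition ito_integral (Z : R -> {RV P >-> d.-tuple R})
    (M : R -> {RV P >-> R}) : Prop :=
  (forall w, cont_on T (fun t => M t w)) /\
  exists H : nat -> simple_process,
    (\int[P]_w \int[lebesgue_measure]_(t in `[0%R, T])
       (vdist (sp_value (H n) t w) (Z t w) ^+ 2)%:E @[n --> \oo] --> 0)%E /\
    (forall t, t \in `[0, T] ->
      (\int[P]_w ((sp_integral (H n) t w - M t w) ^+ 2)%:E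
        @[n --> \oo] --> 0)%E).

Definition pair_rv (X : {RV P >-> R}) (V : {RV P >-> d.-tuple R}) :
  Omega -> state R d := fun w => (X w, V w).

Lemma measurable_pair_rv X V : measurable_fun setT (pair_rv X V).
Proof. by apply: measurable_fun_pair. Qed.

HB.instance Definition _ X V :=
  isMeasurableFun.Build _ _ _ _ (pair_rv X V) (measurable_pair_rv X V).

(* The law of (X, V) as an element of P2.  The second branch is only there
   because (Y_s, Z_s) is square integrable for almost every s only. *)
Definition joint_law (X : {RV P >-> R}) (V : {RV P >-> d.-tuple R}) :
    P2 R d :=
  match pselect (finite_moment2 (distribution P (pair_rv X V))) with
  | left fin => mkP2 fin
  | right _ => delta0
  end.

Variable kappa : Omega -> incr_path T.

Record assumption_A1 (Lf : R)
    (f : R -> Omega -> R -> d.-tuple R -> P2 R d -> R) : Prop := {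
  A1_prog : forall y z nu, progressive (fun t w => f t w y z nu) ;
  A1_int : forall mu, 0 < mu ->
    (\int[P]_w \int[lebesgue_measure]_(t in `[0%R, T])
       (expR (mu * kappa w t) * `|f t w 0 vec0 delta0| ^+ 2)%:E < +oo)%E ;
  A1_lip : forall t w, t \in `[0, T] -> forall y1 y2 z1 z2 nu1 nu2,
    `|f t w y1 z1 nu1 - f t w y2 z2 nu2| <=
      Lf * (`|y1 - y2| + vdist z1 z2 + W2 nu1 nu2) }.

Record assumption_A2 (beta : R) (psi : R -> Omega -> R)
    (g : R -> Omega -> R -> R) : Prop := {
  A2_prog : forall y, progressive (fun t w => g t w y) ;
  A2_cont : forall t w, t \in `[0, T] -> continuous (g t w) ;
  A2_mono : forall t w, t \in `[0, T] -> forall y1 y2,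
    (y1 - y2) * (g t w y1 - g t w y2) <= beta * (y1 - y2) ^+ 2 ;
  A2_psi_adapted : adapted psi ;
  A2_psi_ge0 : forall t w, t \in `[0, T] -> 0 <= psi t w ;
  A2_growth : exists2 Lg : R, 0 < Lg &
    forall t w, t \in `[0, T] -> forall y,
    `|g t w y| <= psi t w + Lg * `|y| ;
  A2_psi_int : forall mu, 0 < mu ->
    (\int[P]_w \int[stieltjes (kappa w)]_(t in `[0%R, T])
       (expR (mu * kappa w t) * `|psi t w| ^+ 2)%:E < +oo)%E }.

Record assumption_A3 (u : R -> R) (xi : {RV P >-> R}) : Prop := {
  A3_meas : measurable_fun setT (xi : at_time T -> R) ;
  A3_int : forall mu, 0 < mu ->
    (\int[P]_w (expR (mu * kappa w T) * `|xi w| ^+ 2)%:E < +oo)%E ;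
  A3_ge : ((u T)%:E <= 'E_P[xi])%E }.

Definition assumption_A4 (u : R -> R) : Prop := cont_on T u.

Record mean_reflected_solution
    (f : R -> Omega -> R -> d.-tuple R -> P2 R d -> R)
    (g : R -> Omega -> R -> R) (xi : {RV P >-> R}) (u : R -> R)
    (Y : R -> {RV P >-> R}) (Z : R -> {RV P >-> d.-tuple R})
    (K : incr_path T) : Prop := {
  sol_S2 : space_S2 Y ;
  sol_H2 : space_H2 Z ;
  sol_eq : exists2 M : R -> {RV P >-> R}, ito_integral Z M &
    {ae P, forall w, forall t, t \in `[0, T] ->
      Y t w = xi w
        + \int[lebesgue_measure]_(s in `[t, T])
            f s w (Y s w) (Z s w) (joint_law (Y s) (Z s))
        + \int[stieltjes (kappa w)]_(s in `[t, T]) g s w (Y s w)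
        - (M T w - M t w)
        + (K T - K t)} ;
  sol_mean : forall t, t \in `[0, T] -> ((u t)%:E <= 'E_P[Y t])%E ;
  sol_flat :
    (\int[stieltjes K]_(t in `[0%R, T]) ('E_P[Y t] - (u t)%:E) = 0)%E }.

End setting.

(* Main.v *)
Require Import Defs.
From HB Require Import structures.
From mathcomp Require Import all_boot all_order all_algebra.
From mathcomp Require Import all_classical all_reals all_analysis.
From mathcomp Require Import measurable_realfun ring lra zify.
Set Implicit Arguments.
Unset Strict Implicit.
Unset Printing Implicit Defensive.
Import Order.TTheory GRing.Theory Num.Theory.
Import numFieldNormedType.Exports.
Local Open Scope classical_set_scope.
Local Open Scope ring_scope.

(** Energy estimate for e^(alpha t) Y_t^2 with alpha = 2 + 2 L_f + 8 L_f^2.  Instead of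
    applying Ito's formula one expands the squares of the increments of Y on the grid of
    step T / (N + 1): the increments of the Ito integral M are orthogonal to the past and
    their squares have the expectation of the integral of |Z|^2, and all remaining terms
    are products with the moduli of continuity of Y and M, which vanish as N tends to
    infinity.  Since kappa_T is unbounded, the weights are cut off where kappa exceeds q,
    and q tends to infinity last.

    The boundary term only costs E int psi^2 dkappa because beta < 0 gives
    2 y g(s, y) <= psi_s^2 / (2 |beta|); the drift is handled by the Lipschitz condition
    and W_2(L(Y_s, Z_s), delta_0)^2 <= E(Y_s^2 + |Z_s|^2), with alpha large enough to
    absorb it; the reflection costs 2 e^(alpha T) K_T E sup |Y|, absorbed by Young's
    inequality.

    For the supremum, Abel summation against the running maximum of |Y| bounds the
    stochastic integral of e^(alpha s) Y by sup |Y| times the maximum of a martingale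
    transform with bounded weights.  Doob's L^2 inequality, proved path by path, is then
    enough, and no Burkholder-Davis-Gundy inequality is needed. *)

(** * Gaussian moments *)

(** Two gaps in measurability shape the proof. The drift evaluated at Y_s, Z_s and their law is not
    known to be measurable in time and outcome, yet the equation integrates it. Such an integral is
    a difference of two suprema over simple functions; for dominated integrands it is still
    controlled by the dominating function and additive over disjoint measurable sets, and the
    argument is arranged to live on that. The process psi is only adapted, so a measurable process
    built from g and Y stands in for it. A further obstacle is kappa_T, which comes with no moment
    of its own: an error of the form (oscillation)^2 kappa_T need not be integrable. The cutoff
    replaces kappa_T by q in such errors. Its weights are read at the left end of a cell in the
    stochastic terms, where they must be known in advance, and at the right end in the terms of
    bounded variation, where the increments of kappa that are counted then sum to at most q. The
    mismatch of the two readings costs a term on the event kappa_T > q and another one that vanishes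
    with the oscillations. *)

Section normal_moments.
Context {R : realType}.
Variables (s : R) (s_gt0 : 0 < s).
Let mu := @lebesgue_measure R.
Let p := normal_pdf 0 s.

Let s_neq0 : s != 0. Proof. by rewrite gt_eqF. Qed.

(** The Radon-Nikodym derivative of [normal_prob] and the density [normal_pdf] have the same
    integral over every measurable set, so they agree almost everywhere; the change of variables
    known for the former passes to the latter. *)
Lemma ge0_integral_normal_prob (f : R -> \bar R) :
  measurable_fun setT f -> (forall x, 0 <= f x)%E ->
  (\int[normal_prob 0%R s]_x f x = \int[mu]_x (f x * (normal_pdf 0%R s x)%:E))%E.
Proof.
move=> mf f0.
have dom := @normal_prob_dominates R 0 s.
rewrite -(Radon_Nikodym_SigmaFinite.change_of_variables dom)//.
have di := Radon_Nikodym_SigmaFinite.f_integrable dom.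
have d0 := Radon_Nikodym_SigmaFinite.f_ge0 dom.
have md := measurable_int _ di.
have mp : measurable_fun [set: R] (fun x => (p x)%:E).
  by apply/measurable_EFinP; exact: measurable_normal_pdf.
apply: ge0_ae_eq_integral => //.
- exact: emeasurable_funM.
- exact: emeasurable_funM.
- by move=> x _; rewrite mule_ge0.
- by move=> x _; rewrite mule_ge0// lee_fin normal_pdf_ge0.
apply: ae_eqe_mul2l; apply: integral_ae_eq => // E _ mE.
by rewrite -(Radon_Nikodym_SigmaFinite.f_integral dom).
Qed.

Let p_even : p =1 p \o -%R.
Proof.
by move=> x; rewrite /p !normal_pdfE//= /normal_fun !subr0 sqrrN.
Qed.

Let p_cont : continuous p. Proof. exact: continuous_normal_pdf. Qed.

Let der_p x : is_derive x (1 : R) p (- (x / s ^+ 2) * p x).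
Proof.
rewrite /p normal_pdfE// /normal_fun.
apply: trigger_derive; rewrite /GRing.scale/=.
rewrite !subr0.
by field.
Qed.

Let F x := - (s ^+ 2 * x * p x).

Let der_F x : is_derive x (1 : R) F ((x ^+ 2 - s ^+ 2) * p x).
Proof.
rewrite /F; have dp := der_p x.
apply: trigger_derive; rewrite /GRing.scale/=.
by field.
Qed.

Let F_cont : continuous F.
Proof.
move=> x; apply: differentiable_continuous; apply/derivable1_diffP.
exact: (@ex_derive _ _ _ _ _ _ _ (der_F x)).
Qed.

Let F_cvgy : F x @[x --> +oo%R] --> (0 : R).
Proof.
(* From exp(-y) <= 1/y at y = x^2 / (2 s^2), the density is at most [normal_peak s] times 2 s^2 /
   x^2; multiplied by s^2 x this is c / x. *)
pose c := normal_peak s * (s ^+ 2 *+ 2) * s ^+ 2.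
have c0 : 0 <= c.
  apply: mulr_ge0; last exact: sqr_ge0.
  by apply: mulr_ge0; [exact: normal_peak_ge0|apply: mulrn_wge0; exact: sqr_ge0].
have Fb x : 0 < x -> `|F x| <= c / x.
  move=> x0; rewrite /F normrN ger0_norm ?mulr_ge0 ?sqr_ge0 ?(ltW x0) ?normal_pdf_ge0 ?(ltW s_gt0)//.
  rewrite /p normal_pdfE// /normal_fun subr0 mulNr expRN.
  have y0 : 0 < x ^+ 2 / (s ^+ 2 *+ 2).
    by rewrite divr_gt0 ?exprn_gt0// pmulrn_lgt0// exprn_gt0.
  have : (expR (x ^+ 2 / (s ^+ 2 *+ 2)))^-1 <= (x ^+ 2 / (s ^+ 2 *+ 2))^-1.
    rewrite lef_pV2 ?posrE ?expR_gt0//; apply: le_trans (expR_ge1Dx _).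
    by rewrite lerDr.
  move=> H; apply: le_trans (_ : s ^+ 2 * x * (normal_peak s * (x ^+ 2 / (s ^+ 2 *+ 2))^-1) <= _).
    apply: ler_wpM2l; first by rewrite mulr_ge0 ?sqr_ge0 ?(ltW x0).
    by apply: ler_wpM2l => //; exact: normal_peak_ge0.
  rewrite /c le_eqVlt; apply/orP; left; apply/eqP; field.
  by rewrite s_neq0 gt_eqF.
apply/norm_cvg0P; apply: (@squeeze_cvgr _ _ _ _ (cst 0) (fun x => c / x)).
- near=> x; rewrite normr_ge0/=; apply: Fb; near: x.
  exact: nbhs_pinfty_gt.
- exact: cvg_cst.
- rewrite -(mulr0 c); apply: cvgM; first exact: cvg_cst.
  by apply/gtr0_cvgV0; [exact: nbhs_pinfty_gt|exact: cvg_id].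
Unshelve. all: by end_near. Qed.

Let x2p x := x ^+ 2 * p x.

Let p_ge0 x : 0 <= p x. Proof. exact: normal_pdf_ge0. Qed.

Let x2p_ge0 x : 0 <= x2p x. Proof. by rewrite mulr_ge0// sqr_ge0. Qed.

Let x2p_cont : continuous x2p.
Proof. by move=> x; apply: cvgM; [exact: exprn_continuous|exact: p_cont]. Qed.

Let mE (g : R -> R) D : continuous g -> measurable D ->
  measurable_fun D (EFin \o g).
Proof.
move=> cg mD; apply/measurable_EFinP; apply: measurable_funTS.
exact: continuous_measurable_fun.
Qed.

(** The integrand (x^2 - s^2) p, with antiderivative [F], changes sign at s. Splitting the half-line
    there keeps all integrands nonnegative, and the boundary terms s^3 p(s) of [int_tail] and
    [int_head] cancel in the sum. *)
Let int_tail : (\int[mu]_(x in `[s, +oo[) (x2p x)%:E =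
  (s ^+ 3 * p s)%:E + (s ^+ 2)%:E * \int[mu]_(x in `[s, +oo[) (p x)%:E)%E.
Proof.
have -> : (s ^+ 3 * p s)%:E = (\int[mu]_(x in `[s, +oo[) (((x ^+ 2 - s ^+ 2) * p x)%:E))%E.
  rewrite (@ge0_continuous_FTC2y _ _ F s 0)//.
  - by rewrite sub0e -EFinN /F opprK; congr EFin; ring.
  - move=> x sx; rewrite mulr_ge0// subr_ge0 ler_sqr// nnegrE ltW//.
    exact: lt_le_trans sx.
  - apply: continuous_subspaceT => x; apply: cvgM; last exact: p_cont.
    by apply: cvgB; [exact: exprn_continuous|exact: cvg_cst].
  - by move=> x _; have dx := der_F x; exact: ex_derive.
  - exact/cvg_at_right_filter/F_cont.
  - by move=> x _; rewrite derive1E; have dx := der_F x; exact: derive_val.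
rewrite -ge0_integralZl//=; last 3 first.
- exact: mE.
- by move=> x _; rewrite lee_fin.
- by rewrite lee_fin sqr_ge0.
rewrite -ge0_integralD//=; first last.
- by apply: emeasurable_funM => //; exact: mE.
- by move=> x _; rewrite mule_ge0 ?lee_fin// sqr_ge0.
- apply: mE => // x; apply: cvgM; last exact: p_cont.
  by apply: cvgB; [exact: exprn_continuous|exact: cvg_cst].
- move=> x; rewrite in_itv/= andbT => sx; rewrite lee_fin mulr_ge0// subr_ge0 ler_sqr// nnegrE ltW//.
  exact: lt_le_trans sx.
apply: eq_integral => x _; rewrite -EFinM -EFinD; congr EFin.
by rewrite /x2p; ring.
Qed.

Let int_head : ((s ^+ 2)%:E * \int[mu]_(x in `[0%R, s]) (p x)%:E =
  \int[mu]_(x in `[0%R, s]) (x2p x)%:E + (s ^+ 3 * p s)%:E)%E.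
Proof.
have -> : (s ^+ 3 * p s)%:E = (\int[mu]_(x in `[0%R, s]) (((s ^+ 2 - x ^+ 2) * p x)%:E))%E.
  have dG x : is_derive x (1 : R) (- F) ((s ^+ 2 - x ^+ 2) * p x).
    have := der_F x => ?.
    by apply: is_derive_eq; rewrite -mulNr opprB.
  rewrite (@continuous_FTC2 _ _ (- F) 0 s)//.
  - rewrite /F !fctE mulr0 mul0r !oppr0 sube0 opprK; congr EFin; ring.
  - apply: continuous_subspaceT => x; apply: cvgM; last exact: p_cont.
    by apply: cvgB; [exact: cvg_cst|exact: exprn_continuous].
  - have cG : continuous (- F) by move=> x; apply: cvgN; exact: F_cont.
    split.
    + by move=> x _; have dx := dG x; exact: ex_derive.
    + exact/cvg_at_right_filter/cG.
    + exact/cvg_at_left_filter/cG.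
  - by move=> x _; rewrite derive1E; have dx := dG x; exact: derive_val.
rewrite -ge0_integralZl//=; last 3 first.
- exact: mE.
- by move=> x _; rewrite lee_fin.
- by rewrite lee_fin sqr_ge0.
rewrite -ge0_integralD//=; first last.
- apply: mE => // x; apply: cvgM; last exact: p_cont.
  by apply: cvgB; [exact: cvg_cst|exact: exprn_continuous].
- move=> x; rewrite in_itv/= => /andP[x0 xs]; rewrite lee_fin mulr_ge0// subr_ge0 ler_sqr// nnegrE ltW//.
- exact: mE.
- by move=> x _; rewrite lee_fin.
apply: eq_integral => x _; rewrite -EFinM -EFinD; congr EFin.
by rewrite /x2p; ring.
Qed.

Lemma normal_prob_moment2 : (\int[normal_prob 0%R s]_x (x ^+ 2)%:E = (s ^+ 2)%:E)%E.
Proof.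
rewrite ge0_integral_normal_prob; last 2 first.
- by apply/measurable_EFinP; exact: exprn_measurable.
- by move=> x; rewrite lee_fin sqr_ge0.
under eq_integral do rewrite -EFinM.
rewrite -/(x2p _) (@ge0_symfun_integralT _ x2p)//; last first.
  by move=> x; rewrite /= /x2p sqrrN p_even.
have split_at (g : R -> R) : continuous g -> (forall x, 0 <= g x) ->
  (\int[mu]_(x in [set x | (0 <= x)%R]) (g x)%:E =
   \int[mu]_(x in `[0%R, s]) (g x)%:E + \int[mu]_(x in `[s, +oo[) (g x)%:E)%E.
  move=> cg g0; rewrite -set_itvcy (@itv_bndbnd_setU _ _ _ (BRight s))//; last first.
    by rewrite bnd_simp ltW.
  rewrite ge0_integral_setU//=; last 3 first.
  - by apply: mE => //; exact: measurableU.
  - by move=> x _; rewrite lee_fin.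
  - rewrite disj_set2E; apply/eqP; rewrite predeqE => x; split => //=; rewrite !in_itv/= andbT.
    by move=> [/andP[_ xs] sx]; move: (le_lt_trans xs sx); rewrite ltxx.
  by rewrite integral_itv_obnd_cbnd//; exact: mE.
rewrite split_at// int_tail addeA -int_head -ge0_muleDr; last 2 first.
- by apply: integral_ge0 => x _; rewrite lee_fin.
- by apply: integral_ge0 => x _; rewrite lee_fin.
rewrite -split_at// muleCA -(@ge0_symfun_integralT _ p)//.
by rewrite integral_normal_pdf mule1.
Qed.

Lemma normal_prob_integrable_sqr :
  (normal_prob 0 s).-integrable setT (EFin \o (fun x : R => x ^+ 2)).
Proof.
apply/integrableP; split; first by apply/measurable_EFinP; exact: exprn_measurable.
under eq_integral do rewrite /= ger0_norm ?sqr_ge0//.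
by rewrite normal_prob_moment2 ltry.
Qed.

Lemma normal_prob_integrable_id :
  (normal_prob 0 s).-integrable setT (EFin \o (id : R -> R)).
Proof.
have i1 := finite_measure_integrable_cst (normal_prob 0 s) (1 : R) measurableT.
have := integrableD measurableT i1 normal_prob_integrable_sqr.
apply: le_integrable => //=; first exact/measurable_EFinP.
move=> x _; rewrite lee_fin [leRHS]ger0_norm; last by rewrite addr_ge0// sqr_ge0.
have := normr_ge0 x; rewrite -(real_normK (num_real x)); nra.
Qed.

(** The reflection x -> -x preserves Lebesgue measure and the density and exchanges the positive and
    negative parts of the identity; integrability makes the difference of the two equal integrals
    meaningful. *)
Lemma normal_prob_mean0 : (\int[normal_prob 0%R s]_x x%:E = 0)%E.
Proof.
rewrite integralE (_ : integral _ _ (fun x => (_^\-)%E x) =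
  \int[normal_prob 0%R s]_x ((EFin \o id : R -> \bar R)^\+ x))%E.
  rewrite subee// fin_num_abs gee0_abs; last by apply: integral_ge0.
  exact: integral_funepos_lt_pinfty normal_prob_integrable_id.
have mf : measurable_fun [set: R] (EFin \o id : R -> \bar R) by exact/measurable_EFinP.
have sym (g : R -> \bar R) : measurable_fun setT g -> (forall x, 0 <= g x)%E ->
  (\int[mu]_x g x = \int[mu]_x g (- x)%R)%E.
  move=> mg g0.
  rewrite -(@ge0_integral_pushforward _ _ _ _ _ (-%R : measurableTypeR R -> measurableTypeR R) _ lebesgue_measure setT g)//.
  by apply: eq_measure_integral => A mA _; exact/esym/lebesgue_measureN.
rewrite !ge0_integral_normal_prob//; last 2 first.
- exact: measurable_funeneg.
- exact: measurable_funepos.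
rewrite sym; last 2 first.
- apply: emeasurable_funM; first exact: measurable_funeneg.
  by apply: mE => //; exact: p_cont.
- by move=> x; rewrite mule_ge0// lee_fin.
apply: eq_integral => x _; congr *%E; last by rewrite -/(p _) -/(p _) [in RHS]p_even.
by rewrite funenegE funeposE/= opprK.
Qed.

End normal_moments.

(** * Integrals of possibly non-measurable functions *)

Section lower_integral.
Context d (T : measurableType d) (R : realType).
Variable mu : {measure set T -> \bar R}.
Local Open Scope ereal_scope.
Import HBNNSimple.

(** The integral of a nonnegative function is a supremum over the simple functions below it, and
    enlarging the function enlarges the set of competitors; measurability never enters. *)
Lemma ge0_le_integral_lower (D : set T) (f g : T -> \bar R) :
  (forall x, D x -> 0 <= f x) -> (forall x, D x -> f x <= g x) ->
  \int[mu]_(x in D) f x <= \int[mu]_(x in D) g x.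
Proof.
move=> f0 fg; rewrite !ge0_integralE//; last first.
  by move=> x Dx; exact: le_trans (f0 _ Dx) (fg _ Dx).
apply: ereal_sup_le => _ [h /= hf <-].
exists h => //= x.
apply: le_trans (hf x) _; rewrite !patchE; case: ifPn => // /set_mem Dx.
exact: fg.
Qed.

(** Measurability of A and B suffices. A simple function below f on the union splits into its
    restrictions, for which additivity is the usual one; conversely simple functions below f on A
    and on B add up to one below f on the union, because A and B are disjoint. *)
Lemma ge0_integral_lower_setU (A B : set T) (f : T -> \bar R) :
  measurable A -> measurable B -> [disjoint A & B] ->
  (forall x, (A `|` B) x -> 0 <= f x) ->
  \int[mu]_(x in A `|` B) f x =
  \int[mu]_(x in A) f x + \int[mu]_(x in B) f x.
Proof.
move=> mA mB AB f0.
have fA0 x : A x -> 0 <= f x by move=> Ax; apply: f0; left.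
have fB0 x : B x -> 0 <= f x by move=> Bx; apply: f0; right.
apply/eqP; rewrite eq_le; apply/andP; split.
  rewrite [leLHS]ge0_integralE//; apply: ge_ereal_sup => _ [h /= hf <-].
  have hoff x : ~ (A `|` B) x -> h x = 0%R.
    move=> nx; apply/eqP; rewrite eq_le fun_ge0 andbT.
    by have := hf x; rewrite patchE memNset// lee_fin.
  have -> : sintegral mu h = \int[mu]_(x in A `|` B) (h x)%:E.
    rewrite integral_nnsfun; last exact: measurableU.
    congr sintegral; apply/funext => x; rewrite patchE.
    by case: ifPn => // /negP; rewrite inE => nx; rewrite hoff.
  rewrite ge0_integral_setU//=.
  - apply: leeD; apply: ge0_le_integral_lower.
    + by move=> x _; rewrite lee_fin fun_ge0.
    + move=> x Ax; have := hf x; rewrite patchE mem_set//; by left.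
    + by move=> x _; rewrite lee_fin fun_ge0.
    + move=> x Bx; have := hf x; rewrite patchE mem_set//; by right.
  - exact/measurable_EFinP/measurable_funTS.
  - by move=> x _; rewrite lee_fin fun_ge0.
have IAB0 : 0 <= \int[mu]_(x in A `|` B) f x by exact: integral_ge0.
have IA0 : 0 <= \int[mu]_(x in A) f x by exact: integral_ge0.
have IB0 : 0 <= \int[mu]_(x in B) f x by exact: integral_ge0.
have key (h1 h2 : {nnsfun T >-> R}) :
    (forall x, (h1 x)%:E <= (f \_ A) x) -> (forall x, (h2 x)%:E <= (f \_ B) x) ->
    sintegral mu h1 + sintegral mu h2 <= \int[mu]_(x in A `|` B) f x.
  move=> h1f h2f; rewrite -sintegralD [leRHS]ge0_integralE//.
  apply: ereal_sup_ubound; exists (add_nnsfun h1 h2) => //= x.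
  have := h1f x; have := h2f x; rewrite !patchE in_setU.
  case: ifPn => Bx; case: ifPn => Ax /=.
  - exfalso; move/disj_setPS : AB => /(_ x); apply; split; exact: set_mem.
  - by move=> H2 H1; rewrite EFinD -[leRHS]add0e leeD.
  - by move=> H2 H1; rewrite EFinD -[leRHS]adde0 leeD.
  - by move=> H2 H1; rewrite EFinD -[leRHS]adde0 leeD.
(* Once the infinite case is set aside, all terms are finite and can be moved across the inequality,
   so that the suprema over [h2] and then over [h1] are taken one at a time. *)
have [->|IABf] := eqVneq (\int[mu]_(x in A `|` B) f x) +oo.
  exact: leey.
have {}IABf : \int[mu]_(x in A `|` B) f x \is a fin_num.
  by rewrite ge0_fin_numE// lt_neqAle IABf leey.
have IAle : \int[mu]_(x in A) f x <= \int[mu]_(x in A `|` B) f x.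
  rewrite [leLHS]ge0_integralE//; apply: ge_ereal_sup => _ [h /= hf <-].
  have := key h nnsfun0 hf _.
  rewrite sintegral0 adde0; apply => x; rewrite patchE; case: ifPn => //.
  by move=> /set_mem; exact: fB0.
have IAf : \int[mu]_(x in A) f x \is a fin_num.
  by rewrite ge0_fin_numE//; apply: le_lt_trans IAle _; rewrite ltey_eq IABf.
rewrite -leeBrDl// [leLHS]ge0_integralE//.
apply: ge_ereal_sup => _ [h2 /= h2f <-].
rewrite leeBrDl// addeC -leeBrDl; last first.
  rewrite ge0_fin_numE ?sintegral_ge0//.
  apply: (@le_lt_trans _ _ (\int[mu]_(x in A `|` B) f x)); last by rewrite ltey_eq IABf.
  have := key nnsfun0 h2 _ h2f.
  rewrite sintegral0 add0e; apply => x; rewrite patchE; case: ifPn => //.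
  by move=> /set_mem; exact: fA0.
rewrite [leLHS]ge0_integralE//.
apply: ge_ereal_sup => _ [h1 /= h1f <-].
rewrite leeBrDl; first by rewrite addeC; exact: key.
rewrite ge0_fin_numE ?sintegral_ge0//.
apply: (@le_lt_trans _ _ (\int[mu]_(x in A `|` B) f x)); last by rewrite ltey_eq IABf.
have := key nnsfun0 h2 _ h2f.
rewrite sintegral0 add0e; apply => x; rewrite patchE; case: ifPn => //.
by move=> /set_mem; exact: fA0.
Qed.

End lower_integral.

Section dominated_nonmeasurable.
Context d (T : measurableType d) (R : realType).
Variable mu : {measure set T -> \bar R}.
Variables (D : set T) (mD : measurable D) (F Fb : T -> R).
Hypothesis iFb : mu.-integrable D (EFin \o Fb).
Hypothesis FFb : forall x, D x -> `|F x| <= Fb x.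

Let part_le (E : set T) (h : T -> R) : measurable E -> E `<=` D ->
  (forall x, 0 <= h x) -> (forall x, h x <= `|F x|) ->
  (\int[mu]_(x in E) (h x)%:E \is a fin_num)%E /\
  \int[mu]_(x in E) h x <= \int[mu]_(x in E) Fb x.
Proof.
move=> mE ED h0 hF.
have iE : mu.-integrable E (EFin \o Fb) by exact: integrableS iFb.
have le : (\int[mu]_(x in E) (h x)%:E <= \int[mu]_(x in E) (Fb x)%:E)%E.
  apply: ge0_le_integral_lower => x Ex; first by rewrite lee_fin.
  by rewrite lee_fin (le_trans (hF x))// FFb//; exact: ED.
have fE := integrable_fin_num mE iE.
have fh : (\int[mu]_(x in E) (h x)%:E \is a fin_num)%E.
  rewrite ge0_fin_numE; last by apply: integral_ge0 => x _; rewrite lee_fin.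
  by apply: le_lt_trans le _; rewrite ltey_eq fE.
by split=> //; rewrite /Rintegral fine_le.
Qed.

Let Fp x := Num.max (F x) 0.
Let Fn x := Num.max (- F x) 0.

Let Fp_le x : Fp x <= `|F x|. Proof. by rewrite /Fp ge_max ler_norm normr_ge0. Qed.
Let Fn_le x : Fn x <= `|F x|.
Proof. by rewrite /Fn ge_max normr_ge0 andbT -normrN ler_norm. Qed.
Let Fp_ge0 x : 0 <= Fp x. Proof. by rewrite /Fp le_max lexx orbT. Qed.
Let Fn_ge0 x : 0 <= Fn x. Proof. by rewrite /Fn le_max lexx orbT. Qed.

Let RintegralE (E : set T) : measurable E -> E `<=` D ->
  \int[mu]_(x in E) F x = \int[mu]_(x in E) Fp x - \int[mu]_(x in E) Fn x.
Proof.
move=> mE ED; rewrite /Rintegral integralE fineB.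
- by congr (fine _ - fine _); apply: eq_integral => x _;
    rewrite ?funeposE ?funenegE /Fp /Fn /= EFin_max.
- have [+ _] := part_le mE ED Fp_ge0 Fp_le; apply: etrans.
  by congr (_ \is a fin_num); apply: eq_integral => x _; rewrite funeposE EFin_max.
- have [+ _] := part_le mE ED Fn_ge0 Fn_le; apply: etrans.
  by congr (_ \is a fin_num); apply: eq_integral => x _; rewrite funenegE EFin_max.
Qed.

(** The integrals of the positive and of the negative part both lie between 0 and the integral of
    [Fb], hence their difference is at most that integral in absolute value. This and
    [Rintegral_setU_dom] are the two facts used for the drift. *)
Lemma ler_norm_Rintegral_dom (E : set T) : measurable E -> E `<=` D ->
  `|\int[mu]_(x in E) F x| <= \int[mu]_(x in E) Fb x.
Proof.
move=> mE ED; rewrite RintegralE//.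
have [_ p1] := part_le mE ED Fp_ge0 Fp_le.
have [_ p2] := part_le mE ED Fn_ge0 Fn_le.
have q1 : 0 <= \int[mu]_(x in E) Fp x by apply: Rintegral_ge0.
have q2 : 0 <= \int[mu]_(x in E) Fn x by apply: Rintegral_ge0.
by rewrite ler_norml; apply/andP; split; lra.
Qed.

Lemma Rintegral_setU_dom (A B : set T) : measurable A -> measurable B ->
  A `|` B `<=` D -> [disjoint A & B] ->
  \int[mu]_(x in A `|` B) F x = \int[mu]_(x in A) F x + \int[mu]_(x in B) F x.
Proof.
move=> mA mB ABD AB.
have mAB := measurableU _ _ mA mB.
have AD : A `<=` D by move=> x Ax; apply: ABD; left.
have BD : B `<=` D by move=> x Bx; apply: ABD; right.
have S (h : T -> R) : (forall x, 0 <= h x) -> (forall x, h x <= `|F x|) ->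
    \int[mu]_(x in A `|` B) h x = \int[mu]_(x in A) h x + \int[mu]_(x in B) h x.
  move=> h0 hF; rewrite /Rintegral ge0_integral_lower_setU//; last first.
    by move=> x _; rewrite lee_fin.
  by rewrite fineD//; [case: (part_le mA AD h0 hF)|case: (part_le mB BD h0 hF)].
rewrite !RintegralE// !S//; ring.
Qed.

End dominated_nonmeasurable.

(** * Square-integrable random variables *)

Section square_integrable.
Context d (T : measurableType d) (R : realType).
Variable P : probability T R.
Implicit Types X Y H : T -> R.

Definition Ig X : Prop := P.-integrable setT (EFin \o X).
Definition Ex X : R := \int[P]_w X w.
Definition SQ X : Prop := measurable_fun setT X /\ Ig (fun w => X w ^+ 2).

Lemma Ig_meas X : Ig X -> measurable_fun setT X.
Proof. by move=> /measurable_int /measurable_EFinP. Qed.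

Lemma Ig_le X Y : measurable_fun setT X -> (forall w, `|X w| <= Y w) ->
  Ig Y -> Ig X.
Proof.
move=> mX XY; apply: le_integrable => //; first exact/measurable_EFinP.
by move=> w _ /=; rewrite lee_fin (le_trans (XY w))// ler_norm.
Qed.

Lemma Ig_cst c : Ig (fun=> c).
Proof. exact: finite_measure_integrable_cst. Qed.

Lemma IgD X Y : Ig X -> Ig Y -> Ig (fun w => X w + Y w).
Proof. by move=> iX iY; have := integrableD measurableT iX iY. Qed.

Lemma IgZ c X : Ig X -> Ig (fun w => c * X w).
Proof. by move=> iX; have := integrableZl measurableT c iX. Qed.

Lemma IgN X : Ig X -> Ig (fun w => - X w).
Proof. by move=> iX; have := integrableN iX. Qed.

Lemma IgB X Y : Ig X -> Ig Y -> Ig (fun w => X w - Y w).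
Proof. by move=> iX iY; apply: IgD => //; exact: IgN. Qed.

Lemma Ig_sum n (X : nat -> T -> R) : (forall i, (i < n)%N -> Ig (X i)) ->
  Ig (fun w => \sum_(i < n) X i w).
Proof.
elim: n => [|n IH] iX; first by under eq_fun do rewrite big_ord0; exact: Ig_cst.
under eq_fun do rewrite big_ord_recr/=.
by apply: IgD; [apply: IH => i ni; apply: iX; exact: ltnW|exact: iX].
Qed.

Lemma Ex_EFin X : Ig X -> ((Ex X)%:E = \int[P]_w (X w)%:E)%E.
Proof. by move=> iX; rewrite fineK//; exact: integrable_fin_num. Qed.

Lemma ExD X Y : Ig X -> Ig Y -> Ex (fun w => X w + Y w) = Ex X + Ex Y.
Proof. by move=> iX iY; exact: RintegralD. Qed.

Lemma ExB X Y : Ig X -> Ig Y -> Ex (fun w => X w - Y w) = Ex X - Ex Y.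
Proof. by move=> iX iY; exact: RintegralB. Qed.

Lemma ExZ c X : Ig X -> Ex (fun w => c * X w) = c * Ex X.
Proof. by move=> iX; exact: RintegralZl. Qed.

Lemma Ex_cst c : Ex (fun=> c) = c.
Proof. by rewrite /Ex /Rintegral/= integral_cst//= probability_setT mule1. Qed.

Lemma Ex_sum n (X : nat -> T -> R) : (forall i, (i < n)%N -> Ig (X i)) ->
  Ex (fun w => \sum_(i < n) X i w) = \sum_(i < n) Ex (X i).
Proof.
elim: n => [|n IH] iX.
  by under [fun w => _]eq_fun do rewrite big_ord0; rewrite big_ord0 Ex_cst.
under [fun w => _]eq_fun do rewrite big_ord_recr/=.
have iX' i : (i < n)%N -> Ig (X i) by move=> ni; apply: iX; exact: ltnW.
by rewrite ExD ?IH ?big_ord_recr//=; [exact: Ig_sum|exact: iX].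
Qed.

Lemma Ex_ge0 X : (forall w, 0 <= X w) -> 0 <= Ex X.
Proof. by move=> X0; apply: Rintegral_ge0. Qed.

Lemma Ex_le X Y : Ig X -> Ig Y -> (forall w, X w <= Y w) -> Ex X <= Ex Y.
Proof. by move=> iX iY XY; apply: le_Rintegral. Qed.

Lemma SQ_mul X Y : SQ X -> SQ Y -> Ig (fun w => X w * Y w).
Proof.
move=> [mX iX] [mY iY]; apply: Ig_le (IgD iX iY).
  exact: measurable_funM.
by move=> w; rewrite ler_norml; apply/andP; split; nra.
Qed.

Lemma SQ_le X Y : measurable_fun setT X -> (forall w, `|X w| <= `|Y w|) ->
  SQ Y -> SQ X.
Proof.
move=> mX XY [mY iY]; split => //; apply: Ig_le iY; first exact: measurable_funX.
by move=> w; rewrite normrX -(real_normK (num_real (Y w))) lerXn2r// nnegrE.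
Qed.

Lemma SQ_cst c : SQ (fun=> c).
Proof. by split; [exact: measurable_cst|exact: Ig_cst]. Qed.

Lemma SQZ c X : SQ X -> SQ (fun w => c * X w).
Proof.
move=> [mX iX]; split; first exact: measurable_funM.
by under eq_fun do rewrite exprMn; exact: IgZ.
Qed.

Lemma SQD X Y : SQ X -> SQ Y -> SQ (fun w => X w + Y w).
Proof.
move=> sX sY; have [mX iX] := sX; have [mY iY] := sY.
split; first exact: measurable_funD.
under eq_fun do rewrite sqrrD.
apply: IgD => //; apply: IgD => //.
under eq_fun do rewrite -mulr_natl.
exact/IgZ/SQ_mul.
Qed.

Lemma SQN X : SQ X -> SQ (fun w => - X w).
Proof. by move=> /(SQZ (-1)); under [fun w => _ * _]eq_fun do rewrite mulN1r. Qed.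

Lemma SQB X Y : SQ X -> SQ Y -> SQ (fun w => X w - Y w).
Proof. by move=> sX sY; apply: SQD => //; exact: SQN. Qed.

Lemma SQ_sum n (X : nat -> T -> R) : (forall i, (i < n)%N -> SQ (X i)) ->
  SQ (fun w => \sum_(i < n) X i w).
Proof.
elim: n => [|n IH] iX; first by under eq_fun do rewrite big_ord0; exact: SQ_cst.
under eq_fun do rewrite big_ord_recr/=.
by apply: SQD; [apply: IH => i ni; apply: iX; exact: ltnW|exact: iX].
Qed.

Lemma SQ_bmul H X (c : R) : measurable_fun setT H -> (forall w, `|H w| <= c) ->
  SQ X -> SQ (fun w => H w * X w).
Proof.
move=> mH Hc sX; have [mX _] := sX.
apply: SQ_le (SQZ c sX); first exact: measurable_funM.
by move=> w; rewrite !normrM ler_wpM2r// (le_trans (Hc w))// ler_norm.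
Qed.

Lemma Ig_bmul H X (c : R) : measurable_fun setT H -> (forall w, `|H w| <= c) ->
  Ig X -> Ig (fun w => H w * X w).
Proof.
move=> mH Hc iX; have mX := Ig_meas iX.
have : Ig (fun w => c * `|X w|) by apply: IgZ; exact: integrable_norm iX.
apply: Ig_le; first exact: measurable_funM.
by move=> w; rewrite normrM ler_wpM2r.
Qed.

Lemma SQ_Ig X : SQ X -> Ig X.
Proof. by move=> /(SQ_mul (SQ_cst 1)); under eq_fun do rewrite mul1r. Qed.

Lemma SQ_abs X : SQ X -> SQ (fun w => `|X w|).
Proof.
move=> sX; have [mX _] := sX.
by apply: SQ_le sX => [|w]; [exact: measurableT_comp|rewrite normr_id].
Qed.

Lemma SQ_EFin X : measurable_fun setT X ->
  (\int[P]_w (X w ^+ 2)%:E < +oo)%E -> SQ X.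
Proof.
move=> mX iX; split=> //; apply/integrableP; split.
  by apply/measurable_EFinP; exact: measurable_funX.
by under eq_integral do rewrite /= ger0_norm ?sqr_ge0//.
Qed.

Lemma SQ_sqr X : SQ X -> Ig (fun w => X w ^+ 2).
Proof. by case. Qed.

Lemma Ex_dominated (X_ : nat -> T -> R) X Y :
  (forall n, measurable_fun setT (X_ n)) -> measurable_fun setT X -> Ig Y ->
  (forall n w, `|X_ n w| <= Y w) -> (forall w, X_ ^~ w @ \oo --> X w) ->
  Ex (X_ n) @[n --> \oo] --> Ex X.
Proof.
move=> mX_ mX iY XY Xc.
have [iX _ cX] : [/\ P.-integrable setT (EFin \o X),
    (\int[P]_w `|(EFin \o X_ n) w - (EFin \o X) w| @[n --> \oo] --> 0)%E &
    (\int[P]_w (EFin \o X_ n) w @[n --> \oo] --> \int[P]_w (EFin \o X) w)%E].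
  apply: (@dominated_convergence _ _ _ P setT measurableT (fun n => EFin \o X_ n) (EFin \o X)
    (EFin \o Y)) => //.
  - by move=> n; exact/measurable_EFinP.
  - exact/measurable_EFinP.
  - by apply/aeW => w _ /=; apply/cvg_EFin; [exact: nearW|exact: Xc].
  - by apply/aeW => w n _; rewrite /= lee_fin.
have iXn n : Ig (X_ n) by apply: Ig_le (XY n) iY.
exact: fine_cvg (eq_ind_r (fun l => _ --> l)%E cX (Ex_EFin iX)).
Qed.

Local Open Scope ereal_scope.

(** The integrable function max (X - Y) 0 is put between X - Y and A: linearity is applied on its
    left, and only monotonicity on its right, off the exceptional null set. *)
Lemma Ex_le_nonmeasurable X Y (A : T -> \bar R) : Ig X -> Ig Y ->
  (forall w, 0 <= A w) -> {ae P, forall w, (X w)%:E <= (Y w)%:E + A w} ->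
  (Ex X)%:E <= (Ex Y)%:E + \int[P]_w A w.
Proof.
move=> iX iY A0 [N [mN N0 XYA]].
have iXY := IgB iX iY.
pose Z w := Num.max (X w - Y w)%R 0%R.
have mZ : measurable_fun setT Z by apply: measurable_maxr => //; exact: Ig_meas.
have iZ : Ig Z.
  have : Ig (fun w => `|X w - Y w|)%R by exact: integrable_norm iXY.
  apply: Ig_le => // w; rewrite ger0_norm; last by rewrite le_max lexx orbT.
  by rewrite ge_max ler_norm normr_ge0.
have Z0 w : (0 <= Z w)%R by rewrite le_max lexx orbT.
have XYZ : (Ex X - Ex Y <= Ex Z)%R.
  by rewrite -ExB//; apply: Ex_le => // w; rewrite le_max lexx.
have ZA : (Ex Z)%:E <= \int[P]_w A w.
  rewrite Ex_EFin// (ge0_negligible_integral mN)//=.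
  - rewrite setTD [leLHS]integral_mkcond.
    apply: ge0_le_integral_lower => w _.
      by rewrite patchE; case: ifP => //= _; rewrite lee_fin.
    rewrite patchE; case: ifPn => [|//]; rewrite inE => Nw.
    have : (X w)%:E <= (Y w)%:E + A w by apply: contrapT => h; apply: Nw; exact: XYA.
    move: (A0 w); case: (A w) => [a| |] //=.
    + by rewrite -EFinD !lee_fin => a0 H; rewrite ge_max a0 andbT lerBlDl.
    + by move=> _ _; exact: leey.
  - by apply/measurable_EFinP.
  - by move=> w _; rewrite lee_fin.
apply: (@le_trans _ _ ((Ex Y)%:E + (Ex Z)%:E)); last by rewrite leeD2l.
by rewrite -EFinD lee_fin -lerBlDl.
Qed.

End square_integrable.

Section independent_pair.
Context d (T : measurableType d) (R : realType).
Variable P : probability T R.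
Variables X Y : {mfun T >-> R}.
Hypothesis indep : forall A B : set R, measurable A -> measurable B ->
  P (X @^-1` A `&` Y @^-1` B) = (P (X @^-1` A) * P (Y @^-1` B))%E.

Let XY w := (X w, Y w).
Let mXY : measurable_fun setT XY. Proof. exact: measurable_fun_pair. Qed.
HB.instance Definition _ := isMeasurableFun.Build _ _ _ _ XY mXY.

(** Independence identifies the joint law with the product law on rectangles, and uniqueness of the
    product measure extends this to all measurable sets. Fubini's theorem then factors the
    expectation of the product. *)
Let joint (S : set (R * R)) : measurable S ->
  (distribution P X \x distribution P Y)%E S = distribution P XY S.
Proof.
apply: product_measure_unique => A B mA mB.
by rewrite /distribution /pushforward -indep.
Qed.

Let f (z : R * R) : \bar R := (z.1 * z.2)%:E.

Let mf : measurable_fun setT f.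
Proof.
apply/measurable_EFinP; apply: measurable_funM.
  exact: measurable_fst.
exact: measurable_snd.
Qed.

Let mfin (Z : {mfun T >-> R}) : Ig P Z ->
  (distribution P Z).-integrable setT (EFin : R -> \bar R).
Proof.
move=> iZ; have /integrableP[_ h] := iZ.
apply/integrableP; split; first exact/measurable_EFinP.
by rewrite ge0_integral_distribution//; exact: measurableT_comp.
Qed.

Let iXY : Ig P X -> Ig P Y ->
  (distribution P X \x distribution P Y)%E.-integrable setT f.
Proof.
move=> iX iY; apply: (@integrable12ltyP _ _ _ _ _ (distribution P X) (distribution P Y) f mf).2.
have /integrableP[_ hX] := mfin iX; have /integrableP[_ hY] := mfin iY.
rewrite (eq_integral (fun x : R => `|x|%:E *
    \int[distribution P Y]_y `|y|%:E))%E; last first.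
  move=> x _; rewrite -ge0_integralZl//=.
  - by apply: eq_integral => y _; rewrite /f/= -EFinM normrM.
  - exact/measurable_EFinP.
rewrite ge0_integralZr//=; last 2 first.
- exact/measurable_EFinP.
- exact: integral_ge0.
by apply: lte_mul_pinfty => //; [exact: integral_ge0|
  rewrite ge0_fin_numE//; exact: integral_ge0].
Qed.

Let Ig_indep_mfun : Ig P X -> Ig P Y ->
  Ig P (fun w => X w * Y w) /\ Ex P (fun w => X w * Y w) = Ex P X * Ex P Y.
Proof.
move=> iX iY; have iF := iXY iX iY.
have iXYP : Ig P (fun w => X w * Y w).
  apply/integrableP; split.
    by apply/measurable_EFinP; exact: measurable_funM.
  have /integrableP[_] := iF.
  rewrite (eq_measure_integral (distribution P XY)); last first.
    by move=> S mS _; exact: joint.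
  by rewrite ge0_integral_distribution//; exact: measurableT_comp.
split => //; apply: EFin_inj; rewrite Ex_EFin//.
transitivity (\int[distribution P XY]_z f z)%E.
  by rewrite integral_distribution.
rewrite (eq_measure_integral (distribution P X \x distribution P Y)%E); last first.
  by move=> S mS _; exact/esym/joint.
rewrite -integral12_prod_meas1// /fubini_F /f/=.
rewrite (eq_integral (fun x : R => x%:E * (Ex P Y)%:E))%E; last first.
  move=> x _; under eq_integral do rewrite EFinM.
  rewrite integralZl//=; last exact: mfin.
  by rewrite Ex_EFin// integral_distribution.
rewrite integralZr//=; last exact: mfin.
by rewrite EFinM integral_distribution// (Ex_EFin iX).
Qed.

Lemma Ig_indep : Ig P X -> Ig P Y -> Ig P (fun w => X w * Y w).
Proof. by move=> iX iY; case: (Ig_indep_mfun iX iY). Qed.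

Lemma Ex_indep : Ig P X -> Ig P Y -> Ex P (fun w => X w * Y w) = Ex P X * Ex P Y.
Proof. by move=> iX iY; case: (Ig_indep_mfun iX iY). Qed.

End independent_pair.

Lemma Ex_indep_fun d (T : measurableType d) (R : realType) (P : probability T R)
  (X Y : T -> R) :
  (forall A B : set R, measurable A -> measurable B ->
    P (X @^-1` A `&` Y @^-1` B) = (P (X @^-1` A) * P (Y @^-1` B))%E) ->
  Ig P X -> Ig P Y ->
  Ig P (fun w => X w * Y w) /\ Ex P (fun w => X w * Y w) = Ex P X * Ex P Y.
Proof.
move=> ind iX iY; have mX := Ig_meas iX; have mY := Ig_meas iY.
pose X' : {mfun T >-> R} := HB.pack X (isMeasurableFun.Build _ _ _ _ X mX).
pose Y' : {mfun T >-> R} := HB.pack Y (isMeasurableFun.Build _ _ _ _ Y mY).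
by split; [exact: (@Ig_indep _ _ _ P X' Y')|exact: (@Ex_indep _ _ _ P X' Y')].
Qed.

(** * Augmented Brownian filtration *)

Section augmented_filtration.
Context {R : realType} {dsp : measure_display} {Omega : measurableType dsp}.
Context (P : probability Omega R) {d : nat} (T : R).
Variable B : R -> {RV P >-> d.-tuple R}.
Hypothesis P_complete : measure_is_complete P.

Lemma past_measurable t (A : set Omega) : <<s past B t >> A -> measurable A.
Proof.
apply: smallest_sub; first exact: sigma_algebra_measurable.
move=> _ [s [U [_ mU ->]]].
by rewrite -[_ @^-1` _]setTI; exact: measurable_funP.
Qed.

(** Completeness of P is what makes the negligible sets added to the filtration events of Omega. *)
Lemma at_time_sub t (A : set Omega) :
  measurable (A : set (at_time B t)) -> measurable A.
Proof.
apply: smallest_sub; first exact: sigma_algebra_measurable.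
move=> C [[s [U [_ mU ->]]]|nC]; last exact: P_complete.
by rewrite -[_ @^-1` _]setTI; exact: measurable_funP.
Qed.

Lemma at_time_funW t d' (S : measurableType d') (X : Omega -> S) :
  measurable_fun setT (X : at_time B t -> S) -> measurable_fun setT X.
Proof.
move=> mX _ U mU; apply: (@at_time_sub t).
by have := mX measurableT _ mU.
Qed.

Lemma at_time_le s t d' (S : measurableType d') (X : Omega -> S) : s <= t ->
  measurable_fun setT (X : at_time B s -> S) ->
  measurable_fun setT (X : at_time B t -> S).
Proof.
move=> st mX _ U mU; have := mX measurableT _ mU.
apply: sub_sigma_algebra2 => C [[r [V [/andP[r0 rs] mV ->]]]|nC]; last by right.
by left; exists r, V; split => //; rewrite r0 (le_trans rs).
Qed.

Lemma at_time_past s t : 0 <= s <= t ->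
  measurable_fun setT (B s : at_time B t -> d.-tuple R).
Proof.
move=> st _ U mU; rewrite setTI; apply: sub_sigma_algebra; left.
by exists s, U.
Qed.

(** The sets that agree with one of the raw filtration off a measurable null set form a
    sigma-algebra, and it contains both the raw generators and the negligible sets. This carries the
    independence of increments from the raw to the augmented filtration. *)
Lemma at_time_approx t (A : set Omega) : measurable (A : set (at_time B t)) ->
  exists A' N, [/\ <<s past B t >> A', measurable N, P N = 0%E &
    A `\` N = A' `\` N].
Proof.
have [s0 sC sU] := smallest_sigma_algebra (@setT Omega) (past B t).
pose G := [set A | exists A' N, [/\ <<s past B t >> A', measurable N, P N = 0%E &
    A `\` N = A' `\` N]].
apply: (@smallest_sub _ _ _ G).
  split.
  - by exists set0, set0; split.
  - move=> C [C' [N [sC' mN N0 CN]]]; exists (setT `\` C'), N; split => //.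
      exact: sC.
    apply/seteqP; split => w [[_ h] nN]; split => //; split => // h'; apply: h.
      by have : (C' `\` N) w by []; rewrite -CN => -[].
    by have : (C `\` N) w by []; rewrite CN => -[].
  - move=> F GF.
    have /choice[F' hF'] : forall n, exists F', exists N,
        [/\ <<s past B t >> F', measurable N, P N = 0%E & F n `\` N = F' `\` N].
      by move=> n; exact: GF.
    have /choice[N hN] : forall n, exists N,
        [/\ <<s past B t >> (F' n), measurable N, P N = 0%E & F n `\` N = F' n `\` N].
      by move=> n; exact: hF'.
    exists (\bigcup_n F' n), (\bigcup_n N n); split.
    + by apply: sU => n; case: (hN n).
    + by apply: bigcupT_measurable => n; case: (hN n).
    + have : P.-negligible (\bigcup_n N n).
        apply: negligible_bigcup => n; case: (hN n) => _ mN N0 _.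
        by exists (N n); split.
      move=> /negligibleP; apply.
      by apply: bigcupT_measurable => n; case: (hN n).
    + apply/seteqP; split => w [[n _ Fn] nN]; split => //; exists n => //.
        have nNn : ~ N n w by move=> h; apply: nN; exists n.
        have : (F n `\` N n) w by [].
        by case: (hN n) => _ _ _ -> [].
      have nNn : ~ N n w by move=> h; apply: nN; exists n.
      have : (F' n `\` N n) w by [].
      by case: (hN n) => _ _ _ <- [].
move=> C [pC|[N [mN N0 CN]]].
  by exists C, set0; split => //; exact: sub_sigma_algebra.
exists set0, N; split => //.
by apply/seteqP; split => w [] // Cw nN; case: nN; exact: CN.
Qed.

Hypothesis hB : brownian T B.

Lemma at_time_indep s t (A : set Omega) (U : set (d.-tuple R)) :
  0 <= s -> s < t -> t <= T ->
  measurable (A : set (at_time B s)) -> measurable U ->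
  P (A `&` increment B s t @^-1` U) = (P A * P (increment B s t @^-1` U))%E.
Proof.
move=> s0 st tT mA mU.
have mI : measurable_fun setT (increment B s t).
  apply/measurable_fun_tnthP => i.
  rewrite (_ : _ \o _ = fun w => tnth (B t w) i - tnth (B s w) i); last first.
    by apply/funext => w /=; rewrite tnth_mktuple.
  by apply: measurable_funB; apply: (measurableT_comp (measurable_tnth i)).
have mV : measurable (increment B s t @^-1` U).
  by rewrite -[X in measurable X]setTI; exact: mI.
have [A' [N [sA' mN N0 AN]]] := at_time_approx mA.
have E (C : set Omega) : measurable C -> P C = P (C `\` N).
  move=> mC; rewrite measureD//=; last first.
    by rewrite (le_lt_trans (probability_le1 P mC))// ltry.
  have -> : P (C `&` N) = 0%E.
    apply: (subset_measure0 _ mN) => //; first exact: measurableI.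
  by rewrite sube0.
have mA0 := at_time_sub mA; have mA' := past_measurable sA'.
rewrite (E _ (measurableI _ _ mA0 mV)) (E _ mA0).
rewrite (_ : (A `&` _) `\` N = (A' `&` increment B s t @^-1` U) `\` N); last first.
  apply/seteqP; split => w [[Aw Uw] nN]; do 2 split => //.
    by have : (A `\` N) w by []; rewrite AN => -[].
  by have : (A' `\` N) w by []; rewrite -AN => -[].
rewrite -E; last exact: measurableI.
by rewrite AN -E// (bm_indep hB).
Qed.

Let inc s t i w : R := tnth (increment B s t w) i.

Lemma measurable_increment s t : measurable_fun setT (increment B s t).
Proof.
apply/measurable_fun_tnthP => i.
rewrite (_ : _ \o _ = fun w => tnth (B t w) i - tnth (B s w) i); last first.
  by apply/funext => w /=; rewrite tnth_mktuple.
by apply: measurable_funB; apply: (measurableT_comp (measurable_tnth i)).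
Qed.

Lemma measurable_inc s t i : measurable_fun setT (inc s t i).
Proof.
apply: (measurableT_comp (measurable_tnth i)); exact: measurable_increment.
Qed.

Lemma inc_id s i w : inc s s i w = 0.
Proof. by rewrite /inc tnth_mktuple subrr. Qed.

Section gaussian.
Variables (s t : R) (s0 : 0 <= s) (st : s < t) (tT : t <= T).
Let sg := Num.sqrt (t - s).

Let sg_gt0 : 0 < sg. Proof. by rewrite sqrtr_gt0 subr_gt0. Qed.

Lemma inc_law i (U : set R) : measurable U ->
  P (inc s t i @^-1` U) = normal_prob 0 sg U.
Proof.
move=> mU.
have := @bm_gauss _ _ _ _ _ _ _ hB s t s0 st tT
  (fun j => if j == i then U else setT).
move=> /(_ _)/wrap[j|]; first by case: ifP.
rewrite (bigD1 i)//= eqxx big1 ?mule1 => [<-|j /negbTE ->]; last exact: probability_setT.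
congr (P _); apply/seteqP; split => w /=.
  by move=> Uw j; case: ifPn => // /eqP ->.
by move/(_ i); rewrite eqxx.
Qed.

Lemma inc_law2 i j (U V : set R) : i != j -> measurable U -> measurable V ->
  P (inc s t i @^-1` U `&` inc s t j @^-1` V) =
  (P (inc s t i @^-1` U) * P (inc s t j @^-1` V))%E.
Proof.
move=> ij mU mV; rewrite !inc_law//.
have := @bm_gauss _ _ _ _ _ _ _ hB s t s0 st tT
  (fun k => if k == i then U else if k == j then V else setT).
move=> /(_ _)/wrap[k|]; first by case: ifP => // _; case: ifP.
rewrite (bigD1 i)//= eqxx (bigD1 j)/=; last by rewrite eq_sym.
rewrite eqxx (negbTE (_ : j != i)) ?[j == i]eq_sym//.
rewrite big1 ?mule1 => [<-|k /andP[/negbTE -> /negbTE ->]]; last exact: probability_setT.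
congr (P _); apply/seteqP; split => w /=.
  by move=> [Uw Vw] k; case: ifPn => [/eqP ->//|_]; case: ifPn => // /eqP ->.
by move=> h; have := h i; have := h j; rewrite !eqxx eq_sym (negbTE ij).
Qed.

(* [lebesgue_measure], hence [normal_prob], lives on [measurableTypeR R],
   whose display differs from the one of [R]. *)
Let incR i : {mfun Omega >-> measurableTypeR R} :=
  HB.pack (inc s t i : Omega -> measurableTypeR R)
    (isMeasurableFun.Build _ _ _ (measurableTypeR R) (inc s t i) (@measurable_inc s t i)).

Let law i (A : set (measurableTypeR R)) : measurable A ->
  distribution P (incR i) A = normal_prob 0 sg A.
Proof. exact: inc_law. Qed.

Local Lemma SQ_inc_lt i : SQ P (inc s t i).
Proof.
apply: SQ_EFin; first exact: measurable_inc.
rewrite -(@ge0_integral_distribution _ _ _ _ _ P (incR i) (fun x : measurableTypeR R => ((x : R) ^+ 2)%:E))//.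
- rewrite (eq_measure_integral (normal_prob 0 sg)); last by move=> A mA _; exact: law.
  by rewrite normal_prob_moment2// ltry.
- by apply/measurable_EFinP; exact: exprn_measurable.
- by move=> y; rewrite lee_fin sqr_ge0.
Qed.

Let Ex_inc_lt i : Ex P (inc s t i) = 0.
Proof.
rewrite /Ex /Rintegral.
rewrite -(@integral_distribution _ _ _ _ _ P (incR i) (EFin : measurableTypeR R -> \bar R))//.
- rewrite (eq_measure_integral (normal_prob 0 sg)); last by move=> A mA _; exact: law.
  by rewrite normal_prob_mean0.
- exact: SQ_Ig (SQ_inc_lt i).
Qed.

Let Ex_inc2_lt i j : Ex P (fun w => inc s t i w * inc s t j w) = (t - s) *+ (i == j).
Proof.
have [->|ij] := eqVneq i j.
  rewrite mulr1n /Ex /Rintegral.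
  rewrite -(@ge0_integral_distribution _ _ _ _ _ P (incR j) (fun x : measurableTypeR R => ((x : R) ^+ 2)%:E))//.
  - rewrite (eq_measure_integral (normal_prob 0 sg)); last by move=> A mA _; exact: law.
    by rewrite normal_prob_moment2//= sqr_sqrtr// subr_ge0 ltW.
  - by apply/measurable_EFinP; exact: exprn_measurable.
  - by move=> y; rewrite lee_fin sqr_ge0.
have [_ ->] := Ex_indep_fun (fun U V => @inc_law2 i j U V ij)
  (SQ_Ig (SQ_inc_lt i)) (SQ_Ig (SQ_inc_lt j)).
by rewrite Ex_inc_lt mul0r.
Qed.

Let Ex_adapted_fun (X : Omega -> R) (phi : d.-tuple R -> R) :
  measurable_fun setT (X : at_time B s -> R) -> measurable_fun setT phi ->
  Ig P X -> Ig P (phi \o increment B s t) ->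
  Ig P (fun w => X w * phi (increment B s t w)) /\
  Ex P (fun w => X w * phi (increment B s t w)) = Ex P X * Ex P (phi \o increment B s t).
Proof.
move=> mX mphi iX iphi.
apply: (@Ex_indep_fun _ _ _ P X (phi \o increment B s t)) => // U V mU mV.
rewrite comp_preimage; apply: at_time_indep => //.
  by have := mX measurableT U mU; rewrite setTI.
by rewrite -[X in measurable X]setTI; exact: mphi.
Qed.

Local Lemma mul_inc_lt i (X : Omega -> R) :
  measurable_fun setT (X : at_time B s -> R) -> Ig P X ->
  Ig P (fun w => X w * inc s t i w) /\ Ex P (fun w => X w * inc s t i w) = 0.
Proof.
move=> mX iX.
have [] := @Ex_adapted_fun X (fun z => tnth z i) mX (measurable_tnth i) iX _.
  exact: (SQ_Ig (SQ_inc_lt i)).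
by rewrite [Ex P (_ \o _)]Ex_inc_lt mulr0.
Qed.

Local Lemma mul_inc2_lt i j (X : Omega -> R) :
  measurable_fun setT (X : at_time B s -> R) -> Ig P X ->
  Ig P (fun w => X w * (inc s t i w * inc s t j w)) /\
  Ex P (fun w => X w * (inc s t i w * inc s t j w)) = Ex P X * ((t - s) *+ (i == j)).
Proof.
move=> mX iX.
have [] := @Ex_adapted_fun X (fun z => tnth z i * tnth z j) mX _ iX _.
- by apply: measurable_funM; exact: measurable_tnth.
- exact: SQ_mul (SQ_inc_lt i) (SQ_inc_lt j).
by rewrite [Ex P (_ \o _)]Ex_inc2_lt.
Qed.

End gaussian.

(** The case s = t, on which [bm_gauss] is silent, is included here and below because clipping the
    grid of a simple process to a time interval creates degenerate cells. *)
Lemma SQ_inc s t i : 0 <= s -> s <= t -> t <= T -> SQ P (inc s t i).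
Proof.
move=> s0; rewrite le_eqVlt => /predU1P[->|st] tT; last exact: SQ_inc_lt.
rewrite (_ : inc t t i = fun=> 0); first exact: SQ_cst.
by apply/funext => w; rewrite inc_id.
Qed.

Lemma Ig_mul_inc s t i (X : Omega -> R) : 0 <= s -> s <= t -> t <= T ->
  measurable_fun setT (X : at_time B s -> R) -> Ig P X ->
  Ig P (fun w => X w * inc s t i w).
Proof.
move=> s0; rewrite le_eqVlt => /predU1P[->|st] tT mX iX; last first.
  by have [] := mul_inc_lt s0 st tT i mX iX.
by under eq_fun do rewrite inc_id mulr0; exact: Ig_cst.
Qed.

Lemma Ex_mul_inc s t i (X : Omega -> R) : 0 <= s -> s <= t -> t <= T ->
  measurable_fun setT (X : at_time B s -> R) -> Ig P X ->
  Ex P (fun w => X w * inc s t i w) = 0.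
Proof.
move=> s0; rewrite le_eqVlt => /predU1P[->|st] tT mX iX; last first.
  by have [] := mul_inc_lt s0 st tT i mX iX.
by under eq_fun do rewrite inc_id mulr0; rewrite Ex_cst.
Qed.

Lemma Ig_mul_inc2 s t i j (X : Omega -> R) : 0 <= s -> s <= t -> t <= T ->
  measurable_fun setT (X : at_time B s -> R) -> Ig P X ->
  Ig P (fun w => X w * (inc s t i w * inc s t j w)).
Proof.
move=> s0; rewrite le_eqVlt => /predU1P[->|st] tT mX iX; last first.
  by have [] := mul_inc2_lt s0 st tT i j mX iX.
by under eq_fun do rewrite inc_id !(mulr0,mul0r); exact: Ig_cst.
Qed.

Lemma Ex_mul_inc2 s t i j (X : Omega -> R) : 0 <= s -> s <= t -> t <= T ->
  measurable_fun setT (X : at_time B s -> R) -> Ig P X ->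
  Ex P (fun w => X w * (inc s t i w * inc s t j w)) = Ex P X * ((t - s) *+ (i == j)).
Proof.
move=> s0; rewrite le_eqVlt => /predU1P[->|st] tT mX iX; last first.
  by have [] := mul_inc2_lt s0 st tT i j mX iX.
by under eq_fun do rewrite inc_id !(mulr0,mul0r); rewrite Ex_cst subrr mul0rn mulr0.
Qed.

End augmented_filtration.

(** Clipping both ends of ]a, b] to [s, t] gives the ends of its intersection with ]s, t], or a
    single point; the right-hand side has the shape in which Lebesgue measure gives the length of
    that intersection. *)
Lemma clip_diff (R : realType) (s t a b : R) : s <= t -> a <= b ->
  Num.max s (Num.min b t) - Num.max s (Num.min a t) =
  if Num.max s a < Num.min t b then Num.min t b - Num.max s a else 0.
Proof.
move=> st ab.
have [bt|tb] := leP b t; have [at_|ta] := leP a t; rewrite ?(max_idPr st).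
- by have [sb|bs] := leP s b; have [sa|as_] := leP s a; case: ltP; lra.
- by exfalso; lra.
- by have [sa|as_] := leP s a; case: ltP; lra.
- by have [sa|as_] := leP s a; case: ltP; lra.
Qed.

(** * Ito integral *)

Section simple_integral.
Context {R : realType} {dsp : measure_display} {Omega : measurableType dsp}.
Context (P : probability Omega R) {d : nat} (T : R).
Variable B : R -> {RV P >-> d.-tuple R}.
Hypothesis P_complete : measure_is_complete P.
Hypothesis hB : brownian T B.
Variable H : simple_process T B.
Let n := sp_size H.
Let g := sp_grid H.
Let coef i k w : R := tnth (sp_coef H i w) k.

Lemma sp_grid_nd i j : (i <= j)%N -> (j <= n)%N -> g i <= g j.
Proof.
elim: j => [|j IH]; first by rewrite leqn0 => /eqP ->.
rewrite leq_eqVlt => /predU1P[->//|]; rewrite ltnS => ij jn.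
by apply: le_trans (sp_grid_le jn); apply: IH => //; exact: ltnW.
Qed.

(** The cells of the grid are pairwise disjoint, so at most one of them contains r and the square
    meets no cross terms. *)
Lemma sqr_vnorm_sp_value r w : vnorm (sp_value H r w) ^+ 2 =
  \sum_(i < n) (if g i < r <= g i.+1 then \sum_(k < d) coef i k w ^+ 2 else 0).
Proof.
rewrite /vnorm sqr_sqrtr; last by apply: sumr_ge0 => k _; exact: sqr_ge0.
under eq_bigr do rewrite tnth_mktuple.
have [i0 /andP[r1 r2]|nor] := pickP [pred i : 'I_n | g i < r <= g i.+1].
  have off (i : 'I_n) : i != i0 -> (g i < r <= g i.+1) = false.
    move=> ii0; apply/negbTE/negP => /andP[q1 q2].
    have : (i < i0)%N || (i0 < i)%N by rewrite -neq_ltn.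
    move=> /orP[lt|lt].
      have : g i.+1 <= g i0 by apply: sp_grid_nd => //; exact: ltnW.
      by move=> h; move: (lt_le_trans r1 (le_trans q2 h)); rewrite ltxx.
    have : g i0.+1 <= g i by apply: sp_grid_nd => //; exact: ltnW.
    by move=> h; move: (lt_le_trans q1 (le_trans r2 h)); rewrite ltxx.
  rewrite [RHS](bigD1 i0)//= r1 r2/= [X in _ = _ + X]big1 ?addr0; last first.
    by move=> i /off ->.
  apply: eq_bigr => k _; rewrite (bigD1 i0)//= -/g r1 r2/= big1 ?addr0//.
  by move=> i /off; rewrite -/g => ->.
rewrite [RHS]big1; last by move=> i _; have /= -> := nor i.
rewrite big1// => k _; rewrite big1 ?expr0n// => i _.
by have /= := nor i; rewrite -/g => ->.
Qed.

Variables (s t : R).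
Hypotheses (s_ge0 : 0 <= s) (le_st : s <= t) (t_leT : t <= T).
Let clip u := Num.max s (Num.min u t).
Let c i := clip (g i).
Let inc i k w : R := tnth (increment B (c i) (c i.+1) w) k.
Let D i w := \sum_(k < d) coef i k w * inc i k w.

Let clip_ge u : s <= clip u. Proof. by rewrite /clip le_max lexx. Qed.
Let clip_le u : clip u <= t. Proof. by rewrite /clip ge_max le_st ge_min lexx orbT. Qed.
Let clip_nd u v : u <= v -> clip u <= clip v.
Proof. by move=> uv; rewrite /clip le_max2// le_min2. Qed.
Let c_ge0 i : 0 <= c i. Proof. exact: le_trans (clip_ge _). Qed.
Let c_leT i : c i <= T. Proof. exact: le_trans (clip_le _) _. Qed.
Let c_le i : (i < n)%N -> c i <= c i.+1.
Proof. by move=> ni; apply: clip_nd; exact: sp_grid_le. Qed.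

(** A clipped cell that is not reduced to a point does not start before the original cell, so a
    coefficient known at time g i is also known at time c i. *)
Let clip_lt i : c i < c i.+1 -> g i <= c i.
Proof.
rewrite /c /clip => h; rewrite le_max; apply/orP; right; rewrite le_min lexx/=.
rewrite leNgt; apply/negP => tg; move: h; rewrite (min_idPr (ltW tg)) ltNge.
by rewrite (max_idPr le_st) -/(clip _) clip_le.
Qed.

Lemma sp_integral_increment w :
  sp_integral H t w - sp_integral H s w = \sum_(i < n) D i w.
Proof.
rewrite /sp_integral -sumrB; apply: eq_bigr => i _.
rewrite -sumrB; apply: eq_bigr => k _; rewrite -mulrBr; congr (_ * _).
rewrite /inc !tnth_mktuple -/g.
pose b u := tnth (B u w) k.
(* The difference of the integrals up to t and up to s becomes an integral over the clipped grid;
   the term [b s] cancels between the two ends of a cell. *)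
have key u : b (Num.min u t) - b (Num.min u s) = b (clip u) - b s.
  rewrite /clip; have [us|su] := leP u s.
    rewrite (min_idPl (le_trans us le_st)) (max_idPl _); first by rewrite !subrr.
    by [].
  by rewrite (max_idPr _)// le_min le_st (ltW su).
rewrite -!/(b _) /c; have := key (g i); have := key (g i.+1); lra.
Qed.

Let mcoef i k : (i < n)%N ->
  measurable_fun setT (coef i k : at_time B (g i) -> R).
Proof.
by move=> ni; apply: (measurableT_comp (measurable_tnth k)); exact: sp_coef_meas.
Qed.

Let coef_bounded : exists M : R, forall i k w, (i < n)%N -> `|coef i k w| <= M.
Proof.
have [M hM] := sp_coef_bounded H; exists M => i k w ni.
apply: le_trans (hM i w ni); rewrite -sqrtr_sqr ler_sqrt; last first.
  by apply: sumr_ge0 => j _; exact: sqr_ge0.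
by rewrite (bigD1 k)//= lerDl sumr_ge0// => j _; exact: sqr_ge0.
Qed.

Let D_eq0 i : c i = c i.+1 -> D i = fun=> 0.
Proof.
move=> ci; apply/funext => w; rewrite /D big1// => k _.
by rewrite /inc -ci tnth_mktuple subrr mulr0.
Qed.

Let mB u k v : 0 <= u <= v -> measurable_fun setT ((fun w => tnth (B u w) k) : at_time B v -> R).
Proof.
by move=> uv; apply: (measurableT_comp (measurable_tnth k)); exact: at_time_past.
Qed.

Let minc i k : (i < n)%N -> measurable_fun setT (inc i k : at_time B (c i.+1) -> R).
Proof.
move=> ni; rewrite (_ : inc i k = fun w => tnth (B (c i.+1) w) k - tnth (B (c i) w) k); last first.
  by apply/funext => w; rewrite /inc tnth_mktuple.
by apply: measurable_funB; apply: mB; rewrite c_ge0 ?lexx ?c_le.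
Qed.

Let mcoefc i k u : (i < n)%N -> c i < c i.+1 -> c i <= u ->
  measurable_fun setT (coef i k : at_time B u -> R).
Proof.
move=> ni ci cu; apply: at_time_le (mcoef k ni).
exact: le_trans (clip_lt ci) cu.
Qed.

Let mD i : (i < n)%N -> measurable_fun setT (D i : at_time B (c i.+1) -> R).
Proof.
move=> ni; have := c_le ni; rewrite le_eqVlt => /predU1P[ci|ci].
  by rewrite D_eq0.
apply: measurable_sum => k; apply: measurable_funM; last exact: minc.
by apply: mcoefc => //; exact: c_le.
Qed.

Let mcoefW i k : (i < n)%N -> measurable_fun setT (coef i k).
Proof. by move=> ni; apply: (at_time_funW P_complete (mcoef k ni)). Qed.

Let SQ_incc i k : (i < n)%N -> SQ P (inc i k).
Proof. by move=> ni; apply: (SQ_inc hB) => //; exact: c_le. Qed.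

Lemma SQ_D i : (i < n)%N -> SQ P (D i).
Proof.
move=> ni; have [M hM] := coef_bounded.
(* The lemmas on sums take families indexed by natural numbers, so the coordinates are extended by 0
   outside 'I_d. The same device recurs below. *)
pose X k w := if (insub k : option 'I_d) is Some k' then coef i k' w * inc i k' w else 0.
rewrite (_ : D i = fun w => \sum_(k < d) X k w); last first.
  by apply/funext => w; apply: eq_bigr => k _; rewrite /X valK.
apply: SQ_sum => k kd; rewrite /X; case: insubP => [k' _ _|]; last by rewrite kd.
apply: (@SQ_bmul _ _ _ _ _ _ M) => //; [exact: mcoefW|by move=> w; exact: hM|exact: SQ_incc].
Qed.

Let S m w := \sum_(i < m) D i w.

Let mS m : (m <= n)%N -> measurable_fun setT (S m : at_time B (c m) -> R).
Proof.
elim: m => [|m IH] mn.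
  rewrite (_ : S 0%N = fun=> 0); first exact: measurable_cst.
  by apply/funext => w; rewrite /S big_ord0.
rewrite (_ : S m.+1 = fun w => S m w + D m w); last first.
  by apply/funext => w; rewrite /S big_ord_recr.
apply: measurable_funD; last exact: mD.
by apply: at_time_le (IH (ltnW mn)); exact: c_le.
Qed.

Let SQ_S m : (m <= n)%N -> SQ P (S m).
Proof. by move=> mn; apply: SQ_sum => i im; apply: SQ_D; exact: leq_trans im mn. Qed.

Let Ex_mul_D i (X : Omega -> R) : (i < n)%N ->
  measurable_fun setT (X : at_time B (c i) -> R) -> SQ P X ->
  Ex P (fun w => X w * D i w) = 0.
Proof.
move=> ni mX sX; have := c_le ni; rewrite le_eqVlt => /predU1P[ci|ci].
  by rewrite D_eq0//; under [fun w => _]eq_fun do rewrite mulr0; rewrite Ex_cst.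
have [M hM] := coef_bounded.
have sXc k : SQ P (fun w => coef i k w * X w).
  by apply: (@SQ_bmul _ _ _ _ _ _ M) => //; [exact: mcoefW|by move=> w; exact: hM].
have mXc k : measurable_fun setT ((fun w => coef i k w * X w) : at_time B (c i) -> R).
  by apply: measurable_funM => //; exact: mcoefc.
pose F k w := if (insub k : option 'I_d) is Some k' then coef i k' w * X w * inc i k' w else 0.
rewrite (_ : (fun w => X w * D i w) = fun w => \sum_(k < d) F k w); last first.
  apply/funext => w; rewrite mulr_sumr; apply: eq_bigr => k _.
  by rewrite /F valK mulrA [X w * _]mulrC.
rewrite Ex_sum.
  rewrite big1// => k _; rewrite /F; under [fun w => _]eq_fun do rewrite valK.
  apply: (Ex_mul_inc P_complete hB) => //; (exact: SQ_Ig || exact: c_le).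
move=> k kd; rewrite /F; case: insubP => [k' _ _|]; last by rewrite kd.
by apply: (Ig_mul_inc P_complete hB) => //; (exact: SQ_Ig || exact: c_le).
Qed.

Lemma Ex_sp_integral_increment (eta : Omega -> R) :
  measurable_fun setT (eta : at_time B s -> R) -> SQ P eta ->
  Ex P (fun w => eta w * (sp_integral H t w - sp_integral H s w)) = 0.
Proof.
move=> me se; under [fun w => _]eq_fun do rewrite sp_integral_increment mulr_sumr.
rewrite (@Ex_sum _ _ _ P n (fun i w => eta w * D i w)).
  rewrite big1// => i _; apply: Ex_mul_D => //.
  by apply: at_time_le me; exact: clip_ge.
by move=> i ni; apply: SQ_mul => //; exact: SQ_D.
Qed.

(** The square of the scalar product expands into pairs of coordinates. Off the diagonal the two
    increments are independent and centred, on it the mean square is the length of the cell. *)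
Let Ex_D2 i (X : Omega -> R) (M : R) : (i < n)%N ->
  measurable_fun setT (X : at_time B (c i) -> R) -> (forall w, `|X w| <= M) ->
  Ex P (fun w => X w * D i w ^+ 2) =
  Ex P (fun w => X w * \sum_(k < d) coef i k w ^+ 2) * (c i.+1 - c i).
Proof.
move=> ni mX XM; have := c_le ni; rewrite le_eqVlt => /predU1P[ci|ci].
  rewrite -ci subrr mulr0 D_eq0//.
  by under [fun w => _]eq_fun do rewrite expr0n mulr0; rewrite Ex_cst.
have [M' hM] := coef_bounded.
have mXW : measurable_fun setT X by exact: (at_time_funW P_complete mX).
have bXc k l : SQ P (fun w => X w * (coef i k w * coef i l w)).
  apply: (@SQ_bmul _ _ _ _ _ _ M) => //.
  apply: (@SQ_bmul _ _ _ _ _ _ M') => //; [exact: mcoefW|by move=> w; exact: hM|].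
  apply: SQ_le (SQ_cst P M'); first exact: mcoefW.
  by move=> w; apply: le_trans (hM _ _ _ ni) (ler_norm _).
have mXc k l : measurable_fun setT ((fun w => X w * (coef i k w * coef i l w)) : at_time B (c i) -> R).
  by apply: measurable_funM => //; apply: measurable_funM; exact: mcoefc.
pose F k l w := if (insub k : option 'I_d) is Some k' then
  if (insub l : option 'I_d) is Some l' then
   X w * (coef i k' w * coef i l' w) * (inc i k' w * inc i l' w) else 0 else 0.
have iF k l : (k < d)%N -> (l < d)%N -> Ig P (F k l).
  move=> kd ld; rewrite /F; case: insubP => [k' _ _|]; last by rewrite kd.
  case: insubP => [l' _ _|]; last by rewrite ld.
  by apply: (Ig_mul_inc2 P_complete hB) => //; (exact: SQ_Ig || exact: c_le).
rewrite (_ : (fun w => X w * D i w ^+ 2) = fun w => \sum_(k < d) \sum_(l < d) F k l w); last first.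
  apply/funext => w; rewrite expr2 mulr_suml mulr_sumr; apply: eq_bigr => k _.
  rewrite mulr_sumr mulr_sumr; apply: eq_bigr => l _; rewrite /F !valK; ring.
rewrite (@Ex_sum _ _ _ P d (fun k w => \sum_(l < d) F k l w)); last first.
  by move=> k kd; apply: Ig_sum => l ld; exact: iF.
pose F' k w := if (insub k : option 'I_d) is Some k' then X w * (coef i k' w * coef i k' w) else 0.
rewrite (_ : (fun w => X w * \sum_(k < d) coef i k w ^+ 2) = fun w => \sum_(k < d) F' k w); last first.
  by apply/funext => w; rewrite mulr_sumr; apply: eq_bigr => k _; rewrite /F' valK expr2.
rewrite Ex_sum; last first.
  by move=> k kd; rewrite /F'; case: insubP => [k' _ _|]; [exact: SQ_Ig|rewrite kd].
rewrite mulr_suml; apply: eq_bigr => k _.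
rewrite (@Ex_sum _ _ _ P d (F k)); last by move=> l ld; exact: iF.
rewrite (bigD1 k)//= big1 ?addr0.
  rewrite /F /F'; under [fun w => _]eq_fun do rewrite valK.
  under [in RHS]eq_fun do rewrite valK.
  rewrite (Ex_mul_inc2 P_complete hB) ?eqxx ?mulr1n//; (exact: SQ_Ig || exact: c_le).
move=> l lk; rewrite /F; under [fun w => _]eq_fun do rewrite !valK.
rewrite (Ex_mul_inc2 P_complete hB) ?(eq_sym k) ?(negbTE lk) ?mulr0n ?mulr0//; (exact: SQ_Ig || exact: c_le).
Qed.

Lemma Ex_sp_integral_sqr (eta : Omega -> R) (M : R) :
  measurable_fun setT (eta : at_time B s -> R) -> (forall w, `|eta w| <= M) ->
  Ex P (fun w => eta w * (sp_integral H t w - sp_integral H s w) ^+ 2) =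
  \sum_(i < n) Ex P (fun w => eta w * \sum_(k < d) coef i k w ^+ 2) * (c i.+1 - c i).
Proof.
move=> me eM; have meW := at_time_funW P_complete me.
under [fun w => _]eq_fun do rewrite sp_integral_increment -/(S n _).
(* Induction on the number of cells: eta and the partial sum [S m] are known at time [c m], so the
   cross term with [D m] has mean zero. *)
suff : forall m, (m <= n)%N -> Ex P (fun w => eta w * S m w ^+ 2) =
  \sum_(i < m) Ex P (fun w => eta w * \sum_(k < d) coef i k w ^+ 2) * (c i.+1 - c i).
  exact.
elim=> [|m IH] mn.
  rewrite big_ord0; under [fun w => _]eq_fun do rewrite /S big_ord0 expr0n mulr0.
  exact: Ex_cst.
have mn' := ltnW mn.
rewrite big_ord_recr/= -IH// -(@Ex_D2 m eta M)//; last first.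
  by apply: at_time_le me; exact: clip_ge.
have sS := SQ_S mn'; have sD := SQ_D mn.
have sES : SQ P (fun w => eta w * S m w) by exact: SQ_bmul eM sS.
have := @Ex_mul_D m (fun w => eta w * S m w) mn _ sES.
move=> /(_ _)/wrap[|h0].
  by apply: measurable_funM; [apply: at_time_le me; exact: clip_ge|exact: mS].
have i1 : Ig P (fun w => eta w * S m w ^+ 2) by apply: Ig_bmul eM _ => //; case: sS.
have i2 : Ig P (fun w => eta w * D m w ^+ 2) by apply: Ig_bmul eM _ => //; case: sD.
have i3 : Ig P (fun w => eta w * S m w * D m w) by exact: SQ_mul.
rewrite (_ : (fun w => eta w * S m.+1 w ^+ 2) = fun w =>
    (eta w * S m w ^+ 2 + eta w * D m w ^+ 2) + 2 * (eta w * S m w * D m w)); last first.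
  by apply/funext => w; rewrite /S big_ord_recr/= -/(S m w); ring.
by rewrite ExD ?ExD ?ExZ// ?h0 ?mulr0 ?addr0//; [exact: IgD|exact: IgZ].
Qed.

Lemma integral_sqr_sp_value w :
  (\int[lebesgue_measure]_(r in `]s, t]) (vnorm (sp_value H r w) ^+ 2)%:E =
   (\sum_(i < n) (\sum_(k < d) coef i k w ^+ 2) * (c i.+1 - c i))%:E)%E.
Proof.
under eq_integral do rewrite sqr_vnorm_sp_value -sumEFin.
have ge0 i : 0 <= \sum_(k < d) coef i k w ^+ 2 by apply: sumr_ge0 => k _; exact: sqr_ge0.
have itvE i : [set r | g i < r <= g i.+1] = `]g i, g i.+1]%classic.
  by apply/seteqP; split => r /=; rewrite in_itv.
have fE i r : (if g i < r <= g i.+1 then \sum_(k < d) coef i k w ^+ 2 else 0) =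
    (\sum_(k < d) coef i k w ^+ 2) * \1_(`]g i, g i.+1]%classic) r.
  rewrite indicE; case: ifPn => h.
    by rewrite mem_set ?mulr1//= in_itv.
  by rewrite memNset ?mulr0//= in_itv; apply/negP.
rewrite ge0_integral_sum//=; last 2 first.
- move=> i; apply/measurable_EFinP; apply: measurable_funTS.
  rewrite (_ : (fun _ => _) = fun r => (\sum_(k < d) coef i k w ^+ 2) *
     \1_(`]g i, g i.+1]%classic) r); last by apply/funext => r; exact: fE.
  by apply: measurable_funM => //; exact: measurable_indic.
- by move=> i r _; rewrite lee_fin; case: ifP.
rewrite -sumEFin; apply: eq_bigr => i _.
under eq_integral do rewrite fE EFinM.
rewrite ge0_integralZl//=; last 2 first.
- by apply/measurable_EFinP; apply: measurable_funTS; exact: measurable_indic.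
- by rewrite lee_fin.
rewrite integral_indic//= EFinM; congr (_ * _)%E.
rewrite (_ : _ `&` _ = `]Num.max s (g i), Num.min t (g i.+1)]%classic); last first.
  apply/seteqP; split => r /=; rewrite !in_itv/= gt_max le_min.
    by move=> [/andP[-> ->] /andP[-> ->]].
  by move=> /andP[/andP[-> ->] /andP[-> ->]].
have gi : g i <= g i.+1 by exact: sp_grid_le.
rewrite lebesgue_measure_itv/= lte_fin /c /clip clip_diff//.
by case: ifP.
Qed.

(** A bounded weight known at time s turns the isometry into its conditional form; the stopping
    weights of the energy estimate will take the place of eta. *)
Lemma sp_isometry (eta : Omega -> R) (M : R) :
  measurable_fun setT (eta : at_time B s -> R) -> (forall w, 0 <= eta w <= M) ->
  (\int[P]_w (eta w * (sp_integral H t w - sp_integral H s w) ^+ 2)%:E =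
   \int[P]_w ((eta w)%:E *
     \int[lebesgue_measure]_(r in `]s, t]) (vnorm (sp_value H r w) ^+ 2)%:E))%E.
Proof.
move=> me e0M; have meW := at_time_funW P_complete me.
have eM w : `|eta w| <= M by have /andP[e0 eM] := e0M w; rewrite ger0_norm.
have [M' hM] := coef_bounded.
have icoef i : (i < n)%N -> Ig P (fun w => eta w * \sum_(k < d) coef i k w ^+ 2).
  move=> ni; apply: Ig_bmul eM _ => //.
  pose F k w := if (insub k : option 'I_d) is Some k' then coef i k' w ^+ 2 else 0.
  rewrite (_ : (fun w => _) = fun w => \sum_(k < d) F k w); last first.
    by apply/funext => w; apply: eq_bigr => k _; rewrite /F valK.
  apply: Ig_sum => k kd; rewrite /F; case: insubP => [k' _ _|]; last by rewrite kd.
  have : SQ P (coef i k').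
    apply: SQ_le (SQ_cst P M'); first exact: mcoefW.
    by move=> w; apply: le_trans (hM _ _ _ ni) (ler_norm _).
  by case.
have sI : SQ P (fun w => sp_integral H t w - sp_integral H s w).
  rewrite (_ : (fun w => _) = S n); first exact: SQ_S.
  by apply/funext => w; exact: sp_integral_increment.
rewrite -Ex_EFin; last by apply: Ig_bmul eM _ => //; case: sI.
rewrite (Ex_sp_integral_sqr me eM).
under eq_integral do rewrite integral_sqr_sp_value -EFinM.
pose G i w := (c i.+1 - c i) * (eta w * \sum_(k < d) coef i k w ^+ 2).
rewrite (_ : (fun w => _) = fun w => (\sum_(i < n) G i w)%:E); last first.
  apply/funext => w; rewrite mulr_sumr; congr EFin; apply: eq_bigr => i _.
  by rewrite /G; ring.
rewrite -Ex_EFin; last by apply: Ig_sum => i ni; apply: IgZ; exact: icoef.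
rewrite Ex_sum; last by move=> i ni; apply: IgZ; exact: icoef.
by congr EFin; apply: eq_bigr => i _; rewrite ExZ 1?mulrC//; exact: icoef.
Qed.

Lemma SQ_sp_integral_increment :
  SQ P (fun w => sp_integral H t w - sp_integral H s w).
Proof.
rewrite (_ : (fun w => _) = S n); first exact: SQ_S.
by apply/funext => w; exact: sp_integral_increment.
Qed.

Lemma sp_integral_increment_adapted :
  measurable_fun setT
    ((fun w => sp_integral H t w - sp_integral H s w) : at_time B t -> R).
Proof.
rewrite (_ : (fun w => _) = S n).
  by apply: at_time_le (mS (leqnn n)); exact: clip_le.
by apply/funext => w; exact: sp_integral_increment.
Qed.

End simple_integral.

(** * Joint measurability in time and outcome, and Tonelli's theorem *)

Section joint_measurability.
Context {R : realType} {dsp : measure_display} {Omega : measurableType dsp}.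
Context (P : probability Omega R) (T : R).

(** Time is taken in [measurableTypeR R], the type that carries Lebesgue measure, so that sections,
    Tonelli's theorem and measurability of time integrals are all available from this one
    property. *)
Definition jmeas (X : R -> Omega -> R) : Prop :=
  measurable_fun (`[0, T]%classic `*` [set: Omega])
    (fun p : measurableTypeR R * Omega => X p.1 p.2).

Let mU : measurable (`[0, T]%classic `*` [set: Omega] : set (measurableTypeR R * Omega)).
Proof. by apply: measurableX. Qed.

Let patch_meas (X : R -> Omega -> R) (D : set (measurableTypeR R)) : jmeas X ->
  measurable D -> D `<=` `[0, T]%classic ->
  measurable_fun setT (fun p : measurableTypeR R * Omega =>
    ((fun q => (X q.1 q.2)%:E) \_ (D `*` setT)) p).
Proof.
move=> mX mD DT; apply/(measurable_restrictT _ _).1.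
  exact: measurableX.
apply/measurable_EFinP; apply: measurable_funS mX => //.
by move=> p [Dp _]; split => //; exact: DT.
Qed.

Let patch_ge0 (X : R -> Omega -> R) (D : set (measurableTypeR R)) :
  (forall r w, D r -> 0 <= X r w) -> forall p : measurableTypeR R * Omega,
  (0 <= ((fun q => (X q.1 q.2)%:E) \_ (D `*` setT)) p)%E.
Proof.
by move=> X0 p; rewrite patchE; case: ifPn => // /set_mem [Dp _]; rewrite lee_fin X0.
Qed.

Let patch_app (X : R -> Omega -> R) (D : set (measurableTypeR R)) r w :
  ((fun q : measurableTypeR R * Omega => (X q.1 q.2)%:E) \_ (D `*` setT)) (r, w) =
    if r \in D then (X r w)%:E else 0%E.
Proof.
rewrite patchE; have [Dr|nDr] := boolP (r \in D).
  by rewrite mem_set//; split => //; exact: set_mem.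
by rewrite memNset// => -[/mem_set h _]; rewrite h in nDr.
Qed.

Lemma jmeas_integral (X : R -> Omega -> R) (D : set (measurableTypeR R)) :
  jmeas X -> measurable D -> D `<=` `[0, T]%classic -> (forall r w, D r -> 0 <= X r w) ->
  measurable_fun setT (fun w => \int[lebesgue_measure]_(r in D) (X r w)%:E)%E.
Proof.
move=> mX mD DT X0.
have := @measurable_fun_fubini_tonelli_G _ _ _ _ R (lebesgue_measure : {measure set (measurableTypeR R) -> \bar R})
  _ (patch_meas mX mD DT) (patch_ge0 X0).
apply: eq_measurable_fun => w _; rewrite /fubini_G [RHS]integral_mkcond.
by apply: eq_integral => r _; rewrite patch_app patchE.
Qed.

Lemma jmeas_tonelli (X : R -> Omega -> R) (D : set (measurableTypeR R)) :
  jmeas X -> measurable D -> D `<=` `[0, T]%classic -> (forall r w, D r -> 0 <= X r w) ->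
  (\int[lebesgue_measure]_(r in D) \int[P]_w (X r w)%:E =
   \int[P]_w \int[lebesgue_measure]_(r in D) (X r w)%:E)%E.
Proof.
move=> mX mD DT X0.
have := @fubini_tonelli _ _ _ _ R (lebesgue_measure : {sigma_finite_measure set (measurableTypeR R) -> \bar R})
  P _ (patch_meas mX mD DT) (patch_ge0 X0).
move=> H; rewrite integral_mkcond; etransitivity; first last.
  etransitivity; first exact: H.
  apply: eq_integral => w _; rewrite [RHS]integral_mkcond; apply: eq_integral => r _.
  by rewrite patch_app patchE.
apply: eq_integral => r _; rewrite patchE; under [RHS]eq_integral do rewrite patch_app.
by case: ifPn => // _; rewrite integral0.
Qed.

Lemma jmeas_integralP (X : R -> Omega -> R) (D : set (measurableTypeR R)) :
  jmeas X -> measurable D -> D `<=` `[0, T]%classic -> (forall r w, D r -> 0 <= X r w) ->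
  measurable_fun D (fun r => \int[P]_w (X r w)%:E)%E.
Proof.
move=> mX mD DT X0.
have := @measurable_fun_fubini_tonelli_F _ _ _ _ R P _ (patch_meas mX mD DT) (patch_ge0 X0).
move=> /(@measurable_funTS _ _ _ _ D); apply: eq_measurable_fun => r rD.
by apply: eq_integral => w _; rewrite patch_app rD.
Qed.

Lemma jmeas_section (X : R -> Omega -> R) w : jmeas X ->
  measurable_fun (`[0, T]%classic : set (measurableTypeR R)) (fun r => X r w).
Proof.
move=> mX; have h := @pair2_measurable _ _ (measurableTypeR R) Omega w.
apply: (@measurable_comp _ _ _ _ _ _ _ (fun p : measurableTypeR R * Omega => X p.1 p.2)
  _ (fun r => (r, w)) mU _ mX) => //.
- by move=> _ [r rT <-].
- exact: measurable_funTS h.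
Qed.

Lemma jmeasD X Y : jmeas X -> jmeas Y -> jmeas (fun r w => X r w + Y r w).
Proof. by move=> mX mY; exact: measurable_funD. Qed.

Lemma jmeasB X Y : jmeas X -> jmeas Y -> jmeas (fun r w => X r w - Y r w).
Proof. by move=> mX mY; exact: measurable_funB. Qed.

Lemma jmeasM X Y : jmeas X -> jmeas Y -> jmeas (fun r w => X r w * Y r w).
Proof. by move=> mX mY; exact: measurable_funM. Qed.

Lemma jmeas_norm X : jmeas X -> jmeas (fun r w => `|X r w|).
Proof. by move=> mX; exact: (measurableT_comp (@normr_measurable R setT) mX). Qed.

Lemma jmeas_max X Y : jmeas X -> jmeas Y -> jmeas (fun r w => Num.max (X r w) (Y r w)).
Proof. by move=> mX mY; exact: measurable_maxr. Qed.

Lemma jmeas_cst c : jmeas (fun _ _ => c).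
Proof. exact: measurable_cst. Qed.

Lemma jmeas_time (h : R -> R) :
  measurable_fun (`[0, T]%classic : set (measurableTypeR R)) h -> jmeas (fun r _ => h r).
Proof.
move=> mh; apply: (@measurable_comp _ _ _ _ _ _ _ h _ fst _ _ mh) => //.
- by move=> _ [p [pT _] <-].
- exact: measurable_funTS measurable_fst.
Qed.

Lemma jmeas_rv (h : Omega -> R) : measurable_fun setT h -> jmeas (fun _ w => h w).
Proof.
move=> mh; apply: (measurableT_comp mh).
exact: measurable_funTS measurable_snd.
Qed.

Lemma jmeas_sqrt X : jmeas X -> jmeas (fun r w => Num.sqrt (X r w)).
Proof.
move=> mX; apply: (measurableT_comp _ mX).
by apply: continuous_measurable_fun; exact: sqrt_continuous.
Qed.

Lemma jmeas_sum n (X : 'I_n -> R -> Omega -> R) : (forall i, jmeas (X i)) ->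
  jmeas (fun r w => \sum_(i < n) X i r w).
Proof. by move=> mX; exact: measurable_sum. Qed.

Lemma jmeas_vdist d (X Y : R -> Omega -> d.-tuple R) :
  (forall k, jmeas (fun r w => tnth (X r w) k)) ->
  (forall k, jmeas (fun r w => tnth (Y r w) k)) ->
  jmeas (fun r w => vdist (X r w) (Y r w)).
Proof.
move=> mX mY; apply: jmeas_sqrt; apply: jmeas_sum => k.
have mXY := jmeasB (mX k) (mY k); exact: (jmeasM mXY mXY).
Qed.

Lemma jmeas_vnorm d (X : R -> Omega -> d.-tuple R) :
  (forall k, jmeas (fun r w => tnth (X r w) k)) ->
  jmeas (fun r w => vnorm (X r w)).
Proof.
move=> mX; apply: jmeas_sqrt; apply: jmeas_sum => k.
exact: jmeasM (mX k) (mX k).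
Qed.

End joint_measurability.

(** Linearity is applied to b and c alone; passing from a to the combination is monotonicity of a
    supremum over simple functions, so a may be any nonnegative function. *)
Lemma ge0_integral_le_comb d (S : measurableType d) (R : realType)
  (mu : {measure set S -> \bar R}) (D : set S) (a b c : S -> \bar R) (k1 k2 : R) :
  measurable D -> 0 <= k1 -> 0 <= k2 -> (forall x, D x -> 0 <= a x)%E ->
  (forall x, D x -> 0 <= b x)%E -> (forall x, D x -> 0 <= c x)%E ->
  measurable_fun D b -> measurable_fun D c ->
  (forall x, D x -> a x <= k1%:E * b x + k2%:E * c x)%E ->
  (\int[mu]_(x in D) a x <=
   k1%:E * \int[mu]_(x in D) b x + k2%:E * \int[mu]_(x in D) c x)%E.
Proof.
move=> mD k10 k20 a0 b0 c0 mb mc abc.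
rewrite -!ge0_integralZl// -ge0_integralD//; first exact: ge0_le_integral_lower.
- by move=> x Dx; rewrite mule_ge0 ?lee_fin// b0.
- by apply: emeasurable_funM.
- by move=> x Dx; rewrite mule_ge0 ?lee_fin// c0.
- by apply: emeasurable_funM.
Qed.

Lemma sqr_young (R : realType) (e a b : R) : 0 < e ->
  a ^+ 2 <= (1 + e) * b ^+ 2 + (1 + e^-1) * (a - b) ^+ 2.
Proof.
move=> e0; have h : 0 <= e^-1 * (e * b - (a - b)) ^+ 2.
  by rewrite mulr_ge0 ?sqr_ge0// invr_ge0 ltW.
have -> : (1 + e) * b ^+ 2 + (1 + e^-1) * (a - b) ^+ 2 =
  a ^+ 2 + e^-1 * (e * b - (a - b)) ^+ 2 by field; rewrite gt_eqF.
by rewrite lerDl.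
Qed.

Lemma sqrB_le (R : realType) (a b : R) : (a - b) ^+ 2 <= 2 * a ^+ 2 + 2 * b ^+ 2.
Proof. by have := sqr_ge0 (a + b); rewrite !expr2; nra. Qed.

(** This closes an approximation argument with two parameters: e, the slack in Young's inequality,
    is chosen first, and then r, the approximation error, small enough to beat 1/e. *)
Lemma young_limit (R : realType) (x y C : R) : 0 <= y -> 0 <= C ->
  (forall e r, 0 < e -> e <= 1 -> 0 < r ->
    x <= (1 + e) * ((1 + e) * y + (1 + e^-1) * (C * r)) + (1 + e^-1) * (C * r)) ->
  x <= y.
Proof.
move=> y0 C0 h; rewrite leNgt; apply/negP => yx.
have D0 : 0 < x - y by rewrite subr_gt0.
(* As e <= 1, the total error is at most 3 e y + 3 q with q = (1 + 1/e) C r. The choice of e bounds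
   the first term by (x - y) / 2, the choice of r below bounds the second one by (x - y) / 4. *)
pose e := Num.min 1 ((x - y) / (6 * (y + 1))).
have q0 : 0 < (x - y) / (6 * (y + 1)) by rewrite divr_gt0// mulr_gt0// ltr_wpDl.
have e0 : 0 < e by rewrite lt_min ltr01.
have e1 : e <= 1 by rewrite ge_min lexx.
have ey : e * y <= (x - y) / 6.
  have : e * (6 * (y + 1)) <= x - y.
    by rewrite -ler_pdivlMr ?ge_min ?lexx ?orbT// mulr_gt0// ltr_wpDl.
  by have := mulr_ge0 (ltW e0) y0; lra.
pose K := 1 + e^-1.
have K0 : 0 < K by rewrite addr_gt0// invr_gt0.
pose r := (x - y) / (12 * (K * (C + 1))).
have KC0 : 0 < K * (C + 1) by rewrite mulr_gt0// ltr_wpDl.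
have r0 : 0 < r by rewrite divr_gt0// mulr_gt0.
have KCr : K * (C * r) <= (x - y) / 12.
  have rK : r * (K * (C + 1)) = (x - y) / 12 by rewrite /r; field; rewrite !gt_eqF// ltr_wpDl.
  by have := mulr_gt0 K0 r0; nra.
have := h e r e0 e1 r0; rewrite -/K.
have KCr0 : 0 <= K * (C * r) by apply: mulr_ge0; [exact: ltW|apply: mulr_ge0 => //; exact: ltW].
move: KCr KCr0; set q := K * (C * r) => KCr KCr0.
have : (1 + e) * ((1 + e) * y + q) + q <= y + 3 * (e * y) + 3 * q.
  have ey0 := mulr_ge0 (ltW e0) y0.
  have : e * (e * y) <= e * y by rewrite ler_piMl.
  have : e * q <= q by rewrite ler_piMl.
  lra.
lra.
Qed.

Section ito.
Context {R : realType} {dsp : measure_display} {Omega : measurableType dsp}.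
Context (P : probability Omega R) {d : nat} (T : R).
Variable B : R -> {RV P >-> d.-tuple R}.
Hypothesis P_complete : measure_is_complete P.
Hypothesis hB : brownian T B.
Hypothesis T_ge0 : 0 <= T.
Variables (Z : R -> {RV P >-> d.-tuple R}) (M : R -> {RV P >-> R}).
Hypothesis mZ : forall k, jmeas T (fun r w => tnth (Z r w) k).
Hypothesis hZ : (norm2_H2 P T (fun t => Z t : Omega -> d.-tuple R) < +oo)%E.
Hypothesis hM : ito_integral T B Z M.

Lemma jmeas_sp_value (H : simple_process T B) k :
  jmeas T (fun r w => tnth (sp_value H r w) k).
Proof.
rewrite (_ : (fun _ _ => _) = fun r w => \sum_(i < sp_size H)
   (\1_(`]sp_grid H i, sp_grid H i.+1]%classic) r * tnth (sp_coef H i w) k)); last first.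
  apply/funext => r; apply/funext => w; rewrite tnth_mktuple; apply: eq_bigr => i _.
  rewrite indicE; case: ifPn => h; first by rewrite mem_set ?mul1r//= in_itv.
  by rewrite memNset ?mul0r//= in_itv; apply/negP.
apply: jmeas_sum => i; apply: jmeasM.
  by apply: jmeas_time; apply: measurable_funTS; exact: measurable_indic.
apply: jmeas_rv; apply: (measurableT_comp (measurable_tnth k)).
by apply: (at_time_funW P_complete (sp_coef_meas _)).
Qed.

Lemma sqr_vnormE (z : d.-tuple R) : vnorm z ^+ 2 = \sum_(k < d) tnth z k ^+ 2.
Proof. by rewrite sqr_sqrtr// sumr_ge0// => k _; exact: sqr_ge0. Qed.

Lemma sqr_vdistE (z1 z2 : d.-tuple R) :
  vdist z1 z2 ^+ 2 = \sum_(k < d) (tnth z1 k - tnth z2 k) ^+ 2.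
Proof. by rewrite sqr_sqrtr// sumr_ge0// => k _; exact: sqr_ge0. Qed.

Lemma vnorm_young (e : R) (z1 z2 : d.-tuple R) : 0 < e ->
  vnorm z1 ^+ 2 <= (1 + e) * vnorm z2 ^+ 2 + (1 + e^-1) * vdist z1 z2 ^+ 2.
Proof.
move=> e0; rewrite !sqr_vnormE sqr_vdistE !mulr_sumr -big_split/=.
by apply: ler_sum => k _; exact: sqr_young.
Qed.

Lemma vdistC (z1 z2 : d.-tuple R) : vdist z1 z2 = vdist z2 z1.
Proof. by congr Num.sqrt; apply: eq_bigr => k _; rewrite -sqrrN opprB. Qed.

(** Finitely many sequences tending to 0 are small simultaneously from some index on, so one simple
    process serves for Z and for M at all the times tau i. *)
Lemma ito_approx (N : nat) (tau : nat -> R) (e : R) : 0 < e ->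
  (forall i, (i <= N)%N -> tau i \in `[0, T]) ->
  exists H : simple_process T B,
    (\int[P]_w \int[lebesgue_measure]_(t in `[0%R, T])
       (vdist (sp_value H t w) (Z t w) ^+ 2)%:E <= e%:E)%E /\
    forall i, (i <= N)%N ->
      (\int[P]_w ((sp_integral H (tau i) w - M (tau i) w) ^+ 2)%:E <= e%:E)%E.
Proof.
move=> e0 tauT; have [_ [H [HZ HM]]] := hM.
have small (u : nat -> \bar R) : (u n @[n --> \oo] --> 0)%E ->
    \forall n \near \oo, (u n <= e%:E)%E.
  move=> u0; have [uf u0'] := (fine_cvgP _ _).1 u0.
  have : \forall n \near \oo, fine (u n) <= e.
    have /cvgrPdist_le/(_ _ e0) := u0'.
    by apply: filterS => n; rewrite sub0r normrN; apply: le_trans; exact: ler_norm.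
  by apply: filterS2 uf => n un; rewrite -lee_fin fineK.
have h1 := small _ HZ.
have h2 : \forall n \near \oo, forall i, (i <= N)%N ->
   (\int[P]_w ((sp_integral (H n) (tau i) w - M (tau i) w) ^+ 2)%:E <= e%:E)%E.
  elim: N tauT => [|N IH] tauT.
    by apply: filterS (small _ (HM _ (tauT 0%N isT))) => n hn i; rewrite leqn0 => /eqP ->.
  have := IH (fun i iN => tauT i (leqW iN)).
  apply: filterS2 (small _ (HM _ (tauT N.+1 (leqnn _)))) => n hn1 hn i.
  by rewrite leq_eqVlt => /predU1P[->//|]; rewrite ltnS; exact: hn.
have [n [? ?]] := @filter_ex _ _ _ _ (filterI h1 h2).
by exists (H n).
Qed.

Let incM s t w := M t w - M s w.

Let sZ r w := vnorm (Z r w) ^+ 2.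

Let jsZ : jmeas T sZ. Proof. exact: (jmeasM (jmeas_vnorm mZ) (jmeas_vnorm mZ)). Qed.

Let sub_itv s t : 0 <= s -> t <= T -> `]s, t]%classic `<=` `[0, T]%classic.
Proof.
move=> s0 tT r; rewrite /= !in_itv/= => /andP[sr rt].
by rewrite (le_trans s0 (ltW sr)) (le_trans rt tT).
Qed.

Lemma ito_approx_increment s t (H : simple_process T B) (e : R) : 0 <= s -> s <= t -> t <= T ->
  (\int[P]_w ((sp_integral H s w - M s w) ^+ 2)%:E <= e%:E)%E ->
  (\int[P]_w ((sp_integral H t w - M t w) ^+ 2)%:E <= e%:E)%E ->
  SQ P (fun w => (sp_integral H t w - sp_integral H s w) - (M t w - M s w)) /\
  Ex P (fun w => ((sp_integral H t w - sp_integral H s w) - (M t w - M s w)) ^+ 2) <= 4 * e.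
Proof.
move=> s0 st tT es et.
(* Grid points are nonnegative, so the simple integral vanishes at time 0 and its value at u is an
   increment. *)
have mI u : 0 <= u <= T -> measurable_fun setT (sp_integral H u).
  move=> /andP[u0 uT].
  have := (SQ_sp_integral_increment P_complete hB H (lexx 0) u0 uT).1.
  apply: eq_measurable_fun => w _; rewrite [X in _ - X](_ : _ = 0) ?subr0//.
  rewrite /sp_integral big1// => i _; rewrite big1// => k _.
  rewrite tnth_mktuple !(min_idPr _) ?subrr ?mulr0//.
    have := sp_grid_itv (ltnW (ltn_ord i)); by rewrite in_itv/= => /andP[].
  have := sp_grid_itv (ltn_ord i); by rewrite in_itv/= => /andP[].
have mI' u : 0 <= u <= T -> measurable_fun setT (fun w => sp_integral H u w - M u w).
  by move=> uT; apply: measurable_funB; first exact: mI.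
have sT : 0 <= s <= T by rewrite s0 (le_trans st).
have tT' : 0 <= t <= T by rewrite tT (le_trans s0).
have ss : SQ P (fun w => sp_integral H s w - M s w).
  by apply: SQ_EFin; [exact: mI'|exact: le_lt_trans es (ltry _)].
have stt : SQ P (fun w => sp_integral H t w - M t w).
  by apply: SQ_EFin; [exact: mI'|exact: le_lt_trans et (ltry _)].
have E w : (sp_integral H t w - sp_integral H s w) - incM s t w =
   (sp_integral H t w - M t w) - (sp_integral H s w - M s w).
  by rewrite /incM; ring.
under [X in SQ P X]eq_fun do rewrite E.
under [X in Ex P X]eq_fun do rewrite E.
split; first exact: SQB.
have h := (SQ_sqr (SQB stt ss)).
apply: (@le_trans _ _ (Ex P (fun w => 2 * (sp_integral H t w - M t w) ^+ 2 +
    2 * (sp_integral H s w - M s w) ^+ 2))).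
  apply: Ex_le => //; first by apply: IgD; apply: IgZ; exact: SQ_sqr.
  by move=> w; exact: sqrB_le.
rewrite ExD ?ExZ; try (try apply: IgZ; exact: SQ_sqr).
have -> : 4 * e = 2 * e + 2 * e by ring.
by apply: lerD; rewrite ler_pM2l// -lee_fin Ex_EFin//; exact: SQ_sqr.
Qed.

Lemma SQ_ito_increment s t : 0 <= s -> s <= t -> t <= T -> SQ P (incM s t).
Proof.
move=> s0 st tT; pose tau i := if i == 0%N then s else t.
have [|H [_ hH]] := @ito_approx 1 tau 1 ltr01.
  by move=> [|[|//]] _; rewrite /tau/= in_itv/= ?s0 ?tT ?(le_trans st)// (le_trans s0).
have [h _] := ito_approx_increment s0 st tT (hH 0%N isT) (hH 1%N isT).
have := SQB (SQ_sp_integral_increment P_complete hB H s0 st tT) h.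
rewrite (_ : (fun w => _) = incM s t)//; apply/funext => w; rewrite /incM; ring.
Qed.

Lemma Ex_ito_increment s t (eta : Omega -> R) : 0 <= s -> s <= t -> t <= T ->
  measurable_fun setT (eta : at_time B s -> R) -> SQ P eta ->
  Ex P (fun w => eta w * (M t w - M s w)) = 0.
Proof.
move=> s0 st tT me se; pose tau i := if i == 0%N then s else t.
have sM := SQ_ito_increment s0 st tT.
have E0 := Ex_ge0 P (fun w => sqr_ge0 (eta w)).
(* The approximation is taken of order e^2. The approximating integral contributes 0, and its error
   X has mean square at most 4 e^2, so |eta X| <= e eta^2 + X^2 / (4 e) gives the bound after taking
   expectations. *)
have key e : 0 < e -> `|Ex P (fun w => eta w * (M t w - M s w))| <=
    e * (Ex P (fun w => eta w ^+ 2) + 1).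
  move=> e0; have e20 : 0 < e ^+ 2 by rewrite exprn_gt0.
  have [|H [_ hH]] := @ito_approx 1 tau (e ^+ 2) e20.
    by move=> [|[|//]] _; rewrite /tau/= in_itv/= ?s0 ?tT ?(le_trans st)// (le_trans s0).
  have [h hE] := ito_approx_increment s0 st tT (hH 0%N isT) (hH 1%N isT).
  have sI := SQ_sp_integral_increment P_complete hB H s0 st tT.
  have -> : Ex P (fun w => eta w * (M t w - M s w)) =
    - Ex P (fun w => eta w * ((sp_integral H t w - sp_integral H s w) - incM s t w)).
    rewrite -[RHS]addr0 -(Ex_sp_integral_increment P_complete hB H s0 st tT me se) addrC.
    rewrite -ExB; [|exact: SQ_mul|exact: SQ_mul].
    by congr (Ex P _); apply/funext => w; rewrite /incM; ring.
  rewrite normrN; set X := (fun w => _ - incM s t w) in h hE *.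
  have iX : Ig P (fun w => eta w * X w) by exact: SQ_mul.
  have i1 : Ig P (fun w => e * eta w ^+ 2 + (4 * e)^-1 * X w ^+ 2).
    by apply: IgD; apply: IgZ; exact: SQ_sqr.
  have b : Ex P (fun w => e * eta w ^+ 2 + (4 * e)^-1 * X w ^+ 2) <=
      e * (Ex P (fun w => eta w ^+ 2) + 1).
    rewrite ExD ?ExZ; try (try apply: IgZ; exact: SQ_sqr).
    rewrite mulrDr lerD2l mulr1 ler_pdivrMl ?mulr_gt0//.
    by apply: le_trans hE _; rewrite le_eqVlt; apply/orP; left; apply/eqP; ring.
  have pt w : e * eta w ^+ 2 + (4 * e)^-1 * X w ^+ 2 =
      e * (eta w - (2 * e)^-1 * X w) ^+ 2 + eta w * X w.
    by field; rewrite gt_eqF.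
  have pt' w : e * eta w ^+ 2 + (4 * e)^-1 * X w ^+ 2 =
      e * (eta w + (2 * e)^-1 * X w) ^+ 2 - eta w * X w.
    by field; rewrite gt_eqF.
  rewrite ler_norml; apply/andP; split; last first.
    by apply: le_trans b; apply: Ex_le => // w; rewrite pt lerDr mulr_ge0 ?sqr_ge0 ?ltW.
  rewrite lerNl -mulN1r -ExZ//; apply: le_trans b; apply: Ex_le => //; first exact: IgZ.
  by move=> w; rewrite pt' mulN1r lerDr mulr_ge0 ?sqr_ge0 ?ltW.
apply/eqP; rewrite -normr_le0; apply/ler_addgt0Pr => e e0.
rewrite add0r; set c := Ex P (fun w => eta w ^+ 2) + 1 in key.
have c0 : 0 < c by rewrite ltr_wpDl.
by have := key _ (divr_gt0 e0 c0); rewrite divfK// gt_eqF.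
Qed.

(** Only in the error term is eta replaced by its bound C and ]s, t] by [0, T], which makes the
    squared H^2 distance of the two processes appear. *)
Let int_young (X1 X2 : R -> Omega -> d.-tuple R) (eta : Omega -> R) s t (C e : R) :
  (forall k, jmeas T (fun r w => tnth (X1 r w) k)) ->
  (forall k, jmeas T (fun r w => tnth (X2 r w) k)) ->
  measurable_fun setT eta -> (forall w, 0 <= eta w <= C) ->
  0 <= s -> t <= T -> 0 < e ->
  (\int[P]_w ((eta w)%:E * \int[lebesgue_measure]_(r in `]s, t]) (vnorm (X1 r w) ^+ 2)%:E) <=
   (1 + e)%:E * (\int[P]_w ((eta w)%:E *
     \int[lebesgue_measure]_(r in `]s, t]) (vnorm (X2 r w) ^+ 2)%:E)) +
   ((1 + e^-1) * C)%:E * \int[P]_w \int[lebesgue_measure]_(r in `[0%R, T])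
     (vdist (X1 r w) (X2 r w) ^+ 2)%:E)%E.
Proof.
move=> m1 m2 me e0C s0 tT e0.
have C0 : 0 <= C by have /andP[] := e0C point; exact: le_trans.
have Ke : 0 <= 1 + e^-1 by rewrite addr_ge0 ?invr_ge0 ?ltW.
have e10 : 0 <= 1 + e by rewrite addr_ge0// ltW.
have j2 := jmeas_vnorm m2; have j12 := jmeas_vdist m1 m2.
have jj2 := jmeasM j2 j2; have jj12 := jmeasM j12 j12.
have sub := @sub_itv s t s0 tT.
have mX2 : measurable_fun setT (fun w =>
    \int[lebesgue_measure]_(r in `]s, t]) (vnorm (X2 r w) ^+ 2)%:E)%E.
  by apply: (jmeas_integral jj2) => // r w _; rewrite -expr2 sqr_ge0.
have mIT : measurable_fun setT (fun w =>
    \int[lebesgue_measure]_(r in `[0%R, T]) (vdist (X1 r w) (X2 r w) ^+ 2)%:E)%E.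
  by apply: (jmeas_integral jj12) => // r w _; rewrite -expr2 sqr_ge0.
have I0 (h : R -> R) (D : set (measurableTypeR R)) :
    (0 <= \int[lebesgue_measure]_(r in D) (h r ^+ 2)%:E)%E.
  by apply: integral_ge0 => r _; rewrite lee_fin sqr_ge0.
have eta0 w : 0 <= eta w by have /andP[] := e0C w.
have meE : measurable_fun setT (fun w => (eta w)%:E) by exact/measurable_EFinP.
apply: ge0_integral_le_comb => //.
- by rewrite mulr_ge0.
- by move=> w _; rewrite mule_ge0 ?lee_fin ?I0.
- by move=> w _; rewrite mule_ge0 ?lee_fin ?I0.
- exact: emeasurable_funM.
move=> w _.
have le1 : (\int[lebesgue_measure]_(r in `]s, t]) (vnorm (X1 r w) ^+ 2)%:E <=
   (1 + e)%:E * \int[lebesgue_measure]_(r in `]s, t]) (vnorm (X2 r w) ^+ 2)%:E +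
   (1 + e^-1)%:E * \int[lebesgue_measure]_(r in `]s, t]) (vdist (X1 r w) (X2 r w) ^+ 2)%:E)%E.
  apply: ge0_integral_le_comb => //.
  - by move=> r _; rewrite lee_fin sqr_ge0.
  - by move=> r _; rewrite lee_fin sqr_ge0.
  - by move=> r _; rewrite lee_fin sqr_ge0.
  - by apply/measurable_EFinP; exact: measurable_funS (jmeas_section w jj2).
  - by apply/measurable_EFinP; exact: measurable_funS (jmeas_section w jj12).
  - by move=> r _; rewrite -!EFinM -EFinD lee_fin vnorm_young.
apply: (le_trans (lee_wpmul2l _ le1)); first by rewrite lee_fin.
rewrite ge0_muleDr ?mule_ge0 ?lee_fin ?I0//.
rewrite muleCA; apply: leeD => //.
rewrite EFinM muleCA -muleA; apply: lee_wpmul2l; first by rewrite lee_fin.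
apply: lee_pmul; rewrite ?lee_fin ?I0//; first by have /andP[] := e0C w.
apply: ge0_subset_integral => //.
  by apply/measurable_EFinP; exact: jmeas_section w jj12.
by move=> r _; rewrite lee_fin sqr_ge0.
Qed.

(** Both sides are compared with their common value for an approximating simple process, up to
    factors 1 + e and errors proportional to r; [young_limit] removes these in either direction,
    once the right-hand side is known to be finite. *)
Lemma ito_isometry s t (eta : Omega -> R) (C : R) : 0 <= s -> s <= t -> t <= T ->
  measurable_fun setT (eta : at_time B s -> R) -> (forall w, 0 <= eta w <= C) ->
  (\int[P]_w (eta w * (M t w - M s w) ^+ 2)%:E =
   \int[P]_w ((eta w)%:E * \int[lebesgue_measure]_(r in `]s, t]) (vnorm (Z r w) ^+ 2)%:E))%E.
Proof.
move=> s0 st tT me e0C; have meW := at_time_funW P_complete me.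
have C0 : 0 <= C by have /andP[] := e0C point; exact: le_trans.
have eta0 w : 0 <= eta w by have /andP[] := e0C w.
have eC w : `|eta w| <= C by rewrite ger0_norm//; have /andP[] := e0C w.
have sM := SQ_ito_increment s0 st tT.
have iM : Ig P (fun w => eta w * (M t w - M s w) ^+ 2).
  by apply: Ig_bmul eC _ => //; exact: SQ_sqr sM.
have mI : measurable_fun setT (fun w =>
    \int[lebesgue_measure]_(r in `]s, t]) (vnorm (Z r w) ^+ 2)%:E)%E.
  apply: (jmeas_integral jsZ) => //; first exact: sub_itv.
  by move=> r w _; rewrite /sZ sqr_ge0.
set V := (RHS).
have V0 : (0 <= V)%E.
  apply: integral_ge0 => w _; rewrite mule_ge0 ?lee_fin//.
  by apply: integral_ge0 => r _; rewrite lee_fin sqr_ge0.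
have mIT : measurable_fun setT (fun w =>
    \int[lebesgue_measure]_(r in `[0%R, T]) (vnorm (Z r w) ^+ 2)%:E)%E.
  by apply: (jmeas_integral jsZ) => // r w _; rewrite /sZ sqr_ge0.
have Vfin : V \is a fin_num.
  rewrite ge0_fin_numE//.
  apply: (@le_lt_trans _ _ (\int[P]_w (C%:E *
      \int[lebesgue_measure]_(r in `[0%R, T]) (vnorm (Z r w) ^+ 2)%:E))%E); last first.
    rewrite ge0_integralZl//; last first.
      by move=> w _; apply: integral_ge0 => r _; rewrite lee_fin sqr_ge0.
    by apply: lte_mul_pinfty; rewrite ?lee_fin.
  apply: ge0_le_integral => //.
  - move=> w _; rewrite mule_ge0 ?lee_fin//.
    by apply: integral_ge0 => r _; rewrite lee_fin sqr_ge0.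
  - by apply: emeasurable_funM => //; exact/measurable_EFinP.
  - by apply: emeasurable_funM => //; exact: measurable_cst.
  move=> w _; apply: lee_pmul; rewrite ?lee_fin//.
  + by apply: integral_ge0 => r _; rewrite lee_fin sqr_ge0.
  + by have /andP[] := e0C w.
  apply: ge0_subset_integral => //; [|by move=> r _; rewrite lee_fin sqr_ge0|exact: sub_itv].
  by apply/measurable_EFinP; exact: jmeas_section w jsZ.
have VE : V = (fine V)%:E by rewrite fineK.
rewrite -Ex_EFin// VE; congr EFin.
pose u := Ex P (fun w => eta w * (M t w - M s w) ^+ 2).
have u0 : 0 <= u by apply: Ex_ge0 => w; rewrite mulr_ge0 ?sqr_ge0.
have v0 : 0 <= fine V by rewrite fine_ge0.
pose tau i := if i == 0%N then s else t.
have step e r : 0 < e -> 0 < r -> exists a,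
  [/\ u <= (1 + e) * a + (1 + e^-1) * (4 * C * r),
      a <= (1 + e) * u + (1 + e^-1) * (4 * C * r),
      a <= (1 + e) * fine V + (1 + e^-1) * (4 * C * r) &
      fine V <= (1 + e) * a + (1 + e^-1) * (4 * C * r)].
  move=> e0 r0; have Ke : 0 <= 1 + e^-1 by rewrite addr_ge0 ?invr_ge0 ?ltW.
  have [|H [hZH hH]] := @ito_approx 1 tau r r0.
    by move=> [|[|//]] _; rewrite /tau/= in_itv/= ?s0 ?tT ?(le_trans st)// (le_trans s0).
  have [h hE] := ito_approx_increment s0 st tT (hH 0%N isT) (hH 1%N isT).
  have sI := SQ_sp_integral_increment P_complete hB H s0 st tT.
  have iI : Ig P (fun w => eta w * (sp_integral H t w - sp_integral H s w) ^+ 2).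
    by apply: Ig_bmul eC _ => //; exact: SQ_sqr sI.
  set X := (fun w => _ - incM s t w) in h hE.
  have iX : Ig P (fun w => C * X w ^+ 2) by apply: IgZ; exact: SQ_sqr.
  have EX : Ex P (fun w => C * X w ^+ 2) <= 4 * C * r.
    rewrite ExZ; last exact: SQ_sqr.
    by rewrite [leRHS](_ : _ = C * (4 * r)) ?ler_wpM2l//; ring.
  have cmp U1 U2 : Ig P (fun w => eta w * U1 w ^+ 2) -> Ig P (fun w => eta w * U2 w ^+ 2) ->
      (forall w, X w ^+ 2 = (U1 w - U2 w) ^+ 2) ->
      Ex P (fun w => eta w * U1 w ^+ 2) <=
      (1 + e) * Ex P (fun w => eta w * U2 w ^+ 2) + (1 + e^-1) * (4 * C * r).
    move=> i1 i2 XU.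
    apply: (@le_trans _ _ (Ex P (fun w => (1 + e) * (eta w * U2 w ^+ 2) +
        (1 + e^-1) * (C * X w ^+ 2)))).
      apply: Ex_le => //; first by apply: IgD; exact: IgZ.
      move=> w; rewrite XU; have := sqr_young (U1 w) (U2 w) e0.
      move=> /(ler_wpM2l (eta0 w)); move/le_trans; apply.
      rewrite mulrDr; apply: lerD; first by rewrite mulrCA.
      rewrite mulrCA ler_wpM2l// ler_wpM2r ?sqr_ge0//.
      by have /andP[] := e0C w.
    rewrite ExD; [|exact: IgZ|exact: IgZ].
    by rewrite (ExZ _ i2) (ExZ _ iX) lerD2l ler_wpM2l.
  exists (Ex P (fun w => eta w * (sp_integral H t w - sp_integral H s w) ^+ 2)).
  have iso := sp_isometry P_complete hB H s0 st tT me e0C.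
  rewrite -Ex_EFin// in iso.
  have zz : (((1 + e^-1) * C)%:E * (\int[P]_w \int[lebesgue_measure]_(t in `[0%R, T])
       (vdist (sp_value H t w) (Z t w) ^+ 2)%:E) <= ((1 + e^-1) * (4 * C * r))%:E)%E.
    apply: (@le_trans _ _ (((1 + e^-1) * C)%:E * r%:E)%E).
      by apply: lee_wpmul2l => //; rewrite lee_fin mulr_ge0.
    rewrite -EFinM lee_fin; have := mulr_ge0 Ke (mulr_ge0 C0 (ltW r0)); lra.
  split.
  - apply: cmp => // w; rewrite /X /incM -[RHS]sqrrN; congr (_ ^+ 2); ring.
  - by apply: cmp => // w; rewrite /X /incM.
  - rewrite -lee_fin iso EFinD EFinM -VE; apply: le_trans (leeD2l _ zz).
    apply: (@int_young (sp_value H) (fun r w => Z r w) eta s t C e) => //.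
    exact: jmeas_sp_value.
  - rewrite -lee_fin -VE EFinD EFinM iso; apply: le_trans (leeD2l _ zz).
    under [X in (_ <= _ + _ * X)%E]eq_integral do under eq_integral do rewrite vdistC.
    apply: (@int_young (fun r w => Z r w) (sp_value H) eta s t C e) => //.
    exact: jmeas_sp_value.
have C40 : 0 <= 4 * C by rewrite mulr_ge0.
apply/eqP; rewrite eq_le; apply/andP; split.
  apply: (young_limit v0 C40) => e r e0 _ r0; have [a [h1 _ h3 _]] := step e r e0 r0.
  apply: (le_trans h1); rewrite lerD2r ler_wpM2l//.
  by rewrite addr_ge0 ?ltW.
apply: (young_limit u0 C40) => e r e0 _ r0; have [a [_ h2 _ h4]] := step e r e0 r0.
apply: (le_trans h4); rewrite lerD2r ler_wpM2l//.
by rewrite addr_ge0 ?ltW.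
Qed.

End ito.

(** * Maximal inequalities *)

Section discrete_paths.
Context {R : realType}.
Implicit Types (L a y m e : nat -> R).

Fixpoint runmax L n : R :=
  if n is n'.+1 then Num.max (runmax L n') `|L n| else `|L 0%N|.

Lemma runmax_ge L i n : (i <= n)%N -> `|L i| <= runmax L n.
Proof.
elim: n => [|n IH]; first by rewrite leqn0 => /eqP ->.
rewrite leq_eqVlt => /predU1P[->|]; first by rewrite /= le_max lexx orbT.
by rewrite ltnS => /IH h; rewrite /= le_max h.
Qed.

Lemma runmax_ge0 L n : 0 <= runmax L n.
Proof. by apply: le_trans (runmax_ge L (leqnn n)). Qed.

Lemma runmax_le L n c : (forall i, (i <= n)%N -> `|L i| <= c) -> runmax L n <= c.
Proof.
elim: n => [|n IH] h; first exact: h.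
by rewrite /= ge_max IH ?h// => i ni; apply: h; exact: leqW.
Qed.

Lemma runmax_nd L i n : (i <= n)%N -> runmax L i <= runmax L n.
Proof. by move=> ni; apply: runmax_le => j ji; apply: runmax_ge; exact: leq_trans ni. Qed.

Lemma runmax_le_sum L n : runmax L n <= \sum_(i < n.+1) `|L i|.
Proof.
elim: n => [|n IH] /=; first by rewrite big_ord_recl big_ord0 addr0.
rewrite big_ord_recr/= ge_max lerDr sumr_ge0// andbT.
by apply: le_trans IH _; rewrite lerDl.
Qed.

(* Pathwise form of Doob's maximal inequality in L2. *)
Lemma doob_path L n : L 0%N = 0 ->
  runmax L n ^+ 2 <= 4 * L n ^+ 2 -
    4 * \sum_(i < n) runmax L i * Num.sg (L i) * (L i.+1 - L i).
Proof.
move=> L0; have key : runmax L n ^+ 2 <= 2 * runmax L n * `|L n| -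
    2 * \sum_(i < n) runmax L i * Num.sg (L i) * (L i.+1 - L i).
  elim: n => [|n IH]; first by rewrite big_ord0 /= L0 normr0; lra.
  rewrite big_ord_recr/=.
  move: IH; set S := \sum_(i < n) _; have := runmax_ge0 L n.
  have := runmax_ge L (leqnn n).
  have : Num.sg (L n) * (L n.+1 - L n) <= `|L n.+1| - `|L n|.
    rewrite mulrBr -normrEsg lerD2r; apply: le_trans (ler_norm _) _.
    by rewrite normrM normr_sg; case: eqP; rewrite ?mul0r ?mul1r.
  set M := runmax L n; set s := Num.sg _ * _; rewrite -[M * _ * _]mulrA -/s.
  move=> hs hM M0 IH; have hMs := ler_wpM2l M0 hs; rewrite mulrBr in hMs.
  have l0 := normr_ge0 (L n.+1).
  case: (leP M `|L n.+1|) => h; last by lra.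
  have := sqr_ge0 (`|L n.+1| - M); rewrite !expr2 in IH *; lra.
have := sqr_ge0 (runmax L n - 2 * `|L n|).
have : `|L n| ^+ 2 = L n ^+ 2 by rewrite real_normK// num_real.
move: key; rewrite !expr2; set S := \sum_(i < n) _; lra.
Qed.

(** Summation by parts leaves the boundary term [a j * L j.+1] and increments of L's weights a,
    which are nonnegative and sum to at most [a j]; each of the two parts is bounded by A B. *)
Lemma abel_bound L a n (A B : R) : L 0%N = 0 -> 0 <= a 0%N ->
  (forall i, a i <= a i.+1) -> (forall i, (i <= n)%N -> a i <= A) ->
  (forall i, (i <= n)%N -> `|L i| <= B) ->
  forall k, (k <= n)%N -> `|\sum_(i < k) a i * (L i.+1 - L i)| <= 2 * A * B.
Proof.
move=> L0 a0 and_ aA LB k kn.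
have B0 : 0 <= B by apply: le_trans (LB 0%N isT).
have A0 : 0 <= A by apply: le_trans (aA 0%N isT).
have a_ge0 i : 0 <= a i by elim: i => // i IH; apply: le_trans IH _.
have key j : (j < n)%N -> `|\sum_(i < j.+1) a i * (L i.+1 - L i) - a j * L j.+1| <= a j * B.
  elim: j => [|j IH] jn.
    by rewrite big_ord_recl big_ord0 addr0 L0 subr0 subrr normr0 mulr_ge0.
  rewrite big_ord_recr/=; have {}IH := IH (ltnW jn).
  have := LB j.+1 (ltnW jn); rewrite !ler_norml in IH *; move=> /andP[l1 l2].
  case/andP: IH; set S := \sum_(i < j.+1) _ => s1 s2.
  have dj : 0 <= a j.+1 - a j by rewrite subr_ge0.
  have q1 : (a j.+1 - a j) * L j.+1 <= (a j.+1 - a j) * B by rewrite ler_wpM2l.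
  have q2 : (a j.+1 - a j) * - B <= (a j.+1 - a j) * L j.+1 by rewrite ler_wpM2l.
  by apply/andP; split; lra.
case: k kn => [_|k kn]; first by rewrite big_ord0 normr0 !mulr_ge0.
have h := key k kn; have aAk := aA k (ltnW kn).
have q : `|a k * L k.+1| <= a k * B by rewrite normrM ger0_norm// ler_wpM2l// LB.
rewrite -[X in `|X|](subrK (a k * L k.+1)).
apply: le_trans (ler_normD _ _) _.
have : a k * B <= A * B by rewrite ler_wpM2r.
lra.
Qed.

Lemma telescope_decr (chi c : nat -> R) j n (C : R) : 0 <= C -> (j <= n)%N ->
  (forall i, chi i.+1 <= chi i) -> (forall i, (i < n)%N -> c i <= C) ->
  \sum_(j <= i < n) (chi i - chi i.+1) * c i <= (chi j - chi n) * C.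
Proof.
move=> C0 jn chid cC.
apply: (@le_trans _ _ (\sum_(j <= i < n) (chi i - chi i.+1) * C)).
  rewrite big_nat_cond [leRHS]big_nat_cond; apply: ler_sum => i /andP[/andP[_ ilt] _].
  by rewrite ler_wpM2l ?cC// subr_ge0.
rewrite -mulr_suml.
under eq_bigr do rewrite -opprB; rewrite sumrN telescope_sumr// opprB.
exact: lexx.
Qed.

(* The increments of [y] are those of [m] minus those of a process [v] of bounded
   variation; stopping is encoded by the decreasing weights [chi], so that the
   increments of [v] only enter before [chi] vanishes. *)
Lemma stopped_square_bound (chi e y m : nat -> R) n j (E Ys o : R) :
  (j <= n)%N ->
  (forall i, chi i.+1 <= chi i) -> (forall i, 0 <= chi i <= 1) ->
  (forall i, 0 <= e i <= E) -> (forall i, (i <= n)%N -> `|y i| <= Ys) -> 0 <= o ->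
  (forall i, (i < n)%N -> `|m i.+1 - m i| <= o) ->
  chi j * e j * y j ^+ 2
  + \sum_(j <= i < n) chi i.+1 * (e i.+1 - e i) * y i.+1 ^+ 2
  + \sum_(j <= i < n) chi i * e i * (m i.+1 - m i) ^+ 2
  + 2 * \sum_(j <= i < n) chi i * e i * y i * (m i.+1 - m i)
  <= E * y n ^+ 2 + (1 - chi n) * (E * Ys ^+ 2) + E * (2 * Ys * o + o ^+ 2) +
     \sum_(j <= i < n) chi i.+1 * e i *
       ((m i.+1 - m i - (y i.+1 - y i)) * (m i.+1 - m i + y i + y i.+1)).
Proof.
move=> jn chid chi01 eE yY o0 mo.
have Ys0 : 0 <= Ys by apply: le_trans (yY 0%N isT).
have E0 : 0 <= E by have /andP[] := eE 0%N; exact: le_trans.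
(* A discrete Ito formula without error: with dm and dy the increments over a cell and y' the value
   at its right end, dm^2 + 2 y dm - (y'^2 - y^2) = (dm - dy) (dm + y + y'). The two sums with
   factor chi i - chi i.+1 come from reading the cutoff at both ends of a cell. *)
have id1 : chi j * e j * y j ^+ 2
  + \sum_(j <= i < n) chi i.+1 * (e i.+1 - e i) * y i.+1 ^+ 2
  + \sum_(j <= i < n) chi i * e i * (m i.+1 - m i) ^+ 2
  + 2 * \sum_(j <= i < n) chi i * e i * y i * (m i.+1 - m i)
  = chi n * e n * y n ^+ 2
   + \sum_(j <= i < n) (chi i - chi i.+1) * (e i * y i ^+ 2)
   + \sum_(j <= i < n) (chi i - chi i.+1) *
       (e i * (2 * y i * (m i.+1 - m i) + (m i.+1 - m i) ^+ 2))
   + \sum_(j <= i < n) chi i.+1 * e i *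
       ((m i.+1 - m i - (y i.+1 - y i)) * (m i.+1 - m i + y i + y i.+1)).
  have -> : chi j * e j * y j ^+ 2 = chi n * e n * y n ^+ 2 -
      \sum_(j <= i < n) (chi i.+1 * e i.+1 * y i.+1 ^+ 2 - chi i * e i * y i ^+ 2).
    by rewrite (telescope_sumr (fun i => chi i * e i * y i ^+ 2))//; lra.
  rewrite mulr_sumr -!addrA; congr (_ + _).
  rewrite -sumrN -!big_split/=; apply: eq_bigr => i _; ring.
rewrite id1 lerD2r.
have c1 : chi n * e n * y n ^+ 2 <= E * y n ^+ 2.
  rewrite ler_wpM2r ?sqr_ge0//; have /andP[e0 eE'] := eE n; have /andP[x0 x1] := chi01 n.
  by apply: le_trans eE'; rewrite ler_piMl.
have sub1 : chi j - chi n <= 1 - chi n by rewrite lerD2r; have /andP[] := chi01 j.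
have sub0 : chi j - chi n <= 1.
  by have /andP[_ h1] := chi01 j; have /andP[h2 _] := chi01 n; lra.
have EY0 : 0 <= E * Ys ^+ 2 by rewrite mulr_ge0 ?sqr_ge0.
have Eo0 : 0 <= E * (2 * Ys * o + o ^+ 2).
  by rewrite mulr_ge0// addr_ge0 ?sqr_ge0 ?mulr_ge0.
have c2 := @telescope_decr chi (fun i => e i * y i ^+ 2) j n (E * Ys ^+ 2) EY0 jn chid.
have {}c2 : \sum_(j <= i < n) (chi i - chi i.+1) * (e i * y i ^+ 2) <= (1 - chi n) * (E * Ys ^+ 2).
  apply: le_trans (c2 _) _ => [i ni|]; last by rewrite ler_wpM2r.
  have /andP[e0 eE'] := eE i; apply: ler_pM; rewrite ?sqr_ge0//.
  by rewrite -real_normK ?num_real// lerXn2r ?nnegrE// yY// ltnW.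
have c3 := @telescope_decr chi (fun i => e i * (2 * y i * (m i.+1 - m i) + (m i.+1 - m i) ^+ 2))
  j n _ Eo0 jn chid.
have {}c3 : \sum_(j <= i < n) (chi i - chi i.+1) *
       (e i * (2 * y i * (m i.+1 - m i) + (m i.+1 - m i) ^+ 2)) <= E * (2 * Ys * o + o ^+ 2).
  apply: le_trans (c3 _) _ => [i ni|]; last by rewrite ler_piMl.
  have /andP[e0 eE'] := eE i.
  apply: (@le_trans _ _ (e i * (2 * Ys * o + o ^+ 2))); last first.
    by rewrite ler_wpM2r// addr_ge0 ?sqr_ge0 ?mulr_ge0.
  rewrite ler_wpM2l//; apply: lerD.
    rewrite -!mulrA ler_wpM2l//; apply: le_trans (ler_norm _) _.
    by rewrite normrM ler_pM ?mo// yY// ltnW.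
  by rewrite -real_normK ?num_real// lerXn2r ?nnegrE// mo.
lra.
Qed.

(** An increment counts only if k is still at most b at its right end, so the counted ones telescope
    to a value of k below b. The induction needs the sharper bound min (k n) b. *)
Lemma stopped_increments (k : nat -> R) (b : R) n : k 0%N = 0 -> 0 <= b ->
  (forall i, k i <= k i.+1) ->
  \sum_(i < n) (k i.+1 <= b)%R%:R * (k i.+1 - k i) <= b.
Proof.
move=> k0 b0 kd; have : \sum_(i < n) (k i.+1 <= b)%R%:R * (k i.+1 - k i) <= Num.min (k n) b.
  elim: n => [|n IH]; first by rewrite big_ord0 k0 le_min lexx b0.
  rewrite big_ord_recr/=; move: IH; rewrite !le_min => /andP[h1 h2].
  have kn := kd n; case: (leP (k n.+1) b) => h; rewrite ?mul1r ?mul0r ?addr0.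
    by apply/andP; split; lra.
  by rewrite h2 andbT (le_trans h1).
by move=> /le_trans; apply; rewrite ge_min lexx orbT.
Qed.

End discrete_paths.

Section doob.
Context {R : realType} {dsp : measure_display} {Omega : measurableType dsp}.
Context (P : probability Omega R) {d : nat} (T : R).
Variable B : R -> {RV P >-> d.-tuple R}.
Hypothesis P_complete : measure_is_complete P.

(** Along approximations with summable mean square errors the sum of the squared errors is almost
    surely finite, so they converge almost surely. The exceptional set and all its subsets are
    negligible, hence belong to the augmented sigma-algebra, and the limit is measurable for it. *)
Lemma at_time_limit t (X : Omega -> R) :
  (forall e, 0 < e -> exists Y : Omega -> R,
    [/\ measurable_fun setT (Y : at_time B t -> R), SQ P (fun w => X w - Y w) &
        Ex P (fun w => (X w - Y w) ^+ 2) <= e]) ->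
  measurable_fun setT (X : at_time B t -> R).
Proof.
move=> HX.
have /choice[Y HY] : forall k : nat, exists Y : Omega -> R,
    [/\ measurable_fun setT (Y : at_time B t -> R), SQ P (fun w => X w - Y w) &
        Ex P (fun w => (X w - Y w) ^+ 2) <= 1 / (2 ^ k.+1)%:R].
  by move=> k; apply: HX; rewrite divr_gt0// ltr0n expn_gt0.
pose h k w := ((X w - Y k w) ^+ 2)%:E.
have mh k : measurable_fun setT (h k).
  by case: (HY k) => _ [mXY _] _; apply/measurable_EFinP; exact: measurable_funX.
have h0 k w : (0 <= h k w)%E by rewrite lee_fin sqr_ge0.
have mS : measurable_fun setT (fun w => \sum_(k <oo) h k w)%E.
  by apply: ge0_emeasurable_sum.
have iS : (\int[P]_w \sum_(k <oo) h k w < +oo)%E.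
  rewrite integral_nneseries//; apply: (@le_lt_trans _ _ 1%E); last exact: ltry.
  apply: le_trans (epsilon_trick0 xpredT (ler01 : 0 <= 1 :> R)).
  apply: lee_nneseries => [k _ _|k _]; first exact: integral_ge0.
  by case: (HY k) => _ sXY leE; rewrite -Ex_EFin ?lee_fin//; exact: SQ_sqr.
have aeS : {ae P, forall w, (\sum_(k <oo) h k w < +oo)%E}.
  have /integrable_ae : P.-integrable setT (fun w => \sum_(k <oo) h k w)%E.
    apply/integrableP; split => //; under eq_integral => w _.
      by rewrite gee0_abs; [over|exact: nneseries_ge0].
    exact: iS.
  move=> /(_ measurableT); apply: filterS => w /(_ I).
  by rewrite ge0_fin_numE//; exact: nneseries_ge0.
pose C := [set w | Y k w @[k --> \oo] --> X w].
have negC : P.-negligible (~` C).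
  apply: negligibleS aeS => w; apply: contra_not => /= Sw.
  have tl := nneseries_tail_cvg Sw (fun k _ => h0 k w).
  have hc : (h k w @[k --> \oo] --> 0)%E.
    apply: (squeeze_cvge _ (cvg_cst _) tl); apply: nearW => N.
    rewrite h0/= (@nneseries_split _ (fun k => h k w) N 1)//.
    by rewrite addn1 big_nat1 leeDl// nneseries_ge0.
  have {}hc : (X w - Y k w) ^+ 2 @[k --> \oo] --> (0:R) by case/fine_cvgP : hc.
  apply/cvgrPdist_lt => e e0; have e20 : 0 < e ^+ 2 by rewrite exprn_gt0.
  move/cvgrPdist_lt : hc => /(_ _ e20); apply: filterS => k.
  rewrite sub0r normrN ger0_norm ?sqr_ge0//.
  by move=> lt2; rewrite -(ltr_pXn2r (isT : (0 < 2)%N)) ?nnegrE ?(ltW e0)// real_normK ?num_real.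
have neg_meas A : P.-negligible A -> measurable (A : set (at_time B t)).
  by move=> nA; apply: sub_sigma_algebra; right.
have mC : measurable (C : set (at_time B t)).
  by rewrite -[C]setCK; apply: measurableC; exact: neg_meas.
have mXC : measurable_fun setT ((fun w => X w * \1_C w) : at_time B t -> R).
  apply: (@measurable_fun_cvg _ (at_time B t) R setT (fun k w => Y k w * \1_C w)) => [k|w _].
    by case: (HY k) => mY _ _; apply: measurable_funM => //; exact: measurable_indic.
  have [Cw|nCw] := pselect (C w); first by apply: cvgM; [exact: Cw|exact: cvg_cst].
  have -> : \1_C w = 0 :> R by rewrite indicE memNset.
  by rewrite mulr0; under eq_fun do rewrite mulr0; exact: cvg_cst.
move=> _ U mU; rewrite setTI.
have -> : X @^-1` U = ((fun w => X w * \1_C w) @^-1` U `&` C) `|` (X @^-1` U `&` ~` C).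
  apply/seteqP; split => w /=.
    have [Cw|nCw] := pselect (C w); last by right.
    by left; rewrite indicE mem_set// mulr1.
  by move=> [[+ Cw]|[]//]; rewrite indicE mem_set// mulr1.
apply: measurableU.
  by apply: measurableI => //; have := mXC measurableT U mU; rewrite setTI.
by apply: neg_meas; apply: negligibleS negC => w [].
Qed.

Hypothesis hB : brownian T B.
Variables (Z : R -> {RV P >-> d.-tuple R}) (M : R -> {RV P >-> R}).
Hypothesis hM : ito_integral T B Z M.

Lemma ito_increment_adapted s t : 0 <= s -> s <= t -> t <= T ->
  measurable_fun setT ((fun w => M t w - M s w) : at_time B t -> R).
Proof.
move=> s0 st tT; apply: at_time_limit => e e0.
have e40 : 0 < e / 4 by rewrite divr_gt0.
have [|H [_ hH]] := @ito_approx _ _ _ _ _ _ _ _ _ hM 1%N (fun i => if i == 0%N then s else t) _ e40.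
  by move=> [|[|//]] _; rewrite /= in_itv/= ?s0 ?tT ?(le_trans st)// (le_trans s0).
have [h hE] := ito_approx_increment P_complete hB s0 st tT (hH 0%N isT) (hH 1%N isT).
exists (fun w => sp_integral H t w - sp_integral H s w); split.
- exact: sp_integral_increment_adapted.
- have := SQN h; under eq_fun do rewrite opprB; exact.
- under [fun w => _]eq_fun do rewrite -sqrrN opprB.
  by apply: le_trans hE _; rewrite mulrC divfK.
Qed.

Section grid.
Variables (tau : nat -> R) (n : nat) (H : nat -> Omega -> R) (C : R).
Hypothesis tauT : forall i, (i <= n)%N -> 0 <= tau i <= T.
Hypothesis tau_nd : forall i, (i < n)%N -> tau i <= tau i.+1.
Hypothesis mH : forall i, (i < n)%N -> measurable_fun setT (H i : at_time B (tau i) -> R).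
Hypothesis HC : forall i w, (i < n)%N -> `|H i w| <= C.

Let dM i w := M (tau i.+1) w - M (tau i) w.
Let L k w := \sum_(i < k) H i w * dM i w.

Let tau0 i : (i <= n)%N -> 0 <= tau i. Proof. by move=> /tauT /andP[]. Qed.
Let tau1 i : (i <= n)%N -> tau i <= T. Proof. by move=> /tauT /andP[]. Qed.

Lemma SQ_grid_increment i : (i < n)%N -> SQ P (dM i).
Proof.
by move=> ni; apply: (SQ_ito_increment P_complete hB hM); rewrite ?tau0 ?tau1 ?tau_nd// ltnW.
Qed.

Let SQ_HdM i : (i < n)%N -> SQ P (fun w => H i w * dM i w).
Proof.
move=> ni; apply: (@SQ_bmul _ _ _ _ _ _ C).
- exact: (at_time_funW P_complete (mH ni)).
- by move=> w; exact: HC.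
- exact: SQ_grid_increment.
Qed.

Lemma SQ_transform k : (k <= n)%N -> SQ P (L k).
Proof. by move=> kn; apply: (@SQ_sum _ _ _ P k (fun i w => H i w * dM i w)) => i ik; apply: SQ_HdM; exact: leq_trans kn. Qed.

Lemma transform_adapted k : (k <= n)%N ->
  measurable_fun setT (L k : at_time B (tau k) -> R).
Proof.
elim: k => [|k IH] kn.
  rewrite (_ : L 0%N = fun=> 0); first exact: measurable_cst.
  by apply/funext => w; rewrite /L big_ord0.
rewrite (_ : L k.+1 = fun w => L k w + H k w * dM k w); last first.
  by apply/funext => w; rewrite /L big_ord_recr.
apply: measurable_funD.
  by apply: at_time_le (IH (ltnW kn)); exact: tau_nd.
apply: measurable_funM; first by apply: at_time_le (mH kn); exact: tau_nd.
by apply: ito_increment_adapted; rewrite ?tau0 ?tau1 ?tau_nd// ltnW.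
Qed.

Lemma Ex_transform_sqr k : (k <= n)%N ->
  Ex P (fun w => L k w ^+ 2) = \sum_(i < k) Ex P (fun w => (H i w * dM i w) ^+ 2).
Proof.
elim: k => [|k IH] kn.
  rewrite big_ord0; under [fun w => _]eq_fun do rewrite /L big_ord0 expr0n/=.
  exact: Ex_cst.
rewrite big_ord_recr/= -IH; last exact: ltnW.
have sL := SQ_transform (ltnW kn); have sD := SQ_HdM kn.
have sLH : SQ P (fun w => H k w * L k w).
  apply: (@SQ_bmul _ _ _ _ _ _ C) => //; last by move=> w; exact: HC.
  exact: (at_time_funW P_complete (mH kn)).
have mLH : measurable_fun setT ((fun w => H k w * L k w) : at_time B (tau k) -> R).
  by apply: measurable_funM; [exact: mH|exact: transform_adapted (ltnW kn)].
have h0 : Ex P (fun w => H k w * L k w * dM k w) = 0.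
  apply: (Ex_ito_increment P_complete hB hM); rewrite ?tau0 ?tau1 ?tau_nd//.
  exact: ltnW.
have i0 : Ig P (fun w => H k w * L k w * dM k w).
  by apply: SQ_mul => //; exact: SQ_grid_increment.
rewrite (_ : (fun w => L k.+1 w ^+ 2) = fun w =>
    (L k w ^+ 2 + (H k w * dM k w) ^+ 2) + 2 * (H k w * L k w * dM k w)); last first.
  by apply/funext => w; rewrite /L big_ord_recr/= -/(L k w); ring.
rewrite ExD; [|by apply: IgD; exact: SQ_sqr|exact: IgZ].
by rewrite ExD ?ExZ ?h0 ?mulr0 ?addr0//; exact: SQ_sqr.
Qed.

Let run k w := runmax (L ^~ w) k.

Let mrun k : (k <= n)%N -> measurable_fun setT (run k : at_time B (tau k) -> R).
Proof.
elim: k => [|k IH] kn.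
  apply: measurableT_comp => //; exact: transform_adapted.
apply: measurable_maxr; first by apply: at_time_le (IH (ltnW kn)); exact: tau_nd.
apply: measurableT_comp => //; exact: transform_adapted.
Qed.

Lemma SQ_runmax k : (k <= n)%N -> SQ P (fun w => runmax (L ^~ w) k).
Proof.
move=> kn; apply: (@SQ_le _ _ _ _ _ (fun w => \sum_(i < k.+1) `|L i w|)).
- exact: (at_time_funW P_complete (mrun kn)).
- move=> w; rewrite ger0_norm ?runmax_ge0// ger0_norm ?sumr_ge0//.
  exact: runmax_le_sum.
- apply: (@SQ_sum _ _ _ _ k.+1 (fun i w => `|L i w|)) => i ik.
  apply: SQ_abs; apply: SQ_transform; exact: leq_trans (ik : (i <= k)%N) kn.
Qed.

(** The expectation of [doob_path]: its last sum is again a transform of the increments of M, with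
    square-integrable weights [eta] known at the left ends, and has mean zero. The rest is
    orthogonality of the increments. *)
Lemma doob_L2 : Ex P (fun w => runmax (L ^~ w) n ^+ 2) <=
  4 * \sum_(i < n) Ex P (fun w => (H i w * dM i w) ^+ 2).
Proof.
rewrite -Ex_transform_sqr//.
pose eta i w := run i w * Num.sg (L i w) * H i w.
have msg t (X : Omega -> R) : measurable_fun setT (X : at_time B t -> R) ->
    measurable_fun setT ((fun w => Num.sg (X w)) : at_time B t -> R).
  move=> mX; rewrite (_ : (fun w => _) = fun w => if X w == 0 then 0 else if X w < 0 then -1 else 1).
    apply: measurable_fun_ifT => //.
      exact: measurable_fun_eqr.
    apply: measurable_fun_ifT => //.
    exact: measurable_fun_ltr.
  by apply/funext => w; case: sgrP.
have meta i : (i < n)%N -> measurable_fun setT (eta i : at_time B (tau i) -> R).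
  move=> ni; apply: measurable_funM; last exact: mH.
  by apply: measurable_funM; [exact: mrun (ltnW ni)|apply: msg; exact: transform_adapted (ltnW ni)].
have seta i : (i < n)%N -> SQ P (eta i).
  move=> ni; have : SQ P (fun w => C * run i w) by apply: SQZ; exact: SQ_runmax (ltnW ni).
  apply: SQ_le; first exact: (at_time_funW P_complete (meta _ ni)).
  move=> w; rewrite /eta !normrM normr_sg [leRHS]mulrC; apply: ler_pM => //; last first.
    by apply: le_trans (HC w ni) (ler_norm _).
  by rewrite ler_piMr// lern1 leq_b1.
have sLn := SQ_transform (leqnn n).
have imart i : (i < n)%N -> Ig P (fun w => eta i w * dM i w).
  by move=> ni; apply: SQ_mul; [exact: seta|exact: SQ_grid_increment].
have isum : Ig P (fun w => \sum_(i < n) eta i w * dM i w).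
  exact: (@Ig_sum _ _ _ P n (fun i w => eta i w * dM i w)).
have Emart : Ex P (fun w => \sum_(i < n) eta i w * dM i w) = 0.
  rewrite (@Ex_sum _ _ _ P n (fun i w => eta i w * dM i w))//.
  rewrite big1// => i _; apply: (Ex_ito_increment P_complete hB hM);
    by rewrite ?tau0 ?tau1 ?tau_nd//; first [exact: ltnW|exact: meta|exact: seta].
apply: (@le_trans _ _ (Ex P (fun w => 4 * L n w ^+ 2 - 4 * \sum_(i < n) eta i w * dM i w))).
  apply: Ex_le.
  - by apply: SQ_sqr; exact: SQ_runmax.
  - by apply: IgB; apply: IgZ; [exact: SQ_sqr|exact: isum].
  move=> w; have := @doob_path _ (L ^~ w) n.
  move=> /(_ _)/wrap[|]; first by rewrite /L big_ord0.
  move/le_trans; apply; rewrite lerD2l lerN2 ler_pM2l// le_eqVlt; apply/orP; left.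
  apply/eqP; apply: eq_bigr => i _; rewrite /eta.
have -> : L i.+1 w - L i w = H i w * dM i w by rewrite /L big_ord_recr/= addrAC subrr add0r.
by rewrite mulrA.
rewrite ExB; [|by apply: IgZ; exact: SQ_sqr|by apply: IgZ; exact: isum].
rewrite (ExZ 4 isum) (ExZ 4 (SQ_sqr sLn)) Emart mulr0 subr0; exact: lexx.
Qed.

End grid.
End doob.

(** * Continuous processes *)

Section continuous_paths.
Context {R : realType} (T : R).
Hypothesis T_ge0 : 0 <= T.
Implicit Types x : R -> R.

Lemma cont_on_clamp x : cont_on T x -> continuous (x \o clamp T).
Proof.
move=> cx t; move/subspace_continuousP : cx => /(_ _ (clamp_itv t T_ge0)) cx.
apply: (@cvg_comp _ _ _ (clamp T) x _ (within `[0, T] (nbhs (clamp T t)))); last exact: cx.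
move=> A /= wA; have := @clamp_continuous R T t _ wA; rewrite nbhs_simpl/=.
by apply: (@filterS _ (nbhs t)) => y; apply; exact: clamp_itv.
Qed.

Lemma clampK t : clamp T (clamp T t) = clamp T t.
Proof. by rewrite clamp_id// clamp_itv. Qed.

Lemma clamp_le_add a b : 0 <= b -> clamp T (a + b) <= clamp T a + b.
Proof.
move=> b0; rewrite /clamp ge_max; apply/andP; split.
  by rewrite addr_ge0// le_max lexx.
apply: (@le_trans _ _ (Num.min a T + b)); last by rewrite lerD2r le_max lexx orbT.
by rewrite ge_min; case: (leP a T) => _; rewrite ?lexx// orbC lerDl b0.
Qed.

(** Where h exceeds c it does so on a nonempty open set, which contains a rational. This is what
    allows the suprema below to be countable. *)
Lemma continuous_bounded_rat (h : R -> R) (c : R) : continuous h ->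
  (forall q : rat, h (ratr q) <= c) -> forall t, h t <= c.
Proof.
move=> ch hq t; rewrite leNgt; apply/negP => ct.
have oh : open (h @^-1` `]c, +oo[%classic).
  by apply: open_comp; [move=> u _; exact: ch|exact: interval_open].
have nt : (h @^-1` `]c, +oo[%classic) !=set0 by exists t; rewrite /= in_itv/= ct.
have [v [/= hc [q _ qE]]] := @dense_rat R _ nt oh.
move: hc; rewrite -qE in_itv/= andbT.
by rewrite ltNge hq.
Qed.

Lemma cont_on_bounded x : cont_on T x -> exists c, forall t, t \in `[0, T] -> `|x t| <= c.
Proof.
move=> cx; have [c _ hc] := EVT_max T_ge0 cx; have [b _ hb] := EVT_min T_ge0 cx.
exists (`|x c| + `|x b|) => t tT; have := hc t tT; have := hb t tT.
have := ler_norm (x c); have := ler_norm (- x b); rewrite normrN ler_norml.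
have := normr_ge0 (x c); have := normr_ge0 (x b) => *; apply/andP; split; lra.
Qed.

(** The supremum runs over an enumeration of the rationals, clamped into [0, T], so that it is
    measurable in the outcome; for continuous paths it is the maximum of |x|. Codes of no rational
    stand for the time 0. *)
Definition supnorm x : R :=
  sups (fun n => `|x (clamp T (ratr (odflt 0 (unpickle n) : rat)))|) 0.

(** The modulus of continuity at scale h, again as a countable supremum: a pair of rationals encodes
    a time and a shift, the latter clamped into [0, h]. *)
Definition modulus x (h : R) : R :=
  sups (fun n => let q := odflt (0, 0) (unpickle n : option (rat * rat)) in
    `|x (clamp T (ratr q.1)) - x (clamp T (ratr q.1 + clamp h (ratr q.2)))|) 0.

Lemma sups0_ge (a : nat -> R) n c : (forall k, a k <= c) -> a n <= sups a 0.
Proof.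
by move=> ac; apply: ub_le_sup; [exists c => _ [k _ <-]; exact: ac|exists n].
Qed.

Lemma sups0_le (a : nat -> R) c : (forall k, a k <= c) -> sups a 0 <= c.
Proof.
move=> ac; apply: ge_sup; first by exists (a 0%N); exists 0%N.
by move=> _ [k _ <-]; exact: ac.
Qed.

Let in0T t : t \in `[0, T] -> clamp T t = t. Proof. exact: clamp_id. Qed.

Lemma supnorm_ge x t : cont_on T x -> t \in `[0, T] -> `|x t| <= supnorm x.
Proof.
move=> cx tT; have [c hc] := cont_on_bounded cx.
have c' : continuous (fun u => `|(x \o clamp T) u|).
  by move=> u; apply: cvg_norm; exact: cont_on_clamp.
suff : forall u, `|(x \o clamp T) u| <= supnorm x by move=> /(_ t)/=; rewrite in0T.
apply: continuous_bounded_rat => // q.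
have := @sups0_ge (fun n => `|x (clamp T (ratr (odflt 0 (unpickle n) : rat)))|) (pickle q) c.
by rewrite pickleK; apply => k; apply: hc; exact: clamp_itv.
Qed.

Lemma supnorm_le x c : (forall t, t \in `[0, T] -> `|x t| <= c) -> supnorm x <= c.
Proof. by move=> xc; apply: sups0_le => k; apply: xc; exact: clamp_itv. Qed.

Lemma supnorm_ge0 x : cont_on T x -> 0 <= supnorm x.
Proof. by move=> cx; apply: le_trans (supnorm_ge cx (clamp_itv 0 T_ge0)). Qed.

Lemma modulus_le2 x h k : cont_on T x ->
  (let q := odflt (0, 0) (unpickle k : option (rat * rat)) in
    `|x (clamp T (ratr q.1)) - x (clamp T (ratr q.1 + clamp h (ratr q.2)))|) <= 2 * supnorm x.
Proof.
move=> cx /=; apply: le_trans (ler_normB _ _) _; rewrite mulr2n mulrDl mul1r.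
by rewrite lerD// supnorm_ge// clamp_itv.
Qed.

Lemma modulus_le x h : cont_on T x -> modulus x h <= 2 * supnorm x.
Proof. by move=> cx; apply: sups0_le => k; exact: modulus_le2. Qed.

Lemma modulus_ge0 x h : cont_on T x -> 0 <= modulus x h.
Proof.
move=> cx; have /= := sups0_ge 0%N (fun k => modulus_le2 h k cx).
by apply: le_trans.
Qed.

Lemma modulus_ge x h s t : cont_on T x -> 0 <= h -> s \in `[0, T] -> t \in `[0, T] ->
  `|s - t| <= h -> `|x s - x t| <= modulus x h.
Proof.
move=> cx h0; wlog st : s t / s <= t.
  move=> wl sT tT sth; have [/wl|/ltW/wl] := leP s t; first exact.
  by move=> {}wl; rewrite distrC; apply: wl => //; rewrite distrC.
move=> sT tT; rewrite distrC ger0_norm ?subr_ge0// => sth.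
have cxc := cont_on_clamp cx.
(* Density of the rationals is used twice, for the shift at a rational base point here, and for the
   base point afterwards. *)
have cM (p : rat) (u : R) : `|(x \o clamp T) (ratr p) - (x \o clamp T) (ratr p + clamp h u)| <= modulus x h.
  move: u; apply: continuous_bounded_rat => [u|q].
    apply: cvg_norm; apply: cvgB; first exact: cvg_cst.
    apply: (@continuous_comp _ _ _ (fun v => ratr p + clamp h v) (x \o clamp T)); last exact: cxc.
    by apply: cvgD; [exact: cvg_cst|exact: clamp_continuous].
  have := sups0_ge (pickle (p, q)) (fun k => modulus_le2 h k cx).
  by rewrite pickleK.
suff : forall v, `|(x \o clamp T) v - (x \o clamp T) (v + (t - s))| <= modulus x h.
  by move=> /(_ s)/=; rewrite [s + _]addrC subrK !in0T.
apply: continuous_bounded_rat => [v|p].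
  apply: cvg_norm; apply: cvgB; first exact: cxc.
  apply: (@continuous_comp _ _ _ (fun v => v + (t - s)) (x \o clamp T)); last exact: cxc.
  by apply: cvgD; [exact: cvg_id|exact: cvg_cst].
by have := cM p (t - s); rewrite clamp_id// in_itv/= subr_ge0 st.
Qed.

Lemma modulus_cvg0 x : cont_on T x -> modulus x (T / n.+1%:R) @[n --> \oo] --> (0 : R).
Proof.
move=> cx; have cxc := cont_on_clamp cx.
apply/cvgrPdist_le => e e0.
(* Heine's theorem: near each point of [0, T] small shifts move x by less than e, and compactness
   makes the admissible size of the shift uniform. *)
have /compact_near_coveringP := @segment_compact R 0 T.
move=> /(_ R (nbhs (0:R)) (fun h s => `|(x \o clamp T) (s + h) - (x \o clamp T) s| < e)).
move=> /(_ _)[|].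
  move=> s _.
  have : (fun z : R * R => `|(x \o clamp T) (z.1 + z.2) - (x \o clamp T) z.1|) z @[z --> (s, 0 : R)]
      --> `|(x \o clamp T) s - (x \o clamp T) s|.
    apply: cvg_norm; apply: cvgB.
      apply: (@cvg_comp _ _ _ (fun z : R * R => z.1 + z.2) (x \o clamp T) _ (nbhs s)); last exact: cxc.
      have : (fun z : R * R => z.1 + z.2) z @[z --> (s, 0 : R)] --> s + 0.
        by apply: cvgD; [exact: cvg_fst|exact: cvg_snd].
      by rewrite addr0.
    by apply: (@cvg_comp _ _ _ fst (x \o clamp T) _ (nbhs s)); [exact: cvg_fst|exact: cxc].
  by rewrite subrr normr0; move/cvgr_lt; apply; exact: e0.
move=> d /= d0 hd.
have : T / n.+1%:R @[n --> \oo] --> (0 : R).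
  rewrite -[X in _ --> X](mulr0 T); apply: cvgM; [exact: cvg_cst|exact: cvg_harmonic].
move/cvgr_lt => /(_ d d0); apply: filterS => n nd.
rewrite sub0r normrN ger0_norm ?modulus_ge0//.
apply: sups0_le => k /=; set q := odflt _ _.
set u := clamp T (ratr q.1); set v := clamp T _.
have Tn0 : 0 <= T / n.+1%:R by rewrite divr_ge0.
have := clamp_itv (ratr q.2 : R) Tn0; rewrite in_itv/= => /andP[c0 cn].
have uv : `|0 - (v - u)| < d.
  rewrite sub0r normrN; apply: le_lt_trans nd; apply: le_trans cn.
  rewrite ger0_norm; last by rewrite subr_ge0; apply: clamp_nd; rewrite lerDl.
  rewrite /u /v; move: (ratr q.1) (clamp (T / _) _) c0 => a b b0.
  by rewrite lerBlDl; exact: clamp_le_add.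
have uT : [set` `[0, T]] u by exact: clamp_itv.
have /= := hd (v - u) uv u uT.
by rewrite [u + _]addrC subrK !clampK distrC => /ltW.
Qed.

End continuous_paths.

Section continuous_processes.
Context {R : realType} {dsp : measure_display} {Omega : measurableType dsp}.
Variables (T : R) (X : R -> Omega -> R).
Hypothesis T_ge0 : 0 <= T.
Hypothesis mX : forall t, t \in `[0, T] -> measurable_fun setT (X t).
Hypothesis cX : forall w, cont_on T (fun t => X t w).

Lemma measurable_supnorm : measurable_fun setT (fun w => supnorm T (fun t => X t w)).
Proof.
apply: measurable_fun_sups => [w _|n].
  have [c hc] := cont_on_bounded T_ge0 (@cX w).
  by exists c => _ [n _ <-]; apply: hc; exact: clamp_itv.
by apply: measurableT_comp => //; apply: mX; exact: clamp_itv.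
Qed.

Lemma measurable_modulus h : measurable_fun setT (fun w => modulus T (fun t => X t w) h).
Proof.
apply: measurable_fun_sups => [w _|n].
  by exists (2 * supnorm T (fun t => X t w)) => _ [n _ <-]; exact: modulus_le2.
apply: measurableT_comp => //; apply: measurable_funB; apply: mX; exact: clamp_itv.
Qed.

Lemma ereal_sup_sqr w :
  ereal_sup [set (`|X t w| ^+ 2)%:E | t in `[0%R, T]%classic] =
  (supnorm T (fun t => X t w) ^+ 2)%:E.
Proof.
have s0 := supnorm_ge0 T_ge0 (@cX w).
apply/eqP; rewrite eq_le; apply/andP; split.
  apply: ge_ereal_sup => _ [t /= tT <-]; rewrite lee_fin lerXn2r ?nnegrE//.
  exact: supnorm_ge.
have bdd t : t \in `[0, T] -> ((`|X t w| ^+ 2)%:E <=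
    ereal_sup [set (`|X t w| ^+ 2)%:E | t in `[0%R, T]%classic])%E.
  by move=> tT; apply: ereal_sup_ubound; exists t.
case E : ereal_sup bdd => [r| |] bdd; last 2 first.
- by rewrite leey.
- by have := bdd _ (clamp_itv 0 T_ge0); rewrite leeNy_eq.
have r0 : 0 <= r.
  by have := bdd _ (clamp_itv 0 T_ge0); rewrite lee_fin; apply: le_trans; exact: sqr_ge0.
rewrite lee_fin -(sqr_sqrtr r0) lerXn2r ?nnegrE ?sqrtr_ge0//.
apply: supnorm_le => // t /bdd; rewrite lee_fin => tr.
by rewrite -[`|X t w|]normr_id -(@sqrtr_sqr _ `|X t w|) ler_sqrt.
Qed.

End continuous_processes.

(** Rounding phi down to multiples of 1 / (n + 1) leaves countably many level sets, on each of which
    the function is one of the h y; continuity in y lets n tend to infinity. *)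
Lemma measurable_fun_caratheodory d (S : measurableType d) (R : realType) (D : set S)
    (phi : S -> R) (h : R -> S -> R) :
  measurable D -> measurable_fun D phi -> (forall y, measurable_fun D (h y)) ->
  (forall p, D p -> continuous (h ^~ p)) ->
  measurable_fun D (fun p => h (phi p) p).
Proof.
move=> mD mphi mh ch.
pose fl n p : int := Num.floor (n.+1%:R * phi p).
pose hn n p := h ((fl n p)%:~R / n.+1%:R) p.
apply: (@measurable_fun_cvg _ _ _ _ hn) => [n|p Dp].
  move=> _ U mU.
  have -> : D `&` hn n @^-1` U = \bigcup_(z : int)
      ((D `&` phi @^-1` `[z%:~R / n.+1%:R, (z + 1)%:~R / n.+1%:R[) `&`
       (D `&` h (z%:~R / n.+1%:R) @^-1` U)).
    apply/seteqP; split => [p [Dp Up]|p [z _ [[Dp]]]].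
      exists (fl n p) => //; split; split => //=.
      rewrite in_itv/= ler_pdivrMr// ltr_pdivlMr// [phi p * _]mulrC.
      by apply/andP; split; [exact: floor_le|exact: floorD1_gt].
    rewrite /= in_itv/= ler_pdivrMr// ltr_pdivlMr// [phi p * _]mulrC => zp [_ Up].
    split => //; rewrite /hn /fl (_ : Num.floor _ = z)//.
    exact/floor_def.
  apply: countable_bigcupT_measurable => [|z]; first exact: countableP.
  by apply: measurableI; [apply: mphi => //; exact: measurable_itv|exact: mh].
apply: (@cvg_comp _ _ _ (fun n => (fl n p)%:~R / n.+1%:R) (h ^~ p) _ (nbhs (phi p))); last exact: ch.
apply/cvgrPdist_le => e e0.
have : @harmonic R n @[n --> \oo] --> (0 : R) by exact: cvg_harmonic.
move/cvgr_lt => /(_ e e0); apply: filterS => n ne.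
apply: le_trans (ltW ne); rewrite /harmonic/=.
have nn : 0 < n.+1%:R :> R by [].
have := floor_le (n.+1%:R * phi p).
have := floorD1_gt (n.+1%:R * phi p).
rewrite -/(fl n p) intrD => h1 h2.
rewrite -(ler_pM2l nn) mulfV// -{1}(gtr0_norm nn) -normrM mulrBr mulrCA mulfV// mulr1.
by rewrite ler_norml; apply/andP; split; lra.
Qed.

Section joint_measurability_processes.
Context {R : realType} {dsp : measure_display} {Omega : measurableType dsp}.
Context (P : probability Omega R) {d : nat} (T : R).
Variable B : R -> {RV P >-> d.-tuple R}.
Hypothesis P_complete : measure_is_complete P.
Hypothesis T_gt0 : 0 < T.
Let T_ge0 : 0 <= T := ltW T_gt0.

Let mD : measurable (`[0, T]%classic `*` setT : set (measurableTypeR R * Omega)).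
Proof. by apply: measurableX => //; exact: measurable_itv. Qed.

(** The preceding lemma with the time as the parameter in which the function is continuous. *)
Lemma jmeas_continuous (X : R -> Omega -> R) :
  (forall t, t \in `[0, T] -> measurable_fun setT (X t)) ->
  (forall w, cont_on T (fun t => X t w)) -> jmeas T X.
Proof.
move=> mX cX.
have := @measurable_fun_caratheodory _ (measurableTypeR R * Omega)%type R
  (`[0, T]%classic `*` setT) fst (fun y p => X (clamp T y) p.2) mD.
move=> /(_ _ _ _)/wrap[|||].
- exact: measurable_funTS measurable_fst.
- move=> y; apply: measurable_funTS; apply: measurableT_comp; last exact: measurable_snd.
  by apply: mX; exact: clamp_itv.
- by move=> p _; exact: (cont_on_clamp T_ge0 (@cX p.2)).
- by apply: eq_measurable_fun => -[t w]; rewrite inE => -[/= tT _]; rewrite clamp_id.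
Qed.

Lemma jmeas_progressive (X : R -> Omega -> R) : progressive T B X -> jmeas T X.
Proof.
have TT : T \in `[0, T] by rewrite in_itv/= T_ge0 lexx.
move=> /(_ T TT) pX.
pose j (p : measurableTypeR R * Omega) : R * at_time B T := (p.1, p.2).
have mj : measurable_fun setT j.
  apply: measurable_fun_pair; first exact: measurable_fst.
  move=> _ A mA; have m2 : measurable_fun setT (snd : measurableTypeR R * Omega -> Omega).
    exact: measurable_snd.
  exact: (m2 measurableT A (at_time_sub P_complete mA)).
have := measurable_comp (F := `[0, T]%classic `*` setT) _ _ pX (measurable_funTS mj).
by apply; [exact: measurableX|by move=> _ [p [? ?] <-]].
Qed.

Lemma jmeas_predictable (X : R -> Omega -> d.-tuple R) k :
  predictable T B X -> jmeas T (fun t w => tnth (X t w) k).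
Proof.
move=> pX.
have sub : <<s predictable_rect T B >> `<=` (measurable : set (set (measurableTypeR R * Omega))).
  apply: smallest_sub; first exact: sigma_algebra_measurable.
  move=> C [[A [mA ->]]|[s [t [A [_ _ _ mA ->]]]]]; apply: measurableX => //.
  - exact: at_time_sub mA.
  - exact: at_time_sub mA.
have mXD : measurable_fun (`[0, T]%classic `*` setT)
    (fun p : measurableTypeR R * Omega => X p.1 p.2).
  move=> _ U mU; apply: sub; apply: pX => //.
  have -> : `[0, T]%classic `*` [set: Omega] = ([set 0] `*` setT) `|` (`]0, T] `*` setT).
    apply/seteqP; split => -[t w] /=; rewrite !in_itv/=.
      move=> [/andP[t0 tT] _]; have [->|nt] := eqVneq t 0; first by left.
      by right; rewrite tT andbT lt_neqAle eq_sym nt.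
    by move=> [[->]|[/andP[/ltW -> ->]]]; rewrite ?lexx ?T_ge0.
  apply: measurableU; apply: sub_sigma_algebra; first by left; exists setT.
  by right; exists 0, T, setT; split.
exact: (measurableT_comp (measurable_tnth k) mXD).
Qed.

End joint_measurability_processes.

(** * Uniform grids and the supremum of the Ito integral *)

Section uniform_grid.
Context {R : realType} (T : R) (n : nat).
Hypothesis T_gt0 : 0 < T.

(* The grid is constant from the index [n.+1] on, so that it stays in [[0, T]]. *)
Definition grid (i : nat) : R := T * (minn i n.+1)%:R / n.+1%:R.

Lemma grid0 : grid 0 = 0. Proof. by rewrite /grid min0n mulr0 mul0r. Qed.

Lemma grid_last : grid n.+1 = T. Proof. by rewrite /grid minnn mulfK. Qed.

Lemma grid_nd i j : (i <= j)%N -> grid i <= grid j.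
Proof.
move=> ij; rewrite /grid ler_pM2r ?invr_gt0// ler_pM2l// ler_nat.
by rewrite leq_min geq_minr andbT (leq_trans (geq_minl _ _)).
Qed.

Lemma grid_le i : grid i <= grid i.+1. Proof. exact: grid_nd. Qed.

Lemma grid_gap i : grid i.+1 - grid i <= T / n.+1%:R.
Proof.
rewrite /grid -mulrBl -mulrBr ler_pM2r ?invr_gt0// ler_piMr ?(ltW T_gt0)//.
rewrite lerBlDr -(natrD _ 1) ler_nat.
by rewrite /minn !ltnS; case: ltngtP => h1; case: ltnP => h2; lia.
Qed.

Lemma grid_itv i : 0 <= grid i <= T.
Proof.
rewrite -{1}grid0 grid_nd//= /grid ler_pdivrMr// ler_pM2l// ler_nat.
exact: geq_minr.
Qed.

Lemma grid_in i : grid i \in `[0, T].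
Proof. by rewrite in_itv/= grid_itv. Qed.

Lemma grid_cell s : s \in `[0, T] ->
  exists2 i, (i <= n)%N & grid i <= s <= grid i.+1.
Proof.
rewrite in_itv/= -grid_last => /andP[s0].
elim: {1 2}n => [|k IH] sk; first by exists 0%N => //; rewrite grid0 s0.
have [/IH[i ik h]|ks] := leP s (grid k.+1); first by exists i => //; exact: leqW.
by exists k.+1 => //; rewrite (ltW ks).
Qed.

Lemma grid_dist i s : grid i <= s <= grid i.+1 ->
  `|s - grid i| <= T / n.+1%:R /\ `|grid i.+1 - s| <= T / n.+1%:R.
Proof.
move=> /andP[h1 h2]; by split; rewrite ger0_norm ?subr_ge0//; apply: le_trans (grid_gap i); rewrite ?lerD2r ?lerD2l ?lerN2.
Qed.

End uniform_grid.

Lemma supnorm_runmax (R : realType) (T : R) (x : R -> R) n : 0 < T -> cont_on T x ->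
  runmax (x \o grid T n) n.+1 <= supnorm T x /\
  supnorm T x <= runmax (x \o grid T n) n.+1 + modulus T x (T / n.+1%:R).
Proof.
move=> T0 cx; have T_ge0 := ltW T0; split.
  by apply: runmax_le => i ni; apply: supnorm_ge => //; exact: grid_in.
apply: supnorm_le => // s sT; have [i ik h] := grid_cell n sT.
have [h1 _] := grid_dist T0 h.
rewrite -[x s](subrK (x (grid T n i))); apply: le_trans (ler_normD _ _) _; rewrite addrC lerD//.
  by apply: (@runmax_ge _ (x \o grid T n)); exact: leqW.
by apply: modulus_ge => //; [rewrite divr_ge0|exact: grid_in].
Qed.

Section ito_supremum.
Context {R : realType} {dsp : measure_display} {Omega : measurableType dsp}.
Context (P : probability Omega R) {d : nat} (T : R).
Variable B : R -> {RV P >-> d.-tuple R}.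
Hypothesis P_complete : measure_is_complete P.
Hypothesis hB : brownian T B.
Hypothesis T_gt0 : 0 < T.
Variables (Z : R -> {RV P >-> d.-tuple R}) (M : R -> {RV P >-> R}).
Hypothesis hM : ito_integral T B Z M.

Let X t w := M t w - M 0 w.

Lemma cont_on_ito w : cont_on T (fun t => X t w).
Proof.
have [cM _] := hM; move=> t; apply: cvgB; last exact: cvg_cst.
exact: (@cM w).
Qed.

(** Doob's inequality with weights 1 bounds the maxima over the grids uniformly. They converge path
    by path to the supremum, since the modulus of continuity vanishes, and Fatou's lemma passes the
    bound to the limit. *)
Lemma SQ_ito_supnorm : SQ P (fun w => supnorm T (fun t => X t w)).
Proof.
have T_ge0 := ltW T_gt0.
have mX t : t \in `[0, T] -> measurable_fun setT (X t) by move=> _; exact: measurable_funB.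
have mS := measurable_supnorm T_ge0 mX cont_on_ito.
pose S w := supnorm T (fun t => X t w).
pose run n w := runmax ((fun t => X t w) \o grid T n) n.+1.
have runE n : run n = fun w => runmax (fun k => \sum_(i < k) 1 * (M (grid T n i.+1) w - M (grid T n i) w)) n.+1.
  apply/funext => w; rewrite /run; congr (runmax _ _); apply/funext => k /=.
  under eq_bigr do rewrite mul1r.
  by rewrite -(big_mkord xpredT (fun i => M (grid T n i.+1) w - M (grid T n i) w)) telescope_sumr// grid0.
have SQrun n : SQ P (run n).
  rewrite runE; apply: (@SQ_runmax _ _ _ _ _ T B P_complete hB Z M hM (grid T n) n.+1 (fun _ _ => 1) 1) => //.
  - by move=> i _; exact: grid_itv.
  - by move=> i _; exact: grid_le.
  - by move=> i w _; rewrite normr1.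
have Erun n : Ex P (fun w => run n w ^+ 2) <= 4 * Ex P (fun w => X T w ^+ 2).
  rewrite runE.
  have := @doob_L2 _ _ _ _ _ T B P_complete hB Z M hM (grid T n) n.+1 (fun _ _ => 1) 1.
  move=> /(_ _ _ _ _)/wrap[||||h].
  - by move=> i _; exact: grid_itv.
  - by move=> i _; exact: grid_le.
  - by move=> i _; exact: measurable_cst.
  - by move=> i w _; rewrite normr1.
  apply: le_trans h _; rewrite ler_pM2l//.
  rewrite -(@Ex_transform_sqr _ _ _ _ _ T B P_complete hB Z M hM (grid T n) n.+1 (fun _ _ => 1) 1)//; last 3 first.
  - by move=> i _; exact: grid_itv.
  - by move=> i _; exact: grid_le.
  - by move=> i w _; rewrite normr1.
  rewrite le_eqVlt; apply/orP; left; apply/eqP; congr (Ex P _); apply/funext => w.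
  under eq_bigr do rewrite mul1r.
  rewrite -(big_mkord xpredT (fun i => M (grid T n i.+1) w - M (grid T n i) w)) telescope_sumr//.
  by rewrite grid0 grid_last.
have cvgrun w : run n w @[n --> \oo] --> S w.
  have c := cont_on_ito (w := w).
  apply: (@squeeze_cvgr _ _ _ _ (fun n => S w - modulus T (fun t => X t w) (T / n.+1%:R)) (fun=> S w)).
  - apply: nearW => n; have [h1 h2] := supnorm_runmax n T_gt0 c.
    by rewrite lerBlDr; apply/andP; split.
  - rewrite -[X in _ --> X]subr0; apply: cvgB; first exact: cvg_cst.
    exact: modulus_cvg0.
  - exact: cvg_cst.
apply: SQ_EFin => //.
have -> : (fun w => (S w ^+ 2)%:E) = (fun w => limn_einf (fun n => (run n w ^+ 2)%:E)).
  apply/funext => w; apply/esym.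
  have : (run n w ^+ 2)%:E @[n --> \oo] --> (S w ^+ 2)%:E.
    by apply: cvg_EFin; [exact: nearW|exact: cvgM].
  by move=> /cvg_limn_einf_sup[].
apply: le_lt_trans (fatou _ _ _ _) _ => //.
- by move=> n; apply/measurable_EFinP; apply: measurable_funX; case: (SQrun n).
- by move=> n w _; rewrite lee_fin sqr_ge0.
apply: (@le_lt_trans _ _ (4 * Ex P (fun w => X T w ^+ 2))%:E); last exact: ltry.
rewrite limn_einf_lim; apply: lime_le; first exact: is_cvg_einfs.
apply: nearW => n; apply: (@le_trans _ _ (\int[P]_w (run n w ^+ 2)%:E)%E).
  by apply: ereal_inf_lbound; exists n => /=.
by rewrite -Ex_EFin ?lee_fin//; exact: SQ_sqr.
Qed.

End ito_supremum.

(** * Wasserstein distance to the Dirac mass *)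

Section wasserstein_bound.
Context {R : realType} {dsp : measure_display} {Omega : measurableType dsp}.
Context (P : probability Omega R) {d : nat}.
Variables (X : {RV P >-> R}) (V : {RV P >-> d.-tuple R}).

Definition pair_state0 (w : Omega) : (state R d * state R d)%type :=
  (pair_rv X V w, state0 R d).

Lemma measurable_pair_state0 : measurable_fun setT pair_state0.
Proof. by apply: measurable_fun_pair => //; exact: measurable_pair_rv. Qed.

HB.instance Definition _ :=
  isMeasurableFun.Build _ _ _ _ pair_state0 measurable_pair_state0.

Lemma measurable_sqdist :
  measurable_fun setT (fun x : state R d * state R d => sqdist x.1 x.2).
Proof.
rewrite /sqdist; apply: measurable_funD.
  apply: (@measurable_funX _ _ _ _ (fun x : state R d * state R d => x.1.1 - x.2.1)).
  apply: measurable_funB.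
    exact: (measurableT_comp measurable_fst measurable_fst).
  exact: (measurableT_comp measurable_fst measurable_snd).
apply: measurable_sum => i.
apply: (@measurable_funX _ _ _ _
  (fun x : state R d * state R d => tnth x.1.2 i - tnth x.2.2 i)).
have m1 := measurable_tnth (i : 'I_d) : measurable_fun setT (fun z : d.-tuple R => tnth z i).
apply: measurable_funB; apply: (measurableT_comp m1).
  exact: (measurableT_comp measurable_snd measurable_fst).
exact: (measurableT_comp measurable_snd measurable_snd).
Qed.

Lemma sqdist_ge0 (x y : state R d) : 0 <= sqdist x y.
Proof. by rewrite addr_ge0 ?sqr_ge0// sumr_ge0// => i _; exact: sqr_ge0. Qed.

Lemma sqdist_pair_state0 w : sqdist (pair_rv X V w) (state0 R d) = X w ^+ 2 + vnorm (V w) ^+ 2.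
Proof.
rewrite /sqdist /= subr0 sqr_vnormE; congr (_ + _); apply: eq_bigr => i _.
by rewrite tnth_mktuple subr0.
Qed.

(** The image of P under w -> ((X w, V w), 0) couples the law with the Dirac mass, and its cost is
    the second moment. Where that moment is infinite [joint_law] is [delta0] by convention, and the
    distance is 0. *)
Lemma W2_delta0_le :
  W2 (joint_law X V) delta0 <= Num.sqrt (fine (\int[P]_w (X w ^+ 2 + vnorm (V w) ^+ 2)%:E)%E).
Proof.
rewrite /joint_law; case: pselect => [fin|nfin]; last first.
  rewrite (_ : W2 delta0 delta0 = 0) ?sqrtr_ge0//.
  rewrite /W2 (_ : ereal_inf _ = 0%E) ?sqrtr0//.
  apply/eqP; rewrite eq_le; apply/andP; split; last first.
    apply: le_ereal_inf_tmp => _ [pi _ <-].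
    by apply: integral_ge0 => x _; rewrite lee_fin sqdist_ge0.
  apply: ereal_inf_lbound; exists (dirac (state0 R d, state0 R d)); last first.
    rewrite integral_dirac//; last by apply/measurable_EFinP; exact: measurable_sqdist.
    rewrite diracT mul1e /sqdist /= subrr expr0n/= add0r big1// => i _.
    by rewrite subrr expr0n.
  move=> A mA; rewrite /delta0/=; split.
    rewrite /= !diracE.
    by rewrite in_setX in_setT andbT.
  by rewrite !diracE !in_setX !in_setT.
apply: ler_wsqrtr.
have E : (\int[distribution P pair_state0]_x (sqdist x.1 x.2)%:E =
    \int[P]_w (X w ^+ 2 + vnorm (V w) ^+ 2)%:E)%E.
  rewrite ge0_integral_distribution//; first last.
    by move=> x; rewrite lee_fin sqdist_ge0.
    by apply/measurable_EFinP; exact: measurable_sqdist.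
  by apply: eq_integral => w _; rewrite /= sqdist_pair_state0.
have F : (\int[P]_w (X w ^+ 2 + vnorm (V w) ^+ 2)%:E < +oo)%E.
  move: fin; rewrite /finite_moment2 ge0_integral_distribution//; first last.
    by move=> x; rewrite lee_fin sqdist_ge0.
    by apply/measurable_EFinP; exact: measurable_sqdist0.
  by under eq_integral do rewrite /= sqdist_pair_state0.
have inf0 : (0 <= ereal_inf [set (\int[pi]_x (sqdist x.1 x.2)%:E)%E |
    pi in coupling (mkP2 fin) delta0])%E.
  apply: le_ereal_inf_tmp => _ [pi _ <-].
  by apply: integral_ge0 => x _; rewrite lee_fin sqdist_ge0.
have infle : (ereal_inf [set (\int[pi]_x (sqdist x.1 x.2)%:E)%E |
    pi in coupling (mkP2 fin) delta0] <= \int[P]_w (X w ^+ 2 + vnorm (V w) ^+ 2)%:E)%E.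
  rewrite -E; apply: ereal_inf_lbound; exists (distribution P pair_state0) => //.
  move=> A mA; split; rewrite /distribution/= /pushforward.
    by congr (P _); apply/seteqP; split => w //= [].
  rewrite diracE; transitivity (P (pair_state0 @^-1` (setT `*` A))); first by [].
  have [s0|s0] := boolP (state0 R d \in A).
    rewrite (_ : _ @^-1` _ = setT) ?probability_setT//.
    by apply/seteqP; split => w // _; split => //=; rewrite inE in s0.
  rewrite (_ : _ @^-1` _ = set0) ?measure0//.
  by apply/seteqP; split => w //= [_]; rewrite notin_setE in s0.
apply: fine_le => //; rewrite ge0_fin_numE//.
- exact: le_lt_trans F.
- exact: le_trans infle.
Qed.

End wasserstein_bound.

(** * Stieltjes integrals along the paths *)

Section stieltjes_measure.
Context {R : realType} (T : R) (k : incr_path T).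
Hypothesis T_ge0 : 0 <= T.

Lemma incr_path_ge0 t : t \in `[0, T] -> 0 <= k t.
Proof.
move=> tT; rewrite -(incr_0 k); apply: incr_nd => //; first by rewrite in_itv/= lexx.
by move: tT; rewrite in_itv/= => /andP[].
Qed.

Lemma stieltjes_itvoc a b : a <= b ->
  stieltjes k `]a, b]%classic = (frozen k b - frozen k a)%:E.
Proof.
move=> ab; transitivity (wlength (frozen k) `]a, b]%classic); last by rewrite wlength_itv_bnd.
exact: (measurable_mu_extE _ (is_ocitv a b)).
Qed.

Lemma stieltjes_setT_cvg :
  stieltjes k `](- n%:R), n%:R]%classic @[n --> \oo] --> stieltjes k setT.
Proof.
have -> : setT = \bigcup_n `](- n%:R), n%:R]%classic :> set R.
  apply/esym; rewrite -subTset => /= x _ /=; exists (Num.bound `|x|) => //=.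
  have := archi_boundP (normr_ge0 x); rewrite in_itv/= ltr_norml => /andP[-> /ltW].
  by move=> ->.
apply: (@nondecreasing_cvg_mu _ _ _ (stieltjes k) (fun n => `](- n%:R), n%:R]%classic)).
- by move=> ?; exact: measurable_itv.
- by apply: bigcup_measurable => n _; exact: measurable_itv.
- move=> n m nm; apply/subsetPset => x /=; rewrite !in_itv/= => /andP[h1 h2].
  by rewrite (le_trans h2) ?ler_nat// andbT (le_lt_trans _ h1)// lerN2 ler_nat.
Qed.

Lemma stieltjes_setT_le : (stieltjes k setT <= (k T)%:E)%E.
Proof.
have h := stieltjes_setT_cvg.
rewrite -(cvg_lim _ h)//; apply: lime_le; first by apply/cvg_ex; eexists; exact: h.
apply: nearW => n /=; rewrite stieltjes_itvoc ?lee_fin; last first.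
  by apply: (@le_trans _ _ 0) => //; rewrite lerNl oppr0.
rewrite -[leRHS]subr0; apply: lerB; last by apply: incr_path_ge0; exact: clamp_itv.
have TT : T \in `[0, T] by rewrite in_itv/= T_ge0 lexx.
have := clamp_itv n%:R T_ge0; move=> h'; apply: incr_nd => //.
by move: h'; rewrite in_itv/= => /andP[].
Qed.

Lemma stieltjes_fin (A : set (measurableTypeR R)) : measurable A ->
  stieltjes k A \is a fin_num.
Proof.
move=> mA; rewrite ge0_fin_numE//; apply: (@le_lt_trans _ _ (stieltjes k setT)).
  by apply: le_measure; rewrite ?inE.
by apply: le_lt_trans stieltjes_setT_le _; exact: ltry.
Qed.

(** Continuity of the path excludes an atom at s: the closed interval lies in ]s - 1/(n+1), t], and
    the mass of the latter tends to k t - k s. *)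
Lemma stieltjes_itvcc_le s t : 0 <= s -> s <= t -> t <= T ->
  (stieltjes k `[s, t]%classic <= (k t - k s)%:E)%E.
Proof.
move=> s0 st tT.
have sT : s \in `[0, T] by rewrite in_itv/= s0 (le_trans st).
have tT' : t \in `[0, T] by rewrite in_itv/= tT (le_trans s0).
have -> : (k t - k s)%:E = (frozen k t - frozen k s)%:E.
  by rewrite /frozen !clamp_id.
have le_n n : (stieltjes k `[s, t]%classic <= (frozen k t - frozen k (s - n.+1%:R^-1))%:E)%E.
  rewrite -stieltjes_itvoc; last by rewrite lerBlDr (le_trans st)// lerDl.
  apply: le_measure; rewrite ?inE//=; try exact: measurable_itv.
  move=> x /=; rewrite !in_itv/= => /andP[h1 ->]; rewrite andbT.
  by rewrite ltrBlDr (le_lt_trans h1)// ltrDl.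
have h : (frozen k t - frozen k (s - n.+1%:R^-1))%:E @[n --> \oo] --> (frozen k t - frozen k s)%:E.
  apply: cvg_EFin; first exact: nearW.
  apply: cvgB; first exact: cvg_cst.
  apply: (@cvg_comp _ _ _ (fun n : nat => s - n.+1%:R^-1) (frozen k) _ (nbhs s)).
    have : s - n.+1%:R^-1 @[n --> \oo] --> s - 0.
      by apply: cvgB; [exact: cvg_cst|exact: cvg_harmonic].
    by rewrite subr0.
  exact: (cont_on_clamp T_ge0 (@incr_cont _ _ k)).
rewrite -(cvg_lim _ h)//; apply: lime_ge; first by apply/cvg_ex; eexists; exact: h.
exact: nearW.
Qed.

Lemma stieltjes_itvco_le s t : 0 <= s -> s <= t -> t <= T ->
  (stieltjes k `[s, t[%classic <= (k t - k s)%:E)%E.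
Proof.
move=> s0 st tT; apply: le_trans (stieltjes_itvcc_le s0 st tT).
apply: le_measure; rewrite ?inE//=; try exact: measurable_itv.
by move=> x /=; rewrite !in_itv/= => /andP[-> /ltW ->].
Qed.

Lemma stieltjes_set1 t : t \in `[0, T] -> stieltjes k `[t, t]%classic = 0%E.
Proof.
rewrite in_itv/= => /andP[t0 tT]; apply/eqP; rewrite eq_le measure_ge0 andbT.
by have := stieltjes_itvcc_le t0 (lexx t) tT; rewrite subrr.
Qed.

End stieltjes_measure.

Section stieltjes_kernel.
Context {R : realType} {dsp : measure_display} {Omega : measurableType dsp}.
Variables (T : R) (kappa : Omega -> incr_path T).
Hypothesis T_ge0 : 0 <= T.
Hypothesis mkappa : forall t, t \in `[0, T] -> measurable_fun setT (fun w => kappa w t).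

Let stk w : {measure set (measurableTypeR R) -> \bar R} := stieltjes (kappa w).

(** Dynkin induction from half-open intervals, whose mass is a difference of two values of kappa;
    the finite total mass handles complements. The path measures thus form a kernel. *)
Lemma measurable_stieltjes (U : set (measurableTypeR R)) : measurable U ->
  measurable_fun setT (fun w => stieltjes (kappa w) U).
Proof.
have moc a b : measurable_fun setT (fun w => stieltjes (kappa w) `]a, b]%classic).
  have [ab|/ltW ba] := leP a b; last first.
    rewrite (_ : (fun w => _) = fun=> 0%E)//; apply/funext => w.
    by rewrite set_itv_ge ?measure0// -leNgt bnd_simp.
  rewrite (_ : (fun w => _) = fun w => (kappa w (clamp T b) - kappa w (clamp T a))%:E).
    by apply/measurable_EFinP; apply: measurable_funB; apply: mkappa; exact: clamp_itv.
  by apply/funext => w; rewrite stieltjes_itvoc.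
have mT : measurable_fun setT (fun w => stieltjes (kappa w) setT).
  apply: (@emeasurable_fun_cvg _ _ _ _ (fun n w => stieltjes (kappa w) `](- n%:R), n%:R]%classic)) => [n|w _].
    exact: moc.
  exact: stieltjes_setT_cvg.
apply: (@dynkin_induction _ (measurableTypeR R) (@ocitv R)
  (fun U => measurable_fun setT (fun w => stieltjes (kappa w) U))) => //.
- exact: ocitvI.
- by move=> _ [[a b] _ <-]; exact: moc.
- move=> S mS mPS; rewrite (_ : (fun w => _) = fun w => (stieltjes (kappa w) setT - stieltjes (kappa w) S)%E).
    by apply: emeasurable_funB.
  apply/funext => w; rewrite -setTD measureD// ?setTI//.
  by rewrite ltey_eq stieltjes_fin.
- move=> F mF tF mPF; rewrite (_ : (fun w => _) = fun w => (\sum_(n <oo) stieltjes (kappa w) (F n))%E).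
    by apply: ge0_emeasurable_sum.
  by apply/funext => w; rewrite measure_bigcup//; apply: eq_eseriesl => i; rewrite in_setT.
Qed.

HB.instance Definition _ := isKernel.Build _ _ Omega (measurableTypeR R) R stk measurable_stieltjes.

Import HBNNSimple.

Lemma jmeas_stieltjes (X : R -> Omega -> R) : jmeas T X ->
  (forall s w, s \in `[0, T] -> 0 <= X s w) ->
  measurable_fun setT (fun w => \int[stieltjes (kappa w)]_(s in `[0%R, T]) (X s w)%:E)%E.
Proof.
move=> mX X0.
pose h (p : Omega * measurableTypeR R) : \bar R :=
  ((fun q : measurableTypeR R * Omega => (X q.1 q.2)%:E) \_ (`[0, T]%classic `*` setT)) (p.2, p.1).
have mh : measurable_fun setT h.
  apply: (measurableT_comp (f := (fun q : measurableTypeR R * Omega => (X q.1 q.2)%:E) \_ (`[0, T]%classic `*` setT))).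
    apply/(measurable_restrictT _ _).1.
      by apply: measurableX => //; exact: measurable_itv.
    exact/measurable_EFinP.
  exact: measurable_swap.
have h0 p : (0 <= h p)%E.
  rewrite /h /patch; case: ifPn => //; rewrite inE/= => -[/= pT _].
  by rewrite lee_fin X0.
rewrite (_ : (fun w => _) = fun w => (\int[stk w]_s h (w, s))%E); last first.
  apply/funext => w; rewrite integral_mkcond; apply: eq_integral => s _.
  by rewrite /h /patch in_setX in_setT andbT.
pose h_ := nnsfun_approx measurableT mh.
apply: (@measurable_fun_xsection_integral _ _ _ _ _ h stk h_).
- by move=> a b ab; exact/nd_nnsfun_approx.
- by move=> z; exact/cvg_nnsfun_approx.
- move=> n r.
  have mA : measurable (h_ n @^-1` [set r]) by [].
  rewrite (_ : (fun w => _) = fun w => mrestr (stk w) measurableT (xsection (h_ n @^-1` [set r]) w)); last first.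
    by apply/funext => w; rewrite /mrestr setIT.
  have ub w : exists C, forall A : set (measurableTypeR R), measurable A ->
      (mrestr (stk w) measurableT A < C%:E)%E; last first.
    by have [] := @measurable_prod_subset_xsection_kernel _ _ Omega (measurableTypeR R) R
      (stk : R.-ker Omega ~> measurableTypeR R) setT measurableT ub _ mA.
  (* The total mass is at most [kappa w T]; adding 1 makes the required bound strict. *)
  exists (kappa w T + 1) => A mA'; rewrite /mrestr setIT.
  apply: (@le_lt_trans _ _ (kappa w T)%:E); last by rewrite lte_fin ltrDl.
  apply: le_trans (stieltjes_setT_le (kappa w) T_ge0).
  by apply: le_measure; rewrite ?inE.
Qed.

End stieltjes_kernel.

(** * Pathwise energy inequality on a grid *)

Section grid_integrals.
Context {R : realType} (T : R) (n : nat).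
Hypothesis T_gt0 : 0 < T.
Variable mu : {measure set (measurableTypeR R) -> \bar R}.

Local Notation g := (grid T n).
Let D : set (measurableTypeR R) := `[0, T]%classic.
Let mD : measurable D. Proof. exact: measurable_itv. Qed.
(** Cells are closed on the left because the equation integrates over [t, T]: splitting off a cell
    leaves an integral of the same form. For the Ito isometry they are closed on the right
    instead. *)
Let cell i : set (measurableTypeR R) := `[g i, g i.+1[%classic.
Let mcell i : measurable (cell i). Proof. exact: measurable_itv. Qed.

Lemma cell_sub i : `[g i, g i.+1[%classic `<=` `[0, T]%classic.
Proof.
move=> s /=; rewrite !in_itv/= => /andP[h1 /ltW h2].
have /andP[a0 _] := grid_itv n T_gt0 i; have /andP[_ bT] := grid_itv n T_gt0 i.+1.
by rewrite (le_trans a0 h1) (le_trans h2 bT).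
Qed.

Lemma integrable_cell (h : R -> R) i : mu.-integrable `[0, T]%classic (EFin \o h) ->
  mu.-integrable `[g i, g i.+1[%classic (EFin \o h).
Proof. by move=> ih; apply: (integrableS mD (mcell i) (@cell_sub i) ih). Qed.

Lemma sum_cell_eq (h : R -> R) k : mu.-integrable `[0, T]%classic (EFin \o h) ->
  (forall s, s \in `[0, T] -> 0 <= h s) ->
  \sum_(0 <= i < k) \int[mu]_(s in `[g i, g i.+1[) h s = \int[mu]_(s in `[0, g k[) h s.
Proof.
move=> ih h0; have hh s : D s -> `|h s| <= h s by move=> Ds; rewrite ger0_norm// h0.
elim: k => [|k IH]; first by rewrite big_geq// grid0 set_itvco0 Rintegral_set0.
  rewrite big_nat_recr//= IH.
  have /andP[k0 _] := grid_itv n T_gt0 k.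
  have /andP[_ kT] := grid_itv n T_gt0 k.+1.
  have -> : `[0, g k.+1[%classic = `[0, g k[%classic `|` `[g k, g k.+1[%classic :> set R.
    by rewrite -itv_bndbnd_setU// ?bnd_simp//; exact: grid_le.
  rewrite (@Rintegral_setU_dom _ _ _ mu D mD h h ih hh)//.
  - move=> s [|/cell_sub//] /=; rewrite /D/= !in_itv/= => /andP[s0 /ltW h1].
    by rewrite s0/= (le_trans h1)// (le_trans _ kT)// grid_le.
  - rewrite disj_set2E; apply/eqP/seteqP; split => s //= -[].
    by rewrite !in_itv/= => /andP[_ h1] /andP[h2 _]; move: (lt_le_trans h1 h2); rewrite ltxx.
Qed.

Lemma sum_cell_le (h : R -> R) j : mu.-integrable `[0, T]%classic (EFin \o h) ->
  (forall s, s \in `[0, T] -> 0 <= h s) ->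
  \sum_(j <= i < n.+1) \int[mu]_(s in `[g i, g i.+1[) h s <= \int[mu]_(s in `[0, T]) h s.
Proof.
move=> ih h0; have hh s : D s -> `|h s| <= h s by move=> Ds; rewrite ger0_norm// h0.
have c0 i : 0 <= \int[mu]_(s in `[g i, g i.+1[) h s.
  by apply: Rintegral_ge0 => s Ds; apply: h0; exact: (cell_sub Ds).
apply: (@le_trans _ _ (\sum_(0 <= i < n.+1) \int[mu]_(s in `[g i, g i.+1[) h s)).
  have [nj|jn] := leqP n.+1 j; first by rewrite big_geq// sumr_ge0.
  by rewrite [leRHS](@big_cat_nat _ _ _ j)//= ?(ltnW jn)// lerDr sumr_ge0.
rewrite (sum_cell_eq n.+1 ih h0) grid_last.
have sub : `[0, T[%classic `<=` D by move=> s; rewrite /D/= !in_itv/= => /andP[-> /ltW].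
have m2 : measurable (`[0, T[%classic : set (measurableTypeR R)) by exact: measurable_itv.
rewrite /Rintegral; apply: fine_le.
- apply: integrable_fin_num => //; exact: (integrableS mD m2 sub ih).
- by apply: integrable_fin_num.
- apply: ge0_subset_integral => //.
  by case/integrableP : ih.
Qed.

Lemma cell_split (F Fb : R -> R) i : mu.-integrable `[0, T]%classic (EFin \o Fb) ->
  (forall s, s \in `[0, T] -> `|F s| <= Fb s) ->
  \int[mu]_(s in `[g i, T]) F s =
  \int[mu]_(s in `[g i, g i.+1[) F s + \int[mu]_(s in `[g i.+1, T]) F s.
Proof.
move=> iFb FFb.
have /andP[i0 _] := grid_itv n T_gt0 i.
have /andP[i10 i1T] := grid_itv n T_gt0 i.+1.
have -> : `[g i, T]%classic = `[g i, g i.+1[%classic `|` `[g i.+1, T]%classic :> set R.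
  by rewrite -itv_bndbnd_setU// ?bnd_simp//; exact: grid_le.
apply: (@Rintegral_setU_dom _ _ _ mu D mD F Fb iFb) => //.
- move=> s [/cell_sub//|] /=; rewrite /D/= !in_itv/= => /andP[h1 h2].
  by rewrite (le_trans i10 h1).
- rewrite disj_set2E; apply/eqP/seteqP; split => s //= -[].
  by rewrite !in_itv/= => /andP[_ h1] /andP[h2 _]; move: (lt_le_trans h1 h2); rewrite ltxx.
Qed.

Lemma cell_bound (F Fb h : R -> R) (c : R) i : mu.-integrable `[0, T]%classic (EFin \o Fb) ->
  mu.-integrable `[0, T]%classic (EFin \o h) ->
  (forall s, s \in `[0, T] -> `|F s| <= Fb s) ->
  (forall s, g i <= s <= g i.+1 -> `|c| * Fb s <= h s) ->
  (\int[mu]_(s in `[g i, g i.+1[) F s) * c <= \int[mu]_(s in `[g i, g i.+1[) h s.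
Proof.
move=> iFb ih FFb ch.
apply: le_trans (ler_norm _) _; rewrite normrM mulrC.
apply: (@le_trans _ _ (`|c| * \int[mu]_(s in `[g i, g i.+1[) Fb s)).
  apply: ler_wpM2l => //.
  exact: (@ler_norm_Rintegral_dom _ _ _ mu D mD F Fb iFb FFb _ (mcell i) (@cell_sub i)).
rewrite -RintegralZl//; last exact: integrable_cell.
apply: le_Rintegral => //.
- apply: integrable_cell; have := integrableZl mD `|c| iFb.
  exact.
- exact: integrable_cell.
- by move=> s /=; rewrite in_itv/= => /andP[h1 /ltW h2]; apply: ch; rewrite h1 h2.
Qed.

(** In contrast to [cell_bound], which knows F through |F| <= Fb only, the sign of G is kept here;
    this is where the monotonicity of g can act. *)
Lemma cell_bound_meas (G h : R -> R) (c : R) i : mu.-integrable `[0, T]%classic (EFin \o G) ->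
  mu.-integrable `[0, T]%classic (EFin \o h) ->
  (forall s, g i <= s <= g i.+1 -> c * G s <= h s) ->
  (\int[mu]_(s in `[g i, g i.+1[) G s) * c <= \int[mu]_(s in `[g i, g i.+1[) h s.
Proof.
move=> iG ih ch; rewrite mulrC -RintegralZl//; last exact: integrable_cell.
apply: le_Rintegral => //.
- apply: integrable_cell; have := integrableZl mD c iG.
  exact.
- exact: integrable_cell.
- by move=> s /=; rewrite in_itv/= => /andP[h1 /ltW h2]; apply: ch; rewrite h1 h2.
Qed.

End grid_integrals.

(** The increase from c to c + 1 pays for the cross term o p, so that what is left of the error
    carries o but no longer p. *)
Lemma young_growth (R : realFieldType) (x z c o p L : R) :
  x <= c * p ^+ 2 -> z <= o * (p + L) ->
  x + z <= (c + 1) * p ^+ 2 + (o ^+ 2 + o * L).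
Proof.
move=> h1 h2; have h3 := sqr_ge0 (o - p); have h4 := sqr_ge0 o; have h5 := sqr_ge0 p.
have h6 : (o - p) ^+ 2 = o ^+ 2 - 2 * (o * p) + p ^+ 2 by ring.
have h7 : o * (p + L) = o * p + o * L by ring.
by rewrite mulrDl mul1r; lra.
Qed.

Lemma measurable_expR_scale (R : realType) (D : set (measurableTypeR R)) (alpha : R) :
  measurable_fun D (fun s => expR (alpha * s)).
Proof.
apply: (measurableT_comp (@measurable_expR R)).
by apply: (@measurable_funM _ (measurableTypeR R) R D (fun=> alpha) (fun s => s)) => //; exact: measurable_id.
Qed.

Section energy_inequality.
Context {R : realType} (T : R) (n : nat).
Hypothesis T_gt0 : 0 < T.
Variables (k K : incr_path T) (y m F Fb G pp : R -> R) (xi alpha c Lg ys om oy q : R).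
Hypothesis alpha_ge0 : 0 <= alpha.
Hypothesis c_ge0 : 0 <= c.
Hypothesis Lg_ge0 : 0 <= Lg.
Hypothesis q_ge0 : 0 <= q.
Hypothesis iFb : (lebesgue_measure : set (measurableTypeR R) -> \bar R).-integrable
  `[0, T]%classic (EFin \o Fb).
Hypothesis FFb : forall s, s \in `[0, T] -> `|F s| <= Fb s.
Hypothesis my : measurable_fun (`[0, T]%classic : set (measurableTypeR R)) y.
Hypothesis mG : measurable_fun (`[0, T]%classic : set (measurableTypeR R)) G.
Hypothesis mpp : measurable_fun (`[0, T]%classic : set (measurableTypeR R)) pp.
Hypothesis pp_ge0 : forall s, s \in `[0, T] -> 0 <= pp s.
Hypothesis ipp : (stieltjes k).-integrable `[0, T]%classic (EFin \o (fun s => pp s ^+ 2)).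
Hypothesis G_growth : forall s, s \in `[0, T] -> `|G s| <= pp s + Lg * `|y s|.
Hypothesis G_mono : forall s, s \in `[0, T] -> 2 * y s * G s <= c * pp s ^+ 2.
Hypothesis y_bound : forall s, s \in `[0, T] -> `|y s| <= ys.
Hypothesis m_mod : forall s t, s \in `[0, T] -> t \in `[0, T] ->
  `|s - t| <= T / n.+1%:R -> `|m s - m t| <= om.
Hypothesis y_mod : forall s t, s \in `[0, T] -> t \in `[0, T] ->
  `|s - t| <= T / n.+1%:R -> `|y s - y t| <= oy.
Hypothesis eqn : forall t, t \in `[0, T] ->
  y t = xi + \int[lebesgue_measure]_(s in `[t, T]) F s
    + \int[stieltjes k]_(s in `[t, T]) G s - (m T - m t) + (K T - K t).

Local Notation g := (grid T n).
Let D : set (measurableTypeR R) := `[0, T]%classic.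
Let mD : measurable D. Proof. exact: measurable_itv. Qed.
Let T_ge0 : 0 <= T. Proof. exact: ltW. Qed.
Let gin i : g i \in `[0, T]. Proof. exact: grid_in. Qed.
Let g0 i : 0 <= g i. Proof. by have /andP[] := grid_itv n T_gt0 i. Qed.
Let gT i : g i <= T. Proof. by have /andP[] := grid_itv n T_gt0 i. Qed.
Let gle i : g i <= g i.+1. Proof. exact: grid_le. Qed.
Let TT : T \in `[0, T]. Proof. by rewrite in_itv/= T_ge0 lexx. Qed.
Let zT : 0 \in `[0, T]. Proof. by rewrite in_itv/= T_ge0 lexx. Qed.

Let E := expR (alpha * T).
(** The distance between 2 y(s) and the factor [S i] that multiplies the increments, for s in the
    cell: one oscillation of m and two of y. *)
Let o := om + 2 * oy.
Let chi i : R := (k (g i) <= q)%R%:R.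
Let e i := expR (alpha * g i).

Let ys_ge0 : 0 <= ys. Proof. exact: le_trans (y_bound zT). Qed.
Let oy_ge0 : 0 <= oy.
Proof. by apply: le_trans (y_mod zT zT _); rewrite ?subrr ?normr0 ?divr_ge0. Qed.
Let om_ge0 : 0 <= om.
Proof. by apply: le_trans (m_mod zT zT _); rewrite ?subrr ?normr0 ?divr_ge0. Qed.
Let o_ge0 : 0 <= o. Proof. by rewrite addr_ge0// mulr_ge0. Qed.
Let E_ge0 : 0 <= E. Proof. exact: expR_ge0. Qed.
Let Fb_ge0 s : s \in `[0, T] -> 0 <= Fb s.
Proof. by move=> /FFb; apply: le_trans. Qed.

Let chi_nd i : chi i.+1 <= chi i.
Proof.
rewrite /chi ler_nat; case: (leP (k (g i.+1)) q) => // h.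
by rewrite (le_trans _ h)//; apply: incr_nd => //; rewrite inE.
Qed.
Let chi01 i : 0 <= chi i <= 1.
Proof. by rewrite /chi ler0n lern1 leq_b1. Qed.
Let eE i : 0 <= e i <= E.
Proof. by rewrite expR_ge0 ler_expR ler_wpM2l. Qed.

Let Gb s := pp s + Lg * `|y s|.

Let ik_bounded (h : R -> R) (C : R) : measurable_fun D h ->
  (forall s, s \in `[0, T] -> `|h s| <= C) -> (stieltjes k).-integrable D (EFin \o h).
Proof.
move=> mh hC; apply: (@measurable_bounded_integrable _ _ _ (stieltjes k)) => //.
  by rewrite ltey_eq stieltjes_fin.
exists C; split; first by rewrite num_real.
by move=> x Cx s Ds; apply: le_trans (ltW Cx); exact: hC.
Qed.

Let il_ysFb : (lebesgue_measure : set (measurableTypeR R) -> \bar R).-integrable D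
  (EFin \o (fun s => 2 * expR (alpha * s) * `|y s| * Fb s)).
Proof.
have mFb : measurable_fun D Fb by apply/measurable_EFinP; case/integrableP : iFb.
apply: (@le_integrable _ _ _ _ _ mD _ (EFin \o (fun s => (2 * E * ys) * Fb s))).
- apply/measurable_EFinP; apply: measurable_funM => //; apply: measurable_funM; last exact: measurableT_comp.
  by apply: measurable_funM => //; exact: measurable_expR_scale.
- move=> s Ds; rewrite /= lee_fin.
  have h1 : 0 <= 2 * expR (alpha * s) * `|y s| by rewrite !mulr_ge0 ?expR_ge0.
  have h2 : 2 * expR (alpha * s) * `|y s| <= 2 * E * ys.
    apply: ler_pM; rewrite ?mulr_ge0 ?expR_ge0//; last exact: y_bound.
    rewrite ler_pM2l// ler_expR ler_wpM2l//.
    by move: Ds; rewrite /D/= in_itv/= => /andP[].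
  apply: le_trans (ler_norm _); rewrite normrM (ger0_norm h1) (ger0_norm (Fb_ge0 Ds)).
  by rewrite ler_wpM2r// Fb_ge0.
- have := integrableZl mD (2 * E * ys) iFb; exact.
Qed.

Let iGb : (stieltjes k).-integrable D (EFin \o Gb).
Proof.
apply: (@le_integrable _ _ _ _ _ mD _ ((EFin \o (fun s => pp s ^+ 2)) \+ (EFin \o (fun=> 1 + Lg * ys)))).
- apply/measurable_EFinP; apply: measurable_funD => //; apply: measurable_funM => //.
  exact: measurableT_comp.
- move=> s Ds; rewrite /= lee_fin /Gb.
  have p0 := pp_ge0 Ds; have yb := y_bound Ds.
  have h : Lg * `|y s| <= Lg * ys by rewrite ler_wpM2l.
  have h0 : 0 <= Lg * `|y s| by rewrite mulr_ge0.
  have h1 := sqr_ge0 (pp s - 1); have h2 := sqr_ge0 (pp s).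
  have h3 : (pp s - 1) ^+ 2 = pp s ^+ 2 - 2 * pp s + 1 by ring.
  by rewrite (ger0_norm (addr_ge0 p0 h0)); apply: le_trans (ler_norm _); lra.
- apply: integrableD => //.
  apply: (@ik_bounded _ (`|1 + Lg * ys|)) => //.
Qed.

Let iG : (stieltjes k).-integrable D (EFin \o G).
Proof.
apply: (@le_integrable _ _ _ _ _ mD _ (EFin \o Gb)) => //; first exact/measurable_EFinP.
move=> s Ds; rewrite /= lee_fin; apply: le_trans (G_growth Ds) _; exact: ler_norm.
Qed.

Let cst := o ^+ 2 + Lg * o * ys.
Let cst_ge0 : 0 <= cst. Proof. by rewrite addr_ge0 ?sqr_ge0// !mulr_ge0. Qed.
Let hG s := (c + 1) * pp s ^+ 2 + cst.

Let i_pp2 : (stieltjes k).-integrable D (EFin \o (fun s => (c + 1) * pp s ^+ 2)).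
Proof. have := integrableZl mD (c + 1) ipp; exact. Qed.

Let i_cst : (stieltjes k).-integrable D (EFin \o (fun=> cst)).
Proof. by apply: (@ik_bounded _ `|cst|). Qed.

Let ihG : (stieltjes k).-integrable D (EFin \o hG).
Proof. have := integrableD mD i_pp2 i_cst; exact. Qed.

Let hF s := 2 * expR (alpha * s) * `|y s| * Fb s + (E * o) * Fb s.
Let ioF : (lebesgue_measure : set (measurableTypeR R) -> \bar R).-integrable D
  (EFin \o (fun s => (E * o) * Fb s)).
Proof. have := integrableZl mD (E * o) iFb; exact. Qed.
Let ihF : (lebesgue_measure : set (measurableTypeR R) -> \bar R).-integrable D (EFin \o hF).
Proof. have := integrableD mD il_ysFb ioF; exact. Qed.
Let hF_ge0 s : s \in `[0, T] -> 0 <= hF s.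
Proof. by move=> sT; rewrite addr_ge0// !mulr_ge0 ?expR_ge0 ?Fb_ge0. Qed.

Let a i := \int[lebesgue_measure]_(s in `[g i, g i.+1[) F s.
Let b i := \int[stieltjes k]_(s in `[g i, g i.+1[) G s.
Let S i := m (g i.+1) - m (g i) + y (g i) + y (g i.+1).

Let increments i : m (g i.+1) - m (g i) - (y (g i.+1) - y (g i)) =
  a i + b i + (K (g i.+1) - K (g i)).
Proof.
rewrite (eqn (gin i)) (eqn (gin i.+1)).
rewrite (@cell_split _ T n T_gt0 lebesgue_measure F Fb i)// (@cell_split _ T n T_gt0 (stieltjes k) G Gb i)//.
rewrite -/(a i) -/(b i).
move: (a i) (b i) (\int[lebesgue_measure]_(s in `[g i.+1, T]) F s)
  (\int[stieltjes k]_(s in `[g i.+1, T]) G s) => a' b' a'' b''; ring.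
Qed.

Let S_near i s : g i <= s <= g i.+1 -> `|S i - 2 * y s| <= o.
Proof.
move=> hs; have sT : s \in `[0, T].
  by move: hs; rewrite in_itv/= => /andP[h1 h2]; rewrite (le_trans (g0 i) h1) (le_trans h2 (gT i.+1)).
have [d1 d2] := grid_dist T_gt0 hs.
have h1 := y_mod sT (gin i) d1; have h2 := y_mod (gin i.+1) sT d2.
have h3 : `|m (g i.+1) - m (g i)| <= om.
  by apply: m_mod => //; have := grid_gap n T_gt0 i; rewrite ger0_norm ?subr_ge0.
have -> : S i - 2 * y s = (m (g i.+1) - m (g i)) + (- (y s - y (g i)) + (y (g i.+1) - y s)).
  by rewrite /S; ring.
apply: le_trans (ler_normD _ _) _; rewrite /o lerD// mulr2n mulrDl mul1r.
by apply: le_trans (ler_normD _ _) _; rewrite normrN lerD.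
Qed.

Let S_bound i : `|S i| <= 2 * ys + o.
Proof.
have h := S_near (i := i) (s := g i); rewrite lexx gle in h; have {}h := h isT.
have h2 := y_bound (gin i).
rewrite -[S i](subrK (2 * y (g i))) addrC; apply: le_trans (ler_normD _ _) _.
by rewrite lerD// normrM ger0_norm// ler_pM2l.
Qed.

(** The increment of bounded variation splits into drift, boundary and reflection parts. In the
    first two the factor [S i] is traded for 2 y(s) under the integral, at the cost o, before the
    majorant and the monotonicity are used; in the third [S i] is bounded crudely. The factor chi
    i.+1 stays with the increment of k, for [stopped_increments]. *)
Let term_bound i :
  chi i.+1 * e i * ((m (g i.+1) - m (g i) - (y (g i.+1) - y (g i))) * S i) <=
  \int[lebesgue_measure]_(s in `[g i, g i.+1[) hF s
  + E * ((\int[stieltjes k]_(s in `[g i, g i.+1[) ((c + 1) * pp s ^+ 2))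
         + cst * (chi i.+1 * (k (g i.+1) - k (g i))))
  + E * (2 * ys + o) * (K (g i.+1) - K (g i)).
Proof.
rewrite increments; have /andP[e0 eiE] := eE i; have /andP[c0 c1] := chi01 i.+1.
have KK : 0 <= K (g i.+1) - K (g i) by rewrite subr_ge0 incr_nd// inE.
have HA : a i * (e i * S i) <= \int[lebesgue_measure]_(s in `[g i, g i.+1[) hF s.
  apply: (@cell_bound _ T n T_gt0 lebesgue_measure F Fb hF) => // s hs.
  have sT : s \in `[0, T].
    by move: hs; rewrite in_itv/= => /andP[h1 h2]; rewrite (le_trans (g0 i) h1) (le_trans h2 (gT i.+1)).
  have F0 := Fb_ge0 sT.
  rewrite /hF -mulrDl ler_wpM2r// normrM (ger0_norm e0).
  have h1 : e i <= expR (alpha * s).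
    by rewrite ler_expR ler_wpM2l//; case/andP : hs.
  have h2 : `|S i| <= 2 * `|y s| + o.
    rewrite -[S i](subrK (2 * y s)) addrC; apply: le_trans (ler_normD _ _) _.
    by rewrite normrM (ger0_norm (ler0n _ 2)) lerD// S_near.
  apply: (@le_trans _ _ (e i * (2 * `|y s| + o))); first by rewrite ler_wpM2l.
  rewrite mulrDr lerD//; last by rewrite ler_wpM2r.
  by rewrite mulrCA -mulrA ler_pM2l// ler_wpM2r.
have HA0 : 0 <= \int[lebesgue_measure]_(s in `[g i, g i.+1[) hF s.
  by apply: Rintegral_ge0 => s Ds; apply: hF_ge0; exact: (cell_sub T_gt0 Ds).
have HB : b i * S i <= \int[stieltjes k]_(s in `[g i, g i.+1[) hG s.
  apply: (@cell_bound_meas _ T n T_gt0 (stieltjes k) G hG) => // s hs.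
  have sT : s \in `[0, T].
    by move: hs; rewrite in_itv/= => /andP[h1 h2]; rewrite (le_trans (g0 i) h1) (le_trans h2 (gT i.+1)).
  have h1 := G_mono sT; have h2 := G_growth sT; have h3 := y_bound sT.
  have h4 := S_near hs.
  have -> : S i * G s = 2 * y s * G s + (S i - 2 * y s) * G s by ring.
  have h5 : (S i - 2 * y s) * G s <= o * (pp s + Lg * ys).
    apply: le_trans (ler_norm _) _; rewrite normrM; apply: ler_pM => //.
    by apply: le_trans h2 _; rewrite lerD2l ler_wpM2l.
  apply: le_trans (young_growth h1 h5) _.
  by rewrite /hG /cst -(mulrC o Lg) -(mulrA o).
have HC : \int[stieltjes k]_(s in `[g i, g i.+1[) hG s <=
    \int[stieltjes k]_(s in `[g i, g i.+1[) ((c + 1) * pp s ^+ 2)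
    + cst * (k (g i.+1) - k (g i)).
  rewrite RintegralD//; last 2 first.
  - exact: integrable_cell.
  - exact: integrable_cell.
  rewrite lerD2l Rintegral_cst; last exact: measurable_itv.
  rewrite ler_wpM2l// -lee_fin fineK; first exact: stieltjes_itvco_le.
  by apply: stieltjes_fin => //; exact: measurable_itv.
have HP0 : 0 <= \int[stieltjes k]_(s in `[g i, g i.+1[) ((c + 1) * pp s ^+ 2).
  by apply: Rintegral_ge0 => s Ds; rewrite mulr_ge0 ?sqr_ge0 ?addr_ge0.
have kk : 0 <= k (g i.+1) - k (g i) by rewrite subr_ge0 incr_nd// inE.
have HS : S i <= 2 * ys + o by apply: le_trans (ler_norm _) (S_bound i).
have -> : chi i.+1 * e i * ((a i + b i + (K (g i.+1) - K (g i))) * S i) =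
  chi i.+1 * (a i * (e i * S i)) + e i * (chi i.+1 * (b i * S i))
  + chi i.+1 * e i * (K (g i.+1) - K (g i)) * S i by ring.
apply: lerD; first apply: lerD.
- apply: le_trans (ler_wpM2l c0 HA) _; exact: ler_piMl.
- have h : chi i.+1 * (b i * S i) <=
    (\int[stieltjes k]_(s in `[g i, g i.+1[) ((c + 1) * pp s ^+ 2))
         + cst * (chi i.+1 * (k (g i.+1) - k (g i))).
    apply: le_trans (ler_wpM2l c0 (le_trans HB HC)) _.
    rewrite mulrDr mulrCA lerD2r; exact: ler_piMl.
  apply: le_trans (ler_wpM2l e0 h) _; apply: ler_wpM2r => //.
  by rewrite addr_ge0// !mulr_ge0.
- have -> : E * (2 * ys + o) * (K (g i.+1) - K (g i)) = E * (K (g i.+1) - K (g i)) * (2 * ys + o) by ring.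
  have h : chi i.+1 * e i <= E by apply: le_trans eiE; exact: ler_piMl.
  apply: (@le_trans _ _ (chi i.+1 * e i * (K (g i.+1) - K (g i)) * (2 * ys + o))).
    by rewrite ler_wpM2l// !mulr_ge0.
  by rewrite ler_wpM2r ?addr_ge0 ?mulr_ge0// ler_wpM2r.
Qed.

Let yT : y (g n.+1) = xi.
Proof.
rewrite grid_last (eqn TT) !subrr subr0 addr0.
rewrite set_itv1 Rintegral_set1 addr0 -set_itv1.
rewrite /Rintegral null_set_integral ?addr0//.
- apply/measurable_EFinP; by apply: measurable_funS mG => // s /=; rewrite !in_itv/= => /andP[/(le_trans T_ge0) -> ->].
- by have := stieltjes_set1 k T_ge0 TT.
Qed.

(** The starting index j is free: 0 serves for the energy, and the index where |y| is maximal serves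
    for the supremum. *)
Lemma energy_bound j : (j <= n.+1)%N ->
  chi j * e j * y (g j) ^+ 2
  + \sum_(j <= i < n.+1) chi i.+1 * (e i.+1 - e i) * y (g i.+1) ^+ 2
  + \sum_(j <= i < n.+1) chi i * e i * (m (g i.+1) - m (g i)) ^+ 2
  + 2 * \sum_(j <= i < n.+1) chi i * e i * y (g i) * (m (g i.+1) - m (g i))
  <= E * xi ^+ 2 + (1 - chi n.+1) * (E * ys ^+ 2) + E * (2 * ys * o + o ^+ 2)
   + (\int[lebesgue_measure]_(s in `[0, T]) (2 * expR (alpha * s) * `|y s| * Fb s)
      + E * o * \int[lebesgue_measure]_(s in `[0, T]) Fb s
      + E * ((c + 1) * \int[stieltjes k]_(s in `[0, T]) (pp s ^+ 2)
             + (o ^+ 2 + Lg * o * ys) * q)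
      + E * (2 * ys + o) * K T).
Proof.
move=> jn.
have hy i : (i <= n.+1)%N -> `|(y \o g) i| <= ys by move=> _; exact: y_bound.
have hm i : (i < n.+1)%N -> `|(m \o g) i.+1 - (m \o g) i| <= o.
  move=> _ /=; apply: (@le_trans _ _ om); last by rewrite lerDl mulr_ge0.
  by apply: m_mod => //; have := grid_gap n T_gt0 i; rewrite ger0_norm ?subr_ge0.
have := stopped_square_bound jn chi_nd chi01 eE hy o_ge0 hm.
rewrite /= yT; move/le_trans; apply; rewrite lerD2l.
apply: le_trans (ler_sum _ (fun i _ => term_bound i)) _.
rewrite big_split big_split/=; apply: lerD; first apply: lerD.
- have h := @sum_cell_le _ T n T_gt0 lebesgue_measure hF j ihF hF_ge0.
  apply: le_trans h _; rewrite RintegralD//.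
  by rewrite lerD2l RintegralZl.
- rewrite -big_distrr/= ler_wpM2l// big_split/=; apply: lerD.
    rewrite -RintegralZl//; apply: sum_cell_le => // s sT.
    by rewrite mulr_ge0 ?sqr_ge0 ?addr_ge0.
  rewrite -big_distrr/= ler_wpM2l//.
  have h := @stopped_increments _ (k \o g) q n.+1.
  apply: le_trans (h _ q_ge0 _) => /=; last 2 first.
  - by rewrite grid0 incr_0.
  - by move=> i; apply: incr_nd => //; rewrite inE.
  rewrite -(big_mkord xpredT (fun i => (k (g i.+1) <= q)%R%:R * (k (g i.+1) - k (g i)))).
  rewrite [leRHS](@big_cat_nat _ _ _ j)//= lerDr sumr_ge0// => i _.
  by rewrite mulr_ge0// subr_ge0 incr_nd// inE.
- rewrite -big_distrr/= ler_wpM2l ?mulr_ge0 ?addr_ge0 ?mulr_ge0//.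
  rewrite telescope_sumr// grid_last lerBlDr lerDl incr_path_ge0//.
Qed.

End energy_inequality.

Section fine_integrals.
Context d (S : measurableType d) (R : realType).
Variable P : probability S R.

Lemma Ig_fine (h : S -> \bar R) : measurable_fun setT h -> (forall w, 0 <= h w)%E ->
  (\int[P]_w h w < +oo)%E ->
  [/\ Ig P (fun w => fine (h w)), ((Ex P (fun w => fine (h w)))%:E = \int[P]_w h w)%E &
      {ae P, forall w, (h w < +oo)%E}].
Proof.
move=> mh h0 hoo.
have ih : P.-integrable setT h.
  apply/integrableP; split => //; rewrite (eq_integral h)// => w _.
  by rewrite gee0_abs.
have ae : {ae P, forall w, (h w < +oo)%E}.
  have /(_ measurableT) := integrable_ae _ ih; apply: filterS => w /(_ I).
  by rewrite ge0_fin_numE.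
have mf : measurable_fun setT (fun w => fine (h w)) by exact: measurableT_comp.
have E : (\int[P]_w (fine (h w))%:E = \int[P]_w h w)%E.
  apply: ae_eq_integral => //; first exact/measurable_EFinP.
  by apply: filterS ae => w hw _; rewrite fineK// ge0_fin_numE.
have I : Ig P (fun w => fine (h w)).
  apply/integrableP; split; first exact/measurable_EFinP.
  rewrite (eq_integral (fun w => (fine (h w))%:E)) ?E// => w _.
  by rewrite gee0_abs// lee_fin fine_ge0.
by split => //; rewrite Ex_EFin.
Qed.

Lemma Ex_le_ae (X Y : S -> R) : Ig P X -> Ig P Y -> {ae P, forall w, X w <= Y w} ->
  Ex P X <= Ex P Y.
Proof.
move=> iX iY XY.
have := @Ex_le_nonmeasurable _ _ _ P X Y (fun=> 0%E) iX iY (fun=> lexx _).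
move=> /(_ _)/wrap[|]; first by apply: filterS XY => w XY; rewrite adde0 lee_fin.
by rewrite integral0 adde0 lee_fin.
Qed.

Lemma Ig_le_ae (X Y : S -> R) : measurable_fun setT X -> Ig P Y ->
  {ae P, forall w, `|X w| <= Y w} -> Ig P X.
Proof.
move=> mX iY XY; apply/integrableP; split; first exact/measurable_EFinP.
have /integrableP[mY fY] := iY; apply: le_lt_trans fY.
apply: ae_ge0_le_integral => //.
- by apply/measurable_EFinP; exact: measurableT_comp.
- by move: mY => /measurable_EFinP mY; apply/measurable_EFinP; exact: measurableT_comp.
- by apply: filterS XY => w h _; rewrite /= lee_fin; apply: le_trans h (ler_norm _).
Qed.

End fine_integrals.

Section time_integrals.
Context {R : realType} {dsp : measure_display} {Omega : measurableType dsp}.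
Context (P : probability Omega R) (T : R).
Variable X : R -> Omega -> R.
Hypothesis mX : jmeas T X.
Hypothesis X0 : forall s w, s \in `[0, T] -> 0 <= X s w.
Hypothesis iX : (\int[P]_w \int[lebesgue_measure]_(s in `[0%R, T]) (X s w)%:E < +oo)%E.

Let h w := (\int[lebesgue_measure]_(s in `[0%R, T]) (X s w)%:E)%E.

Lemma time_integral :
  [/\ Ig P (fun w => \int[lebesgue_measure]_(s in `[0, T]) X s w),
      ((Ex P (fun w => \int[lebesgue_measure]_(s in `[0, T]) X s w))%:E =
       \int[P]_w \int[lebesgue_measure]_(s in `[0%R, T]) (X s w)%:E)%E &
      {ae P, forall w, (lebesgue_measure : set (measurableTypeR R) -> \bar R).-integrable
         `[0, T]%classic (EFin \o X ^~ w)}].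
Proof.
have mh : measurable_fun setT h.
  exact: (jmeas_integral mX).
have h0 w : (0 <= h w)%E by apply: integral_ge0 => s sT; rewrite lee_fin X0.
have [i e ae] := Ig_fine mh h0 iX; split => //.
apply: filterS ae => w hw; apply/integrableP; split.
  by apply/measurable_EFinP; exact: jmeas_section.
apply: le_lt_trans hw; rewrite le_eqVlt; apply/orP; left; apply/eqP.
by apply: eq_integral => s; rewrite inE => sT; rewrite gee0_abs// lee_fin X0.
Qed.

End time_integrals.

(** Cauchy-Schwarz against the constant 1, from h <= l / 2 + h^2 / (2 l): with a the integral of h,
    the choice l = a / T is optimal up to constants and gives the claim. *)
Lemma sqr_Rintegral_le (R : realType) (T : R) (h : R -> R) : 0 < T ->
  measurable_fun (`[0, T]%classic : set (measurableTypeR R)) h ->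
  (forall s, s \in `[0, T] -> 0 <= h s) ->
  (lebesgue_measure : set (measurableTypeR R) -> \bar R).-integrable `[0, T]%classic
    (EFin \o (fun s => h s ^+ 2)) ->
  (lebesgue_measure : set (measurableTypeR R) -> \bar R).-integrable `[0, T]%classic (EFin \o h) /\
  (\int[lebesgue_measure]_(s in `[0, T]) h s) ^+ 2 <=
    T * \int[lebesgue_measure]_(s in `[0, T]) h s ^+ 2.
Proof.
move=> T0 mh h0 ih2.
pose D : set (measurableTypeR R) := `[0, T]%classic.
have mD : measurable D by exact: measurable_itv.
have muD : lebesgue_measure D = T%:E by rewrite lebesgue_measure_itv/= lte_fin T0 oppr0 adde0.
have icst c : (lebesgue_measure : set (measurableTypeR R) -> \bar R).-integrable D (EFin \o (fun=> c)).
  apply: (@measurable_bounded_integrable _ _ _ lebesgue_measure) => //.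
    exact: (@eq_ind _ T%:E (fun z => (z < +oo)%E) (ltry T) _ (esym muD)).
  exists `|c|; split; first by rewrite num_real.
  by move=> x cx s Ds; exact: ltW.
have icomb (l a : R) : (lebesgue_measure : set (measurableTypeR R) -> \bar R).-integrable D
    (EFin \o (fun s => a + l * h s ^+ 2)).
  have h1 := integrableZl mD l ih2; have := integrableD mD (icst a) h1; exact.
have ih : (lebesgue_measure : set (measurableTypeR R) -> \bar R).-integrable D (EFin \o h).
  apply: (le_integrable mD _ _ (icomb 1 1)) => [|s Ds]; first exact/measurable_EFinP.
  rewrite /= lee_fin (ger0_norm (h0 _ Ds)); apply: le_trans (ler_norm _).
  have := sqr_ge0 (h s - 1); have := sqr_ge0 (h s).
  by rewrite sqrrB expr1n mulr1 mulr2n; lra.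
split => //.
set a := (X in X ^+ 2 <= _); set b := (X in _ <= T * X).
have a0 : 0 <= a by apply: Rintegral_ge0.
have key l : 0 < l -> a <= l * T / 2 + b / (2 * l).
  move=> l0; apply: (@le_trans _ _ (\int[lebesgue_measure]_(s in D) (l / 2 + (2 * l)^-1 * h s ^+ 2))).
    apply: (le_Rintegral mD ih (icomb _ _)) => s Ds; rewrite -subr_ge0.
    have -> : l / 2 + (2 * l)^-1 * h s ^+ 2 - h s = (2 * l)^-1 * (l - h s) ^+ 2.
      by field; rewrite gt_eqF.
    by rewrite mulr_ge0 ?sqr_ge0// invr_ge0 mulr_ge0// ltW.
  rewrite RintegralD//; last exact: (integrableZl mD (2 * l)^-1 ih2).
  rewrite Rintegral_cst// RintegralZl// -/b.
  rewrite (_ : fine _ = T); last exact: (congr1 fine muD).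
by rewrite le_eqVlt; apply/orP; left; apply/eqP; field; rewrite gt_eqF.
have [->|an0] := eqVneq a 0.
  by rewrite expr0n/= mulr_ge0 ?(ltW T0)// Rintegral_ge0// => s _; exact: sqr_ge0.
have ap : 0 < a by rewrite lt_neqAle eq_sym an0.
have := key (a / T) (divr_gt0 ap T0).
have -> : a / T * T / 2 + b / (2 * (a / T)) = a / 2 + (T * b) / (2 * a).
  by field; rewrite !gt_eqF.
have a20 : 0 < 2 * a by rewrite mulr_gt0.
move=> h1; have : a / 2 <= T * b / (2 * a) by lra.
by rewrite ler_pdivlMr// (_ : a / 2 * (2 * a) = a ^+ 2)//; field.
Qed.

Lemma runmax_attained (R : realType) (L : nat -> R) n :
  exists2 i, (i <= n)%N & runmax L n = `|L i|.
Proof.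
elim: n => [|n [i ni e]]; first by exists 0%N.
rewrite /=; case: (leP (runmax L n) `|L n.+1|) => _; first by exists n.+1.
by exists i => //; exact: leqW.
Qed.

(** * Running maxima and the exponential time weight on a grid *)

Section weighted_sums.
Context {R : realType} (T : R) (n : nat).
Hypothesis T_gt0 : 0 < T.
Variables (chi y m : nat -> R).
Hypothesis chi_nd : forall i, chi i.+1 <= chi i.
Hypothesis chi01 : forall i, 0 <= chi i <= 1.

Let chi_le i j : (i <= j)%N -> chi j <= chi i.
Proof.
move=> ij; rewrite -(subnK ij); elim: (j - i)%N => [|k IH]; first by rewrite add0n.
by rewrite addSn; exact: le_trans (chi_nd _) IH.
Qed.

Variables (e : nat -> R) (E rhs ys : R).
Hypothesis e1 : forall i, 1 <= e i <= E.
Hypothesis e_nd : forall i, e i <= e i.+1.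
Hypothesis y_bound : forall i, `|y i| <= ys.
Hypothesis bound : forall j, (j <= n.+1)%N ->
  chi j * e j * y j ^+ 2
  + \sum_(j <= i < n.+1) chi i.+1 * (e i.+1 - e i) * y i.+1 ^+ 2
  + \sum_(j <= i < n.+1) chi i * e i * (m i.+1 - m i) ^+ 2
  + 2 * \sum_(j <= i < n.+1) chi i * e i * y i * (m i.+1 - m i) <= rhs.

(** Dividing by the running maximum makes the weight bounded while it stays determined by the past;
    the maximum is restored by Abel summation. Where the maximum is 0 so is y, and the convention
    0^-1 = 0 is consistent. *)
Definition normalized_weight (i : nat) : R := chi i * e i * y i / runmax y i.

Let H := normalized_weight.
Let L k := \sum_(i < k) H i * (m i.+1 - m i).

Let e0 i : 0 <= e i. Proof. by have /andP[/(le_trans ler01)] := e1 i. Qed.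
Let c0 i : 0 <= chi i. Proof. by have /andP[] := chi01 i. Qed.

Lemma normalized_weight_le i : `|H i| <= E.
Proof.
have /andP[_ c1] := chi01 i; have /andP[_ eE] := e1 i.
rewrite /H /normalized_weight normrM normrM ger0_norm ?mulr_ge0// normfV (ger0_norm (runmax_ge0 _ _)).
apply: (@le_trans _ _ (chi i * e i)).
  have [->|r0] := eqVneq (runmax y i) 0; first by rewrite invr0 mulr0 mulr_ge0.
  rewrite ler_pdivrMr; last by rewrite lt_neqAle eq_sym r0 runmax_ge0.
  by rewrite ler_wpM2l ?mulr_ge0// runmax_ge.
by apply: le_trans eE; exact: ler_piMl.
Qed.

Lemma sum_le_energy :
  \sum_(i < n.+1) chi i * e i * (m i.+1 - m i) ^+ 2
  + 2 * \sum_(i < n.+1) chi i * e i * y i * (m i.+1 - m i)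
  + chi n.+1 * \sum_(i < n.+1) (e i.+1 - e i) * y i.+1 ^+ 2 <= rhs.
Proof.
have := bound (leq0n n.+1); rewrite !big_mkord => h.
have h1 : chi n.+1 * \sum_(i < n.+1) (e i.+1 - e i) * y i.+1 ^+ 2 <=
    \sum_(i < n.+1) chi i.+1 * (e i.+1 - e i) * y i.+1 ^+ 2.
  rewrite big_distrr/=; apply: ler_sum => i _; rewrite mulrA ler_wpM2r ?sqr_ge0//.
  by rewrite ler_wpM2r ?subr_ge0// chi_le.
have h2 : 0 <= chi 0%N * e 0%N * y 0%N ^+ 2 by rewrite mulr_ge0 ?sqr_ge0// mulr_ge0.
by lra.
Qed.

(** [bound] is used from the index j where |y| is maximal. The stochastic sum from j on is a
    difference of two partial sums, each at most 2 ys [runmax L n.+1] by [abel_bound]; with its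
    factor 2 this makes 8. *)
Lemma runmax_sqr_le_energy :
  chi n.+1 * runmax y n.+1 ^+ 2 <= rhs + 8 * ys * runmax L n.+1.
Proof.
have [j jn ->] := runmax_attained y n.+1.
rewrite -normrX ger0_norm ?sqr_ge0//.
have := bound jn.
have s1 : 0 <= \sum_(j <= i < n.+1) chi i.+1 * (e i.+1 - e i) * y i.+1 ^+ 2.
  by apply: sumr_ge0 => i _; rewrite mulr_ge0 ?sqr_ge0// mulr_ge0 ?subr_ge0.
have s2 : 0 <= \sum_(j <= i < n.+1) chi i * e i * (m i.+1 - m i) ^+ 2.
  by apply: sumr_ge0 => i _; rewrite mulr_ge0 ?sqr_ge0// mulr_ge0.
have s3 : chi n.+1 * y j ^+ 2 <= chi j * e j * y j ^+ 2.
  rewrite ler_wpM2r ?sqr_ge0//; apply: le_trans (chi_le jn) _.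
  by have /andP[e1j _] := e1 j; rewrite ler_peMr.
have ab k : (k <= n.+1)%N -> `|\sum_(0 <= i < k) chi i * e i * y i * (m i.+1 - m i)| <=
    2 * ys * runmax L n.+1.
  move=> kn; rewrite big_mkord.
  have -> : \sum_(i < k) chi i * e i * y i * (m i.+1 - m i) =
      \sum_(i < k) runmax y i * (L i.+1 - L i).
    apply: eq_bigr => i _; rewrite /L big_ord_recr/= addrAC subrr add0r mulrA; congr (_ * _).
    rewrite /H /normalized_weight [RHS]mulrC.
    have [r0|r0] := eqVneq (runmax y i) 0; last by rewrite mulfVK.
    have : `|y i| <= 0 by rewrite -r0 runmax_ge.
    by rewrite normr_le0 => /eqP ->; rewrite !mulr0 ?mul0r.
  apply: (@abel_bound _ L (runmax y) n.+1 ys (runmax L n.+1)) => //.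
  - by rewrite /L big_ord0.
  - exact: (runmax_ge0 y 0).
  - by move=> i; exact: runmax_nd.
  - by move=> i _; apply: runmax_le.
  - by move=> i; exact: runmax_ge.
have s4 : \sum_(j <= i < n.+1) chi i * e i * y i * (m i.+1 - m i) =
    \sum_(0 <= i < n.+1) chi i * e i * y i * (m i.+1 - m i)
    - \sum_(0 <= i < j) chi i * e i * y i * (m i.+1 - m i).
  by rewrite (@big_cat_nat _ _ _ j 0 n.+1)//= addrAC subrr add0r.
have := ab _ jn; have := ab _ (leqnn n.+1); rewrite s4 !ler_norml.
move=> /andP[h1 h2] /andP[h3 h4] h5; lra.
Qed.

End weighted_sums.

Section time_weight.
Context {R : realType} (T : R) (n : nat).
Hypothesis T_gt0 : 0 < T.
Variables (alpha ys oy : R) (y : R -> R).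
Hypothesis alpha_ge0 : 0 <= alpha.
Hypothesis my : measurable_fun (`[0, T]%classic : set (measurableTypeR R)) y.
Hypothesis y_bound : forall s, s \in `[0, T] -> `|y s| <= ys.
Hypothesis y_mod : forall s t, s \in `[0, T] -> t \in `[0, T] ->
  `|s - t| <= T / n.+1%:R -> `|y s - y t| <= oy.

Local Notation g := (grid T n).
Let D : set (measurableTypeR R) := `[0, T]%classic.
Let mD : measurable D. Proof. exact: measurable_itv. Qed.
Let lam := expR (- (alpha * (T / n.+1%:R))).

Lemma expR_grid_lower i s : g i <= s <= g i.+1 -> lam * expR (alpha * s) <= expR (alpha * g i).
Proof.
move=> hs; rewrite /lam -expRD ler_expR.
have [+ _] := grid_dist T_gt0 hs; have /andP[h1 h2] := hs.
rewrite ger0_norm ?subr_ge0// => h3.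
by rewrite addrC lerBlDr -lerBlDl -mulrBr ler_wpM2l.
Qed.

Let il_bounded (h : R -> R) (C : R) : measurable_fun D h ->
  (forall s, s \in `[0, T] -> `|h s| <= C) ->
  (lebesgue_measure : set (measurableTypeR R) -> \bar R).-integrable D (EFin \o h).
Proof.
move=> mh hC; apply: (@measurable_bounded_integrable _ _ _ lebesgue_measure) => //.
  have muD : lebesgue_measure D = T%:E by rewrite lebesgue_measure_itv/= lte_fin T_gt0 oppr0 adde0.
  exact: (@eq_ind _ T%:E (fun z => (z < +oo)%E) (ltry T) _ (esym muD)).
exists C; split; first by rewrite num_real.
by move=> x Cx s Ds; apply: le_trans (ltW Cx); exact: hC.
Qed.

(** On a cell [a, b], exp(alpha b) - exp(alpha a) >= alpha (b - a) exp(alpha a), the last factor is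
    at least [lam] exp(alpha s), and y(s)^2 exceeds y(b)^2 by at most 2 ys oy. *)
Lemma time_weight_lower :
  lam * alpha * \int[lebesgue_measure]_(s in `[0, T]) (expR (alpha * s) * y s ^+ 2)
  <= \sum_(i < n.+1) (expR (alpha * g i.+1) - expR (alpha * g i)) * y (g i.+1) ^+ 2
     + alpha * T * (2 * expR (alpha * T) * ys * oy).
Proof.
have z0 : 0 \in `[0, T] by rewrite in_itv/= lexx ltW.
have ys0 : 0 <= ys by apply: le_trans (y_bound z0).
have oy0 : 0 <= oy by apply: le_trans (y_mod z0 z0 _); rewrite ?subrr ?normr0 ?divr_ge0 ?(ltW T_gt0).
pose w s := expR (alpha * s) * y s ^+ 2.
have iw : (lebesgue_measure : set (measurableTypeR R) -> \bar R).-integrable D (EFin \o w).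
  apply: (@il_bounded _ (expR (alpha * T) * ys ^+ 2)).
    by apply: measurable_funM; [exact: measurable_expR_scale|exact: measurable_funX].
  move=> s sT; rewrite normrM (ger0_norm (expR_ge0 _)) normrX ler_pM ?expR_ge0 ?sqr_ge0//.
    by rewrite ler_expR ler_wpM2l//; move: sT; rewrite in_itv/= => /andP[].
  by rewrite lerXn2r ?nnegrE// y_bound.
pose c := 2 * expR (alpha * T) * ys * oy.
have c0 : 0 <= c by rewrite !mulr_ge0 ?expR_ge0.
have -> : \int[lebesgue_measure]_(s in `[0, T]) w s =
    \sum_(0 <= i < n.+1) \int[lebesgue_measure]_(s in `[g i, g i.+1[) w s.
  have w0 s : s \in `[0, T] -> 0 <= w s by move=> _; rewrite mulr_ge0 ?expR_ge0 ?sqr_ge0.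
  rewrite (@sum_cell_eq _ T n T_gt0 lebesgue_measure w n.+1 iw w0) grid_last; apply/esym; apply: Rintegral_itv_bndo_bndc.
  have mco : measurable (`[0, T[%classic : set (measurableTypeR R)) by exact: measurable_itv.
  have sco : `[0, T[%classic `<=` D by move=> s; rewrite /D/= !in_itv/= => /andP[-> /ltW].
  exact: (integrableS mD mco sco iw).
have gsum : \sum_(i < n.+1) (g i.+1 - g i) = T.
  rewrite -(big_mkord xpredT (fun i => g i.+1 - g i)) telescope_sumr//.
  by rewrite grid_last grid0 subr0.
have -> : alpha * T * c = \sum_(i < n.+1) alpha * (g i.+1 - g i) * c.
  by rewrite -mulr_suml -mulr_sumr gsum.
rewrite big_mkord big_distrr/= -big_split/=; apply: ler_sum => i _.
set b := y (g i.+1) ^+ 2.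
have b0 : 0 <= b by exact: sqr_ge0.
have d0 : 0 <= g i.+1 - g i by rewrite subr_ge0 grid_le.
have key : lam * \int[lebesgue_measure]_(s in `[g i, g i.+1[) w s <=
    (expR (alpha * g i) * b + c) * (g i.+1 - g i).
  rewrite -RintegralZl//; last by apply: integrable_cell.
  have ic : (lebesgue_measure : set (measurableTypeR R) -> \bar R).-integrable D
      (EFin \o (fun=> expR (alpha * g i) * b + c)).
    by apply: (@il_bounded _ `|expR (alpha * g i) * b + c|).
  have mu : lebesgue_measure (`[g i, g i.+1[%classic : set R) = (g i.+1 - g i)%:E.
    rewrite lebesgue_measure_itv/= lte_fin; case: ltP => // h.
    by rewrite (_ : g i.+1 = g i) ?subrr//; apply/eqP; rewrite eq_le h grid_le.
  have -> : (expR (alpha * g i) * b + c) * (g i.+1 - g i) =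
      \int[lebesgue_measure]_(s in `[g i, g i.+1[) (expR (alpha * g i) * b + c).
    by rewrite Rintegral_cst//; congr (_ * _); exact/esym/(congr1 fine mu).
  apply: le_Rintegral => //.
  - by apply: integrable_cell => //; have := integrableZl mD lam iw; exact.
  - exact: integrable_cell.
  move=> s /=; rewrite in_itv/= => /andP[h1 /ltW h2].
  have hs : g i <= s <= g i.+1 by rewrite h1 h2.
  have sT : s \in `[0, T].
    have /andP[a0 _] := grid_itv n T_gt0 i; have /andP[_ bT] := grid_itv n T_gt0 i.+1.
    by rewrite in_itv/= (le_trans a0 h1) (le_trans h2 bT).
  have gT := grid_in n T_gt0 i.+1.
  have [_ d2] := grid_dist T_gt0 hs.
  have h3 := y_mod gT sT d2; have h4 := y_bound sT; have h5 := y_bound gT.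
  have h6 : y s ^+ 2 <= b + 2 * ys * oy.
    rewrite -lerBlDl /b subr_sqr; apply: le_trans (ler_norm _) _; rewrite normrM mulrC.
    apply: ler_pM => //; last by rewrite distrC.
    by apply: le_trans (ler_normD _ _) _; lra.
  rewrite /w mulrA; apply: (@le_trans _ _ (expR (alpha * g i) * y s ^+ 2)).
    by rewrite ler_wpM2r ?sqr_ge0//; exact: expR_grid_lower.
  apply: (le_trans (ler_wpM2l (expR_ge0 _) h6)); rewrite mulrDr lerD2l /c -!mulrA mulrCA.
  rewrite ler_pM2l// ler_wpM2r ?mulr_ge0//.
  rewrite ler_expR ler_wpM2l//; by have /andP[] := grid_itv n T_gt0 i.
have eg : expR (alpha * g i) * (alpha * (g i.+1 - g i)) <= expR (alpha * g i.+1) - expR (alpha * g i).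
  have := expR_ge1Dx (alpha * (g i.+1 - g i)).
  rewrite -(ler_pM2l (expR_gt0 (alpha * g i))) -expRD -mulrDr [g i + _]addrC subrK; lra.
have k1 := ler_wpM2l alpha_ge0 key.
have k2 := ler_wpM2r b0 eg.
rewrite (mulrC lam alpha) -(mulrA alpha lam); apply: (le_trans k1).
apply: le_trans (_ : _ <= expR (alpha * g i) * (alpha * (g i.+1 - g i)) * b + alpha * (g i.+1 - g i) * c) _.
  by rewrite le_eqVlt; apply/orP; left; apply/eqP; ring.
by rewrite lerD2r.
Qed.

End time_weight.

Lemma integral_grid_cells (R : realType) (T : R) n (h : R -> \bar R) : 0 < T ->
  measurable_fun (`[0, T]%classic : set (measurableTypeR R)) h ->
  (forall s, s \in `[0, T] -> (0 <= h s)%E) ->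
  (\sum_(i < n.+1) \int[lebesgue_measure]_(s in `]grid T n i, grid T n i.+1]) h s =
   \int[lebesgue_measure]_(s in `[0%R, T]) h s)%E.
Proof.
move=> T_gt0 mh h0; pose g := grid T n.
have sub k : `]0, g k]%classic `<=` (`[0, T]%classic : set R).
  have /andP[_ kT] := grid_itv n T_gt0 k.
  by move=> s /=; rewrite !in_itv/= => /andP[/ltW -> h2]; rewrite (le_trans h2).
have cs i : `]g i, g i.+1]%classic `<=` (`[0, T]%classic : set R).
  have /andP[i0 _] := grid_itv n T_gt0 i.
  move=> s /=; rewrite !in_itv/= => /andP[h1 h2]; rewrite (le_trans i0 (ltW h1)).
  by have /andP[_ kT] := grid_itv n T_gt0 i.+1; rewrite (le_trans h2).
have E k : (\sum_(i < k) \int[lebesgue_measure]_(s in `]g i, g i.+1]) h s =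
    \int[lebesgue_measure]_(s in `]0%R, g k]) h s)%E.
  elim: k => [|k IH]; first by rewrite big_ord0 /g grid0 set_itvoc0 integral_set0.
  rewrite big_ord_recr/= IH.
  have /andP[k0 _] := grid_itv n T_gt0 k.
  have -> : `]0, g k.+1]%classic = `]0, g k]%classic `|` `]g k, g k.+1]%classic :> set R.
    by rewrite -itv_bndbnd_setU// ?bnd_simp//; exact: grid_le.
  rewrite [RHS]ge0_integral_setU//=.
  - by apply: measurable_funS mh => // s [/sub//|/cs].
  - by move=> s [/sub|/cs]; exact: h0.
  - rewrite disj_set2E; apply/eqP/seteqP; split => s //= -[].
    by rewrite !in_itv/= => /andP[_ h1] /andP[h2 _]; move: (lt_le_trans h2 h1); rewrite ltxx.
rewrite E /g grid_last; apply: integral_itv_obnd_cbnd.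
by apply: measurable_funS mh => // s /=; rewrite !in_itv/= => /andP[/ltW -> ->].
Qed.

Section double_integrals.
Context {R : realType} {dsp : measure_display} {Omega : measurableType dsp}.
Context (P : probability Omega R) (T : R).

Definition dint (X : R -> Omega -> R) : \bar R :=
  (\int[P]_w \int[lebesgue_measure]_(s in `[0%R, T]) (X s w)%:E)%E.

Definition nneg_on (X : R -> Omega -> R) : Prop := forall s w, s \in `[0, T] -> 0 <= X s w.

Definition dint_fin (X : R -> Omega -> R) : Prop := (dint X < +oo)%E.

Lemma jmeas_sqr (X : R -> Omega -> R) : jmeas T X -> jmeas T (fun s w => X s w ^+ 2).
Proof. by move=> mX; exact: measurable_funX. Qed.

Lemma dint_ge0 X : nneg_on X -> (0 <= dint X)%E.
Proof.
by move=> X0; do 2?(apply: integral_ge0 => ? ?); rewrite lee_fin X0.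
Qed.

Lemma dint_le_comb (a b c : R -> Omega -> R) (k1 k2 : R) : 0 <= k1 -> 0 <= k2 ->
  jmeas T b -> jmeas T c -> nneg_on a -> nneg_on b -> nneg_on c ->
  (forall s w, s \in `[0, T] -> a s w <= k1 * b s w + k2 * c s w) ->
  (dint a <= k1%:E * dint b + k2%:E * dint c)%E.
Proof.
move=> k10 k20 mb mc a0 b0 c0 abc.
have int0 (X : R -> Omega -> R) w : nneg_on X -> (0 <= \int[lebesgue_measure]_(s in `[0%R, T]) (X s w)%:E)%E.
  by move=> X0; apply: integral_ge0 => s sT; rewrite lee_fin X0.
apply: ge0_integral_le_comb => //.
- by move=> w _; exact: int0.
- by move=> w _; exact: int0.
- by move=> w _; exact: int0.
- exact: (jmeas_integral mb).
- exact: (jmeas_integral mc).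
move=> w _; apply: ge0_integral_le_comb => //.
- by move=> s sT; rewrite lee_fin a0.
- by move=> s sT; rewrite lee_fin b0.
- by move=> s sT; rewrite lee_fin c0.
- by apply/measurable_EFinP; exact: jmeas_section.
- by apply/measurable_EFinP; exact: jmeas_section.
- by move=> s sT; rewrite -!EFinM -EFinD lee_fin abc.
Qed.

Lemma dint_comb_fin (a b c : R -> Omega -> R) (k1 k2 : R) : 0 <= k1 -> 0 <= k2 ->
  jmeas T b -> jmeas T c -> nneg_on a -> nneg_on b -> nneg_on c ->
  (forall s w, s \in `[0, T] -> a s w <= k1 * b s w + k2 * c s w) ->
  dint_fin b -> dint_fin c -> dint_fin a.
Proof.
move=> k10 k20 mb mc a0 b0 c0 abc.
rewrite /dint_fin; move=> fb fc; apply: le_lt_trans (dint_le_comb k10 k20 mb mc a0 b0 c0 abc) _.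
by apply: lte_add_pinfty; rewrite lte_mul_pinfty// ?lee_fin.
Qed.

Lemma dint_rv_fin (h : Omega -> R) : 0 < T -> Ig P h -> (forall w, 0 <= h w) ->
  dint_fin (fun _ w => h w).
Proof.
move=> T0 ih h0.
have muD : lebesgue_measure (`[0, T]%classic : set R) = T%:E.
  by rewrite lebesgue_measure_itv/= lte_fin T0 oppr0 adde0.
rewrite /dint_fin /dint (_ : (fun w => _) = fun w => (T%:E * (h w)%:E)%E); last first.
  apply/funext => w; rewrite integral_cst// muleC; congr (_ * _)%E; exact: muD.
have mh : measurable_fun setT h by exact: Ig_meas ih.
rewrite ge0_integralZl//; last 3 first.
- exact/measurable_EFinP.
- by move=> w _; rewrite lee_fin.
- by rewrite lee_fin ltW.
by rewrite -(Ex_EFin ih) -EFinM ltry.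
Qed.

End double_integrals.

(** Collects every term with the oscillation o into o times an affine function of o; the terms free
    of o are those of [energy_rhs], and b is the cost of the cutoff. *)
Lemma energy_remainder (R : realFieldType) (E x b Ys o I J A c Lg q k a z : R) :
  0 <= o -> 0 <= Ys -> z <= o * (2 * Ys + 2 * a * E * Ys + o) ->
  E * x + b + E * (2 * Ys * o + o ^+ 2)
  + (J + E * o * I + E * ((c + 1) * A + (o ^+ 2 + Lg * o * Ys) * q) + E * (2 * Ys + o) * k) + z
  <= (E * x + J + E * ((c + 1) * A) + 2 * E * k * Ys) + b
     + o * ((2 * E * Ys + E * I + E * Lg * q * Ys + E * k + 2 * Ys + 2 * a * E * Ys)
            + (E + E * q + 1) * o).
Proof.
move=> o0 Y0; rewrite -subr_ge0 => z0; rewrite -subr_ge0.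
by move: z0; congr (0 <= _); ring.
Qed.

Lemma time_error_le (R : realFieldType) (E a Ys oy o : R) :
  0 <= E -> 0 <= a -> 0 <= Ys -> 0 <= oy -> oy <= o ->
  a * (2 * E * Ys * oy) <= o * (2 * Ys + 2 * a * E * Ys + o).
Proof.
move=> E0 a0 Y0 oy0 oyo; have o0 := le_trans oy0 oyo.
have -> : a * (2 * E * Ys * oy) = (2 * a * E * Ys) * oy by ring.
apply: (@le_trans _ _ ((2 * a * E * Ys) * o)); first by rewrite ler_wpM2l// !mulr_ge0.
rewrite [leLHS]mulrC ler_wpM2l// -addrA addrCA lerDl addr_ge0// mulr_ge0//.
Qed.

Lemma quadratic_close (R : realFieldType) (S m st lam al X sm z rhs tot : R) :
  0 <= st -> st <= 1 -> 0 <= z -> S + 2 * m + st * sm <= rhs ->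
  lam * al * X <= sm + z -> rhs + z <= tot ->
  S + 2 * m + lam * (st * (al * X)) <= tot.
Proof.
move=> s0 s1 z0 h1 h2 h3; have h4 := ler_wpM2l s0 h2.
have h5 : st * z <= z by exact: ler_piMl.
have h6 : st * (lam * al * X) = lam * (st * (al * X)) by ring.
have h7 : st * (sm + z) = st * sm + st * z by ring.
lra.
Qed.

Lemma sup_close (R : realFieldType) (st Ys rm oy o a rhs tot : R) :
  0 <= st -> st <= 1 -> 0 <= rm -> rm <= Ys -> 0 <= oy -> oy <= o -> Ys <= rm + oy ->
  st * rm ^+ 2 <= rhs + a -> rhs + (2 * Ys * o + o ^+ 2) <= tot ->
  st * Ys ^+ 2 <= tot + a.
Proof.
move=> s0 s1 r0 rY o0 oo Yr h1 h2.
have Y0 := le_trans r0 rY.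
have h3 : Ys ^+ 2 <= rm ^+ 2 + (2 * Ys * o + o ^+ 2).
  apply: (@le_trans _ _ ((rm + oy) ^+ 2)); first by rewrite lerXn2r ?nnegrE ?addr_ge0.
  rewrite sqrrD -addrA lerD2l; apply: lerD; last by rewrite lerXn2r ?nnegrE ?(le_trans o0).
  by rewrite -mulr_natl -mulrA ler_pM2l//; apply: ler_pM.
have h4 := ler_wpM2l s0 h3; rewrite mulrDr in h4.
have h5 : st * (2 * Ys * o + o ^+ 2) <= 2 * Ys * o + o ^+ 2.
  apply: ler_piMl => //; rewrite addr_ge0 ?sqr_ge0// !mulr_ge0//; exact: le_trans oo.
lra.
Qed.

Lemma cvg_expR_harmonic (R : realType) (a T : R) :
  expR (- (a * (T / N.+1%:R))) @[N --> \oo] --> (1 : R).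
Proof.
have h : (- (a * (T / N.+1%:R))) @[N --> \oo] --> (0 : R).
  rewrite -[X in _ --> X]oppr0; apply: cvgN.
  rewrite -[X in _ --> X](mulr0 a); apply: cvgM; first exact: cvg_cst.
  rewrite -[X in _ --> X](mulr0 T); apply: cvgM; [exact: cvg_cst|exact: cvg_harmonic].
have := @cvg_comp _ _ _ _ (@expR R) _ _ _ h (@continuous_expR R 0).
by rewrite expR0.
Qed.

Lemma ler_cvg (R : realType) (u v : nat -> R) (a b : R) :
  u n @[n --> \oo] --> a -> v n @[n --> \oo] --> b -> (forall n, u n <= v n) -> a <= b.
Proof.
move=> ua vb uv; rewrite -(cvg_lim _ ua)// -(cvg_lim _ vb)//; apply: ler_lim.
- by apply/cvg_ex; exists a.
- by apply/cvg_ex; exists b.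
- exact: nearW.
Qed.

Lemma measurable_fun_le_indic d (S : measurableType d) (R : realType) (X : S -> R) (q : R) :
  measurable_fun setT X -> measurable_fun setT (fun w => (X w <= q)%R%:R : R).
Proof.
move=> mX; rewrite (_ : (fun w => _) = fun w => if X w <= q then 1 else 0 : R).
  by apply: measurable_fun_ifT => //; exact: measurable_fun_ler.
by apply/funext => w; case: (_ <= _).
Qed.

Lemma measurable_fun_invr d (S : measurableType d) (R : realType) (X : S -> R) :
  measurable_fun setT X -> (forall w, 0 <= X w) -> measurable_fun setT (fun w => (X w)^-1).
Proof.
move=> mX X0; rewrite (_ : (fun w => _) = fun w => X w `^ (-1)).
  exact: (measurableT_comp (measurable_powR (-1)) mX).
by apply/funext => w; rewrite powR_inv1.
Qed.

(** * Energy and maximal estimates *)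

Section estimates.
Context {R : realType} {dsp : measure_display} {Omega : measurableType dsp}.
Context (P : probability Omega R) {d : nat} (T : R).
Variable B : R -> {RV P >-> d.-tuple R}.
Hypothesis P_complete : measure_is_complete P.
Hypothesis hB : brownian T B.
Hypothesis T_gt0 : 0 < T.
Variables (kappa : Omega -> incr_path T) (K : incr_path T).
Hypothesis kappa_adapted : adapted T B (fun t w => kappa w t).
Variables (Y : R -> {RV P >-> R}) (Z : R -> {RV P >-> d.-tuple R}) (M : R -> {RV P >-> R}).
Hypothesis hY : space_S2 T B Y.
Hypothesis mZ : forall k, jmeas T (fun r w => tnth (Z r w) k).
Hypothesis hZ : (norm2_H2 P T (fun t => Z t : Omega -> d.-tuple R) < +oo)%E.
Hypothesis hM : ito_integral T B Z M.
(* The drift [F s w] involves the law of (Y_s, Z_s) and psi is only adapted: neither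
   is known to be measurable in (s, w).  Their roles are played by a measurable
   majorant [Fb] of |F| and by a measurable minorant [pp] of psi. *)
Variables (F Fb G pp : R -> Omega -> R) (xi : Omega -> R) (alpha c Lg : R).
Hypothesis alpha_ge0 : 0 <= alpha.
Hypothesis c_ge0 : 0 <= c.
Hypothesis Lg_ge0 : 0 <= Lg.
Hypothesis mFb : jmeas T Fb.
Hypothesis Fb_ge0 : nneg_on T Fb.
Hypothesis Fb2_fin : dint_fin P T (fun s w => Fb s w ^+ 2).
Hypothesis F_le : forall s w, s \in `[0, T] -> `|F s w| <= Fb s w.
Hypothesis mG : jmeas T G.
Hypothesis mpp : jmeas T pp.
Hypothesis pp_ge0 : nneg_on T pp.
Hypothesis pp2_fin : (\int[P]_w \int[stieltjes (kappa w)]_(s in `[0%R, T]) (pp s w ^+ 2)%:E < +oo)%E.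
Hypothesis G_growth : forall s w, s \in `[0, T] -> `|G s w| <= pp s w + Lg * `|Y s w|.
Hypothesis G_mono : forall s w, s \in `[0, T] -> 2 * Y s w * G s w <= c * pp s w ^+ 2.
Hypothesis sxi : SQ P xi.
Hypothesis eqn : {ae P, forall w, forall t, t \in `[0, T] ->
  Y t w = xi w + \int[lebesgue_measure]_(s in `[t, T]) F s w
    + \int[stieltjes (kappa w)]_(s in `[t, T]) G s w - (M T w - M t w) + (K T - K t)}.

Local Notation g := (grid T).
Let T_ge0 : 0 <= T. Proof. exact: ltW. Qed.
Let E := expR (alpha * T).
Let Ys w := supnorm T (fun t => Y t w).
Let Ms w := supnorm T (fun t => M t w - M 0 w).

Local Lemma cY w : cont_on T (fun t => Y t w).
Proof. by have [cY _ _] := hY; exact: cY. Qed.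

Let mY t : t \in `[0, T] -> measurable_fun setT (Y t). Proof. by []. Qed.

Let jY : jmeas T (fun t w => Y t w).
Proof. exact: (jmeas_continuous T_gt0 mY cY). Qed.

Let Ys_ge0 w : 0 <= Ys w. Proof. exact: (supnorm_ge0 T_ge0 (@cY w)). Qed.

Let Ys_ge w t : t \in `[0, T] -> `|Y t w| <= Ys w.
Proof. exact: (supnorm_ge T_ge0 (@cY w)). Qed.

Lemma SQ_solution_sup : SQ P (fun w => supnorm T (fun t => Y t w)).
Proof.
apply: SQ_EFin; first exact: (measurable_supnorm T_ge0 mY cY).
have [_ _] := hY; rewrite (eq_integral (fun w => (supnorm T (fun t => Y t w) ^+ 2)%:E))// => w _.
by rewrite (ereal_sup_sqr T_ge0 cY).
Qed.

Let sYs : SQ P Ys. Proof. exact: SQ_solution_sup. Qed.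

Let cM w : cont_on T (fun t => M t w - M 0 w). Proof. exact: (cont_on_ito hM (w := w)). Qed.
Let sMs : SQ P Ms. Proof. exact: (SQ_ito_supnorm P_complete hB T_gt0 hM). Qed.
Lemma dint_solution_sqr_fin : dint_fin P T (fun s w => Y s w ^+ 2).
Proof.
have h := dint_rv_fin T_gt0 (SQ_sqr sYs) (fun w => sqr_ge0 _).
apply: (@dint_comb_fin _ _ _ P T _ (fun _ w => Ys w ^+ 2) (fun _ w => Ys w ^+ 2) 1 0) => //.
- by apply: jmeas_rv; apply: measurable_funX; case: sYs.
- by apply: jmeas_rv; apply: measurable_funX; case: sYs.
- by move=> s w _; exact: sqr_ge0.
- by move=> s w _; exact: sqr_ge0.
- by move=> s w _; exact: sqr_ge0.
- move=> s w sT; rewrite mul1r mul0r addr0 -[leLHS]ger0_norm ?sqr_ge0// normrX.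
  by rewrite lerXn2r ?nnegrE// Ys_ge.
Qed.

Let Y2_fin : dint_fin P T (fun s w => Y s w ^+ 2). Proof. exact: dint_solution_sqr_fin. Qed.

Let jw : jmeas T (fun s (_ : Omega) => expR (alpha * s)).
Proof. by apply: jmeas_time; exact: measurable_expR_scale. Qed.

Let w_le s : s \in `[0, T] -> 0 <= expR (alpha * s) <= E.
Proof. by rewrite in_itv/= => /andP[_ sT]; rewrite expR_ge0 ler_expR ler_wpM2l. Qed.

Definition weighted_Y2 w := \int[lebesgue_measure]_(s in `[0, T]) (expR (alpha * s) * Y s w ^+ 2).
Definition weighted_Z2 w := \int[lebesgue_measure]_(s in `[0, T]) (expR (alpha * s) * vnorm (Z s w) ^+ 2).
Definition drift_energy w :=
  \int[lebesgue_measure]_(s in `[0, T]) (2 * expR (alpha * s) * `|Y s w| * Fb s w).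
Definition drift_total w := \int[lebesgue_measure]_(s in `[0, T]) Fb s w.
Definition boundary_energy w := \int[stieltjes (kappa w)]_(s in `[0, T]) (pp s w ^+ 2).

Let wnn (X : R -> Omega -> R) : jmeas T X -> nneg_on T X -> dint_fin P T X ->
  dint_fin P T (fun s w => expR (alpha * s) * X s w).
Proof.
move=> mX X0 fX.
apply: (@dint_comb_fin _ _ _ P T _ X X E 0) => //; rewrite ?expR_ge0//.
- by move=> s w sT; rewrite mulr_ge0 ?expR_ge0 ?X0.
- by move=> s w sT; rewrite mul0r addr0 ler_wpM2r ?X0//; have /andP[] := w_le sT.
Qed.

Let jY2 : jmeas T (fun s w => Y s w ^+ 2).
Proof. exact: jmeas_sqr. Qed.

Let jZ2 : jmeas T (fun s w => vnorm (Z s w) ^+ 2).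
Proof. by apply: jmeas_sqr; exact: jmeas_vnorm. Qed.

Let nn_sqr (X : R -> Omega -> R) : nneg_on T (fun s w => X s w ^+ 2).
Proof. by move=> s w _; exact: sqr_ge0. Qed.

Let nn_w (X : R -> Omega -> R) : nneg_on T X -> nneg_on T (fun s w => expR (alpha * s) * X s w).
Proof. by move=> X0 s w sT; rewrite mulr_ge0 ?expR_ge0 ?X0. Qed.

Let tY : [/\ Ig P weighted_Y2, ((Ex P weighted_Y2)%:E =
    dint P T (fun s w => expR (alpha * s) * Y s w ^+ 2)%R)%E & True].
Proof.
have [h1 h2 _] := time_integral (jmeasM jw jY2) (nn_w (nn_sqr (fun s w => Y s w)))
  (wnn jY2 (nn_sqr (fun s w => Y s w)) Y2_fin).
by split.
Qed.

Lemma Ig_weighted_Y2 : Ig P weighted_Y2. Proof. by case: tY. Qed.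

Lemma Ex_weighted_Y2 : ((Ex P weighted_Y2)%:E =
  dint P T (fun s w => expR (alpha * s) * Y s w ^+ 2)%R)%E.
Proof. by case: tY. Qed.

Let tZ : [/\ Ig P weighted_Z2, ((Ex P weighted_Z2)%:E =
    dint P T (fun s w => expR (alpha * s) * vnorm (Z s w) ^+ 2)%R)%E & True].
Proof.
have [h1 h2 _] := time_integral (jmeasM jw jZ2) (nn_w (nn_sqr (fun s w => vnorm (Z s w))))
  (wnn jZ2 (nn_sqr (fun s w => vnorm (Z s w))) hZ).
by split.
Qed.

Lemma Ig_weighted_Z2 : Ig P weighted_Z2. Proof. by case: tZ. Qed.

Lemma Ex_weighted_Z2 : ((Ex P weighted_Z2)%:E =
  dint P T (fun s w => expR (alpha * s) * vnorm (Z s w) ^+ 2)%R)%E.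
Proof. by case: tZ. Qed.

Let jFb2 : jmeas T (fun s w => Fb s w ^+ 2). Proof. exact: jmeas_sqr. Qed.

Let jJ : jmeas T (fun s w => 2 * expR (alpha * s) * `|Y s w| * Fb s w).
Proof.
apply: jmeasM => //; apply: jmeasM; last exact: jmeas_norm.
by apply: jmeasM => //; exact: jmeas_cst.
Qed.

Let nnJ : nneg_on T (fun s w => 2 * expR (alpha * s) * `|Y s w| * Fb s w).
Proof. by move=> s w sT; rewrite mulr_ge0 ?Fb_ge0// mulr_ge0// mulr_ge0 ?expR_ge0. Qed.

Let J_fin : dint_fin P T (fun s w => 2 * expR (alpha * s) * `|Y s w| * Fb s w).
Proof.
apply: (dint_comb_fin (expR_ge0 (alpha * T)) (expR_ge0 (alpha * T)) jY2 jFb2 nnJ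
  (nn_sqr (fun s w => Y s w)) (nn_sqr Fb) _ Y2_fin Fb2_fin) => s w sT.
have /andP[w0 wE] := w_le sT; rewrite -mulrDr.
have h : 2 * (`|Y s w| * Fb s w) <= Y s w ^+ 2 + Fb s w ^+ 2.
  have := sqr_ge0 (`|Y s w| - Fb s w); rewrite sqrrB real_normK ?num_real// mulr2n; lra.
have -> : 2 * expR (alpha * s) * `|Y s w| * Fb s w = expR (alpha * s) * (2 * (`|Y s w| * Fb s w)) by ring.
by apply: ler_pM => //; rewrite mulr_ge0// mulr_ge0// Fb_ge0.
Qed.

Lemma Ig_drift_energy : Ig P drift_energy.
Proof. by case: (time_integral jJ nnJ J_fin). Qed.

Lemma Ex_drift_energy : ((Ex P drift_energy)%:E =
  dint P T (fun s w => 2 * expR (alpha * s) * `|Y s w| * Fb s w)%R)%E.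
Proof. by case: (time_integral jJ nnJ J_fin). Qed.

Let Fb_fin : dint_fin P T Fb.
Proof.
have i1 : dint_fin P T (fun _ (_ : Omega) => 1%R).
  by apply: (dint_rv_fin T_gt0 (Ig_cst P 1)).
have n1 : nneg_on T (fun _ (_ : Omega) => 1 : R) by move=> s w _.
have j1 : jmeas T (fun _ (_ : Omega) => 1 : R) by exact: jmeas_cst.
have h := @dint_comb_fin _ _ _ P T Fb (fun _ _ => 1) (fun s w => Fb s w ^+ 2) 1 1 ler01 ler01
  j1 jFb2 Fb_ge0 n1 (nn_sqr Fb).
apply: (h _ i1 Fb2_fin).
move=> s w sT; rewrite !mul1r.
by have := sqr_ge0 (Fb s w - 1); have := sqr_ge0 (Fb s w); rewrite sqrrB expr1n mulr1 mulr2n; lra.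
Qed.

Let iFb_ae : {ae P, forall w, (lebesgue_measure : set (measurableTypeR R) -> \bar R).-integrable
   `[0, T]%classic (EFin \o Fb ^~ w)}.
Proof. by case: (time_integral mFb Fb_ge0 Fb_fin). Qed.

Lemma SQ_drift_total : SQ P drift_total.
Proof.
have [i1 _ _] := time_integral mFb Fb_ge0 Fb_fin.
have [i2 _ ae2] := time_integral jFb2 (nn_sqr Fb) Fb2_fin.
split; first exact: Ig_meas i1.
apply: Ig_le_ae (IgZ T i2) _; first by apply: measurable_funX; exact: Ig_meas i1.
apply: filterS ae2 => w iw; rewrite ger0_norm ?sqr_ge0//.
have [_ h] := sqr_Rintegral_le T_gt0 (jmeas_section w mFb) (fun s sT => Fb_ge0 w sT) iw.
exact: h.
Qed.

Let mkappa t : t \in `[0, T] -> measurable_fun setT (fun w => kappa w t).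
Proof. by move=> tT; apply: (at_time_funW P_complete); exact: kappa_adapted tT. Qed.

Let mbd : measurable_fun setT (fun w => \int[stieltjes (kappa w)]_(s in `[0%R, T]) (pp s w ^+ 2)%:E)%E.
Proof.
apply: (jmeas_stieltjes T_ge0 mkappa (X := fun s w => pp s w ^+ 2)); first exact: jmeas_sqr.
by move=> s w _; exact: sqr_ge0.
Qed.

Let tbd : [/\ Ig P boundary_energy,
   ((Ex P boundary_energy)%:E = \int[P]_w \int[stieltjes (kappa w)]_(s in `[0%R, T]) (pp s w ^+ 2)%:E)%E &
   {ae P, forall w, (stieltjes (kappa w)).-integrable `[0, T]%classic (EFin \o (fun s => pp s w ^+ 2))}].
Proof.
have h0 w : (0 <= \int[stieltjes (kappa w)]_(s in `[0%R, T]) (pp s w ^+ 2)%:E)%E.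
  by apply: integral_ge0 => s _; rewrite lee_fin sqr_ge0.
have [i e ae] := Ig_fine mbd h0 pp2_fin; split => //.
apply: filterS ae => w hw; apply/integrableP; split.
  by apply/measurable_EFinP; exact: (jmeas_section w (jmeas_sqr mpp)).
apply: le_lt_trans hw; rewrite le_eqVlt; apply/orP; left; apply/eqP.
by apply: eq_integral => s sT; rewrite gee0_abs// lee_fin sqr_ge0.
Qed.

Lemma Ig_boundary_energy : Ig P boundary_energy. Proof. by case: tbd. Qed.

Lemma Ex_boundary_energy : ((Ex P boundary_energy)%:E =
  \int[P]_w \int[stieltjes (kappa w)]_(s in `[0%R, T]) (pp s w ^+ 2)%:E)%E.
Proof. by case: tbd. Qed.

Definition stopped q t w : R := (kappa w t <= q)%R%:R.

Definition path_modulus N w :=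
  modulus T (fun t => M t w - M 0 w) (T / N.+1%:R) + 2 * modulus T (fun t => Y t w) (T / N.+1%:R).

Definition energy_rhs w := E * xi w ^+ 2 + drift_energy w
  + E * ((c + 1) * boundary_energy w) + 2 * E * K T * Ys w.

(** The price of switching off: it lives on the event kappa_T > q, which shrinks to the empty set as
    q grows. *)
Definition late_energy q w := (1 - stopped q T w) * (E * Ys w ^+ 2).

(** The coefficient found in [energy_remainder]. It is square integrable because the cutoff has put
    the constant q in the place of kappa_T. *)
Definition modulus_coef q w := 2 * E * Ys w + E * drift_total w + E * Lg * q * Ys w
  + E * K T + 2 * Ys w + 2 * (alpha * T) * E * Ys w.

Definition remainder N q w :=
  path_modulus N w * (modulus_coef q w + (E + E * q + 1) * path_modulus N w).

Definition stopped_weight N q i w := stopped q (g N i) w * expR (alpha * g N i).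

Definition quadratic_sum N q w :=
  \sum_(i < N.+1) stopped_weight N q i w * (M (g N i.+1) w - M (g N i) w) ^+ 2.

Definition martingale_sum N q w :=
  \sum_(i < N.+1) stopped_weight N q i w * Y (g N i) w * (M (g N i.+1) w - M (g N i) w).

Definition transform_weight N q i w :=
  normalized_weight (fun j => stopped q (g N j) w) (fun j => Y (g N j) w)
    (fun j => expR (alpha * g N j)) i.

Definition transform_max N q w := runmax (fun k =>
  \sum_(i < k) transform_weight N q i w * (M (g N i.+1) w - M (g N i) w)) N.+1.

Let mod0 N w : 0 <= modulus T (fun t => Y t w) (T / N.+1%:R).
Proof. exact: (modulus_ge0 T_ge0 _ (@cY w)). Qed.

Let modM0 N w : 0 <= modulus T (fun t => M t w - M 0 w) (T / N.+1%:R).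
Proof. exact: (modulus_ge0 T_ge0 _ (@cM w)). Qed.

Let pm0 N w : 0 <= path_modulus N w.
Proof. by rewrite addr_ge0// mulr_ge0. Qed.

Let oy_le N w : 2 * modulus T (fun t => Y t w) (T / N.+1%:R) <= path_modulus N w.
Proof. by rewrite lerDr. Qed.

Let st_nd N q w i : stopped q (g N i.+1) w <= stopped q (g N i) w.
Proof.
rewrite /stopped ler_nat; case: (leP (kappa w (g N i.+1)) q) => // h.
suff -> : kappa w (g N i) <= q by [].
by apply: le_trans h; apply: incr_nd; rewrite ?grid_le//; exact: grid_in.
Qed.

Let st01 q t w : 0 <= stopped q t w <= 1.
Proof. by rewrite /stopped ler0n lern1 leq_b1. Qed.

Let e1E N i : 1 <= expR (alpha * g N i) <= E.
Proof.
have /andP[g0 gT] := grid_itv N T_gt0 i.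
by rewrite -expR0 !ler_expR mulr_ge0//= ler_wpM2l.
Qed.

(** One null set serves for all N, q and j: off it the equation holds and the majorants are
    integrable along the path. The oscillations of M are those of M - M 0. *)
Let path_bound : {ae P, forall w, forall N q j, 0 <= q -> (j <= N.+1)%N ->
  stopped q (g N j) w * expR (alpha * g N j) * Y (g N j) w ^+ 2
  + \sum_(j <= i < N.+1) stopped q (g N i.+1) w * (expR (alpha * g N i.+1) - expR (alpha * g N i)) * Y (g N i.+1) w ^+ 2
  + \sum_(j <= i < N.+1) stopped q (g N i) w * expR (alpha * g N i) * (M (g N i.+1) w - M (g N i) w) ^+ 2
  + 2 * \sum_(j <= i < N.+1) stopped q (g N i) w * expR (alpha * g N i) * Y (g N i) w * (M (g N i.+1) w - M (g N i) w)
  <= E * xi w ^+ 2 + late_energy q w + E * (2 * Ys w * path_modulus N w + path_modulus N w ^+ 2)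
   + (drift_energy w + E * path_modulus N w * drift_total w
      + E * ((c + 1) * boundary_energy w
             + (path_modulus N w ^+ 2 + Lg * path_modulus N w * Ys w) * q)
      + E * (2 * Ys w + path_modulus N w) * K T)}.
Proof.
have [_ _ ipp] := tbd.
apply: filterS3 eqn iFb_ae ipp => w eqw iFw ipw N q j q0 jN.
have Tn0 : 0 <= T / N.+1%:R by rewrite divr_ge0.
have := @energy_bound R T N T_gt0 (kappa w) K (fun t => Y t w) (fun t => M t w) (F ^~ w) (Fb ^~ w) (G ^~ w)
  (pp ^~ w) (xi w) alpha c Lg (Ys w) (modulus T (fun t => M t w - M 0 w) (T / N.+1%:R))
  (modulus T (fun t => Y t w) (T / N.+1%:R)) q alpha_ge0 c_ge0 Lg_ge0 q0 iFw
  (fun s sT => F_le w sT) (jmeas_section w jY) (jmeas_section w mG) (jmeas_section w mpp)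
  (fun s sT => pp_ge0 w sT) ipw (fun s sT => G_growth w sT) (fun s sT => G_mono w sT)
  (fun s sT => Ys_ge w sT) _ (fun s t sT tT h => modulus_ge T_ge0 (@cY w) Tn0 sT tT h) eqw j jN.
have hm s t : s \in `[0, T] -> t \in `[0, T] -> `|s - t| <= T / N.+1%:R ->
    `|M s w - M t w| <= modulus T (fun t => M t w - M 0 w) (T / N.+1%:R).
  move=> sT tT h; have := modulus_ge T_ge0 (@cM w) Tn0 sT tT h.
  by rewrite opprB addrA subrK.
by move=> /(_ hm); rewrite /late_energy /stopped grid_last.
Qed.

Let e_nd N i : expR (alpha * g N i) <= expR (alpha * g N i.+1).
Proof. by rewrite ler_expR ler_wpM2l// grid_le. Qed.

Let oy_le1 N w : modulus T (fun t => Y t w) (T / N.+1%:R) <= path_modulus N w.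
Proof. by apply: le_trans (oy_le N w); rewrite mulr2n mulrDl mul1r lerDl. Qed.

Lemma quadratic_bound : {ae P, forall w, forall N q, 0 <= q ->
  quadratic_sum N q w + 2 * martingale_sum N q w
  + expR (- (alpha * (T / N.+1%:R))) * (stopped q T w * (alpha * weighted_Y2 w))
  <= energy_rhs w + late_energy q w + remainder N q w}.
Proof.
apply: filterS path_bound => w pb N q q0.
have h := sum_le_energy (st_nd N q w) (fun i => st01 q (g N i) w) (e1E N)
  (e_nd N) (fun j => pb N q j q0).
have Tn0 : 0 <= T / N.+1%:R by rewrite divr_ge0.
have tw := time_weight_lower T_gt0 alpha_ge0 (jmeas_section w jY) (fun s sT => Ys_ge w sT)
  (fun s t sT tT h => modulus_ge T_ge0 (@cY w) Tn0 sT tT h).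
have /andP[s0 s1] := st01 q T w.
rewrite grid_last in h.
apply: (quadratic_close s0 s1 _ h tw).
  by rewrite mulr_ge0 ?mulr_ge0 ?expR_ge0.
apply: (energy_remainder _ _ _ _ _ _ _ _ _ (pm0 N w) (Ys_ge0 w)).
by apply: time_error_le => //; rewrite ?expR_ge0 ?mulr_ge0.
Qed.

Lemma sup_bound : {ae P, forall w, forall N q, 0 <= q ->
  stopped q T w * Ys w ^+ 2
  <= energy_rhs w + late_energy q w + remainder N q w + 8 * Ys w * transform_max N q w}.
Proof.
apply: filterS path_bound => w pb N q q0.
have h := runmax_sqr_le_energy (st_nd N q w) (fun i => st01 q (g N i) w) (e1E N)
  (e_nd N) (fun i => Ys_ge w (grid_in N T_gt0 i)) (fun j => pb N q j q0).
have [hr hs] := supnorm_runmax N T_gt0 (@cY w).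
have /andP[s0 s1] := st01 q T w.
rewrite grid_last in h.
apply: (sup_close s0 s1 (runmax_ge0 _ _) hr (mod0 N w) (oy_le1 N w) hs h).
apply: (energy_remainder _ _ _ _ _ _ _ _ _ (pm0 N w) (Ys_ge0 w)).
by rewrite expr2 -mulrDl mulrC ler_wpM2l// lerD2r lerDl !mulr_ge0// expR_ge0.
Qed.

Let gin N i : g N i \in `[0, T]. Proof. exact: grid_in. Qed.
Let g_0 N i : 0 <= g N i. Proof. by have /andP[] := grid_itv N T_gt0 i. Qed.
Let g_T N i : g N i <= T. Proof. by have /andP[] := grid_itv N T_gt0 i. Qed.
Let g_le N i : g N i <= g N i.+1. Proof. exact: grid_le. Qed.

Let YA t : t \in `[0, T] -> measurable_fun setT (Y t : at_time B t -> R).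
Proof. by move=> tT; have [_ h _] := hY; exact: h tT. Qed.

Let m_stopped q t : t \in `[0, T] -> measurable_fun setT (stopped q t : at_time B t -> R).
Proof. by move=> tT; apply: measurable_fun_le_indic; exact: kappa_adapted tT. Qed.

Let m_weight N q i : measurable_fun setT (stopped_weight N q i : at_time B (g N i) -> R).
Proof. by apply: measurable_funM; [exact: m_stopped|exact: measurable_cst]. Qed.

Let m_weightW N q i : measurable_fun setT (stopped_weight N q i).
Proof.
exact: (at_time_funW P_complete (@m_weight N q i)).
Qed.

Let weight_0E N q i w : 0 <= stopped_weight N q i w <= E.
Proof.
have /andP[s0 s1] := st01 q (g N i) w; have /andP[e1 eE] := e1E N i.
rewrite mulr_ge0 ?expR_ge0//=; apply: le_trans eE; apply: ler_piMl => //; exact: expR_ge0.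
Qed.

Let weight_abs N q i w : `|stopped_weight N q i w| <= E.
Proof. by have /andP[h1 h2] := weight_0E N q i w; rewrite ger0_norm. Qed.

Let sY t : t \in `[0, T] -> SQ P (Y t).
Proof.
move=> tT; apply: (SQ_le (mY tT) _ sYs) => w.
by apply: le_trans (Ys_ge w tT) (ler_norm _).
Qed.

Let sdM N i : SQ P (fun w => M (g N i.+1) w - M (g N i) w).
Proof. exact: (SQ_ito_increment P_complete hB hM). Qed.

Let swY N q i : SQ P (fun w => stopped_weight N q i w * Y (g N i) w).
Proof.
apply: (@SQ_bmul _ _ _ P _ _ E); last exact: sY.
- exact: m_weightW.
- exact: weight_abs.
Qed.

Lemma Ex_martingale_sum N q : Ig P (martingale_sum N q) /\ Ex P (martingale_sum N q) = 0.
Proof.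
pose X i w := stopped_weight N q i w * Y (g N i) w * (M (g N i.+1) w - M (g N i) w).
have iX i : Ig P (X i) by apply: SQ_mul; [exact: swY|exact: sdM].
split; first exact: (@Ig_sum _ _ _ P N.+1 X).
rewrite (@Ex_sum _ _ _ P N.+1 X)// big1// => i _.
apply: (@Ex_ito_increment _ _ _ P d T B P_complete hB Z M hM (g N i) (g N i.+1)
  (fun w => stopped_weight N q i w * Y (g N i) w)) => //.
by apply: measurable_funM; [exact: m_weight|exact: YA].
Qed.

Let cellZ N i w : \bar R :=
  (\int[lebesgue_measure]_(s in `]g N i, g N i.+1]) (vnorm (Z s w) ^+ 2)%:E)%E.

Let cell_sub N i : `]g N i, g N i.+1]%classic `<=` (`[0, T]%classic : set R).
Proof.
move=> s /=; rewrite !in_itv/= => /andP[h1 h2].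
by rewrite (le_trans (g_0 N i) (ltW h1)) (le_trans h2).
Qed.

Let cellZ_ge0 N i w : (0 <= cellZ N i w)%E.
Proof. by apply: integral_ge0 => s _; rewrite lee_fin sqr_ge0. Qed.

Let m_cellZ N i : measurable_fun setT (cellZ N i).
Proof.
apply: (jmeas_integral jZ2 (measurable_itv _) (@cell_sub N i)) => r w _.
exact: sqr_ge0.
Qed.

Lemma Ex_weighted_quadratic N (eta : nat -> Omega -> R) (C : R) :
  (forall i, measurable_fun setT (eta i : at_time B (g N i) -> R)) ->
  (forall i w, 0 <= eta i w <= C) ->
  ((\sum_(i < N.+1) Ex P (fun w => (eta i w * (M (g N i.+1) w - M (g N i) w) ^+ 2)%R))%:E =
   \int[P]_w \sum_(i < N.+1) ((eta i w)%:E *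
     \int[lebesgue_measure]_(s in `]g N i, g N i.+1]) (vnorm (Z s w) ^+ 2)%:E))%E.
Proof.
move=> me e0C.
rewrite ge0_integral_sum//; last 2 first.
- move=> i; apply: emeasurable_funM; last exact: m_cellZ.
  by apply/measurable_EFinP; exact: (at_time_funW P_complete (me i)).
- by move=> i w _; rewrite mule_ge0// ?cellZ_ge0// lee_fin; have /andP[] := e0C i w.
rewrite -sumEFin; apply: eq_bigr => i _.
rewrite Ex_EFin.
  exact: (ito_isometry P_complete hB mZ hZ hM (g_0 N i) (g_le N i) (g_T N i.+1) (me i) (e0C i)).
apply: (@Ig_bmul _ _ _ P _ _ C); last exact: SQ_sqr (sdM N i).
- exact: (at_time_funW P_complete (me i)).
- by move=> w; have /andP[h1 h2] := e0C i w; rewrite ger0_norm.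
Qed.

Let m_stT q : measurable_fun setT (stopped q T).
Proof.
have TT : T \in `[0, T] by rewrite in_itv/= T_ge0 lexx.
exact: (at_time_funW P_complete (m_stopped q TT)).
Qed.

Let st_abs q t w : `|stopped q t w| <= 1.
Proof. by have /andP[h1 h2] := st01 q t w; rewrite ger0_norm. Qed.

(** By the isometry the left side is a weighted integral of |Z|^2 over the cells. The weight at the
    left end is at least [lam] times exp(alpha s), and being below level q at time T implies the
    same at every grid point. *)
Lemma Ex_quadratic_sum N q : Ig P (quadratic_sum N q) /\
  expR (- (alpha * (T / N.+1%:R))) * Ex P (fun w => stopped q T w * weighted_Z2 w) <=
  Ex P (quadratic_sum N q).
Proof.
pose X i w := stopped_weight N q i w * (M (g N i.+1) w - M (g N i) w) ^+ 2.
have iX i : Ig P (X i).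
  apply: (@Ig_bmul _ _ _ P _ _ E); last exact: SQ_sqr (sdM N i).
  - exact: m_weightW.
  - exact: weight_abs.
split; first exact: (@Ig_sum _ _ _ P N.+1 X).
have iZ : Ig P (fun w => stopped q T w * weighted_Z2 w).
  by apply: (@Ig_bmul _ _ _ P _ _ 1) Ig_weighted_Z2; [exact: m_stT|exact: st_abs].
rewrite -ExZ// -lee_fin Ex_EFin; last exact: IgZ.
rewrite (@Ex_sum _ _ _ P N.+1 X)// (@Ex_weighted_quadratic N (stopped_weight N q) E)//.
set lam := expR _.
have l0 : 0 <= lam by exact: expR_ge0.
have wz0 w : 0 <= weighted_Z2 w.
  by apply: Rintegral_ge0 => s _; rewrite mulr_ge0 ?expR_ge0 ?sqr_ge0.
apply: ge0_le_integral_lower => w _.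
  by rewrite lee_fin; have /andP[s0 _] := st01 q T w; rewrite !mulr_ge0.
have /andP[s0 s1] := st01 q T w.
apply: (@le_trans _ _ ((lam * stopped q T w)%:E *
   \int[lebesgue_measure]_(s in `[0%R, T]) (expR (alpha * s) * vnorm (Z s w) ^+ 2)%:E)%E).
  rewrite mulrA EFinM; apply: lee_wpmul2l; first by rewrite lee_fin mulr_ge0.
  (* [Rintegral] gives 0 to an infinite integral, so the inequality holds for every outcome, without
     discarding a null set. *)
  rewrite /weighted_Z2 /Rintegral; set I := integral _ _ _.
  have : (0 <= I)%E by apply: integral_ge0 => s _; rewrite lee_fin mulr_ge0 ?expR_ge0 ?sqr_ge0.
  by case: I => [r| |]//= _; rewrite leey.
have mw : measurable_fun (`[0, T]%classic : set (measurableTypeR R))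
    (fun s => (expR (alpha * s) * vnorm (Z s w) ^+ 2)%:E).
  by apply/measurable_EFinP; exact: (jmeas_section w (jmeasM jw jZ2)).
rewrite -(@integral_grid_cells R T N _ T_gt0 mw); last first.
  by move=> s _; rewrite lee_fin mulr_ge0 ?expR_ge0 ?sqr_ge0.
rewrite ge0_sume_distrr; last first.
  by move=> i _; apply: integral_ge0 => s _; rewrite lee_fin mulr_ge0 ?expR_ge0 ?sqr_ge0.
apply: lee_sum => i _.
have mcell : measurable (`]g N i, g N i.+1]%classic : set (measurableTypeR R)) by exact: measurable_itv.
have mwc : measurable_fun (`]g N i, g N i.+1]%classic : set (measurableTypeR R))
    (fun s => (expR (alpha * s) * vnorm (Z s w) ^+ 2)%:E).
  by apply: measurable_funS mw => //; exact: cell_sub.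
have mzc : measurable_fun (`]g N i, g N i.+1]%classic : set (measurableTypeR R))
    (fun s => (vnorm (Z s w) ^+ 2)%:E).
  apply: (@measurable_funS _ _ _ _ (`[0, T]%classic : set (measurableTypeR R))) => //.
  by apply/measurable_EFinP; exact: (jmeas_section w jZ2).
rewrite -!ge0_integralZl//; last 4 first.
- by move=> s _; rewrite lee_fin sqr_ge0.
- by rewrite lee_fin; have /andP[] := weight_0E N q i w.
- by move=> s _; rewrite lee_fin mulr_ge0 ?expR_ge0 ?sqr_ge0.
- by rewrite lee_fin mulr_ge0.
apply: ge0_le_integral_lower => s /=; rewrite in_itv/= => /andP[h1 h2].
  by rewrite -EFinM lee_fin mulr_ge0 ?(mulr_ge0 l0 s0)// mulr_ge0 ?expR_ge0 ?sqr_ge0.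
rewrite -!EFinM lee_fin mulrA ler_wpM2r ?sqr_ge0// /stopped_weight mulrAC [leRHS]mulrC.
apply: ler_pM => //; first by rewrite mulr_ge0 ?expR_ge0.
  by apply: expR_grid_lower => //; rewrite (ltW h1) h2.
rewrite /stopped ler_nat; case: (leP (kappa w T) q) => // h.
suff -> : kappa w (g N i) <= q by [].
by apply: le_trans h; apply: incr_nd => //; rewrite in_itv/= T_ge0 lexx.
Qed.

Let m_runmax N i : measurable_fun setT
  ((fun w => runmax (fun j => Y (g N j) w) i) : at_time B (g N i) -> R).
Proof.
elim: i => [|i IH]; first by apply: measurableT_comp => //; exact: YA.
apply: measurable_maxr; first exact: (at_time_le (@g_le N i) IH).
by apply: measurableT_comp => //; exact: YA.
Qed.

Let m_transform N q i : measurable_fun setT (transform_weight N q i : at_time B (g N i) -> R).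
Proof.
apply: measurable_funM.
  by apply: measurable_funM; [exact: m_weight|exact: YA].
by apply: measurable_fun_invr; [exact: m_runmax|move=> w; exact: runmax_ge0].
Qed.

Let transform_abs N q i w : `|transform_weight N q i w| <= E.
Proof. exact: (normalized_weight_le (fun j => Y (g N j) w) (fun i => st01 q (g N i) w) (@e1E N) i). Qed.

Lemma sum_Ex_increments N :
  \sum_(i < N.+1) Ex P (fun w => (M (g N i.+1) w - M (g N i) w) ^+ 2) <= Ex P weighted_Z2.
Proof.
have h01 : forall (i : nat) (w : Omega), 0 <= (1 : R) <= 1 by move=> _ _; rewrite lexx ler01.
have := @Ex_weighted_quadratic N (fun _ _ => 1) 1 (fun i => measurable_cst _) h01.
under [X in X%:E = _ -> _]eq_bigr => i _ do under [X in Ex P X]eq_fun => w do rewrite mul1r.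
rewrite -lee_fin => ->; rewrite Ex_weighted_Z2.
apply: ge0_le_integral_lower => w _.
  by apply: sume_ge0 => i _; rewrite mul1e; exact: cellZ_ge0.
have mz : measurable_fun (`[0, T]%classic : set (measurableTypeR R)) (fun s => (vnorm (Z s w) ^+ 2)%:E).
  by apply/measurable_EFinP; exact: (jmeas_section w jZ2).
under eq_bigr do rewrite mul1e.
rewrite (@integral_grid_cells R T N _ T_gt0 mz); last by move=> s _; rewrite lee_fin sqr_ge0.
apply: ge0_le_integral_lower => s sT; first by rewrite lee_fin sqr_ge0.
rewrite lee_fin ler_peMl ?sqr_ge0// -expR0 ler_expR mulr_ge0//.
by move: sT; rewrite /= in_itv/= => /andP[].
Qed.

Lemma Ex_transform_max N q : SQ P (transform_max N q) /\
  Ex P (fun w => transform_max N q w ^+ 2) <= 4 * E ^+ 2 * Ex P weighted_Z2.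
Proof.
have gT i : (i <= N.+1)%N -> 0 <= g N i <= T by move=> _; exact: grid_itv.
have gl i : (i < N.+1)%N -> g N i <= g N i.+1 by move=> _; exact: grid_le.
have mt i : (i < N.+1)%N -> measurable_fun setT (transform_weight N q i : at_time B (g N i) -> R).
  by move=> _; exact: m_transform.
have ta i w : (i < N.+1)%N -> `|transform_weight N q i w| <= E by move=> _; exact: transform_abs.
split.
  exact: (@SQ_runmax _ _ _ _ _ T B P_complete hB Z M hM (g N) N.+1 (transform_weight N q) E gT gl mt ta).
apply: le_trans (@doob_L2 _ _ _ _ _ T B P_complete hB Z M hM (g N) N.+1 (transform_weight N q) E gT gl mt ta) _.
rewrite -mulrA ler_pM2l//.
apply: le_trans (ler_wpM2l (sqr_ge0 E) (sum_Ex_increments N)); rewrite big_distrr/=.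
apply: ler_sum => i _; rewrite -ExZ; last exact: SQ_sqr (sdM N i).
apply: Ex_le.
- have := SQ_sqr (@SQ_bmul _ _ _ P (transform_weight N q i) _ E _ _ (sdM N i)); apply.
  + exact: (at_time_funW P_complete (@m_transform N q i)).
  + by move=> w; exact: transform_abs.
- by apply: IgZ; exact: SQ_sqr (sdM N i).
- move=> w; rewrite exprMn ler_wpM2r ?sqr_ge0// -[leLHS]ger0_norm ?sqr_ge0// normrX.
  by rewrite lerXn2r ?nnegrE ?expR_ge0.
Qed.

Lemma Ig_energy_rhs : Ig P energy_rhs.
Proof.
apply: IgD; last by apply: IgZ; exact: SQ_Ig sYs.
apply: IgD; last by do 2 apply: IgZ; exact: Ig_boundary_energy.
by apply: IgD; [apply: IgZ; exact: SQ_sqr|exact: Ig_drift_energy].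
Qed.

Lemma Ex_energy_rhs : Ex P energy_rhs =
  E * Ex P (fun w => xi w ^+ 2) + Ex P drift_energy + E * ((c + 1) * Ex P boundary_energy)
  + 2 * E * K T * Ex P (fun w => supnorm T (fun t => Y t w)).
Proof.
have i1 : Ig P (fun w => E * xi w ^+ 2) by apply: IgZ; exact: SQ_sqr.
have i2 : Ig P (fun w => (c + 1) * boundary_energy w) by apply: IgZ; exact: Ig_boundary_energy.
have i3 : Ig P (fun w => E * ((c + 1) * boundary_energy w)) by exact: IgZ.
have i4 : Ig P (fun w => E * xi w ^+ 2 + drift_energy w) by apply: IgD i1 _; exact: Ig_drift_energy.
rewrite /energy_rhs ExD; [|exact: IgD|by apply: IgZ; exact: SQ_Ig sYs].
rewrite ExD// ExD//; last exact: Ig_drift_energy.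
rewrite !ExZ//; [exact: SQ_Ig sYs|exact: Ig_boundary_energy|exact: SQ_sqr].
Qed.

Lemma Ig_late_energy q : Ig P (late_energy q).
Proof.
apply: (@Ig_bmul _ _ _ P _ _ 1); last by apply: IgZ; exact: SQ_sqr sYs.
- by apply: measurable_funB => //; exact: m_stT.
- by move=> w; have /andP[h1 h2] := st01 q T w; rewrite ger0_norm ?subr_ge0// gerBl.
Qed.

Lemma Ex_stopped (X : Omega -> R) : Ig P X ->
  Ex P (fun w => stopped n%:R T w * X w) @[n --> \oo] --> Ex P X.
Proof.
move=> iX; have mX := Ig_meas iX.
apply: (@Ex_dominated _ _ _ P (fun n w => stopped n%:R T w * X w) X (fun w => `|X w|)) => //.
- by move=> n; apply: measurable_funM => //; exact: m_stT.
- have := integrable_abse iX; exact.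
- move=> n w; rewrite normrM -[leRHS]mul1r ler_wpM2r//; exact: st_abs.
- move=> w; have -> : X w = 1 * X w by rewrite mul1r.
  apply: cvgM; last by rewrite mul1r; exact: cvg_cst.
  apply: (cvg_near_cst); near=> n; rewrite /stopped.
  suff -> : kappa w T <= n%:R by [].
  by near: n; exact: nbhs_infty_ger.
Unshelve. all: by end_near.
Qed.

Lemma Ex_late_energy : Ex P (late_energy n%:R) @[n --> \oo] --> (0 : R).
Proof.
have iY : Ig P (fun w => E * Ys w ^+ 2) by apply: IgZ; exact: SQ_sqr sYs.
have -> : (fun n => Ex P (late_energy n%:R)) =
    fun n => Ex P (fun w => E * Ys w ^+ 2) - Ex P (fun w => stopped n%:R T w * (E * Ys w ^+ 2)).
  apply/funext => n; rewrite -ExB//.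
    by congr (Ex P _); apply/funext => w; rewrite /late_energy mulrBl mul1r.
  by apply: (@Ig_bmul _ _ _ P _ _ 1) iY; [exact: m_stT|exact: st_abs].
rewrite -[X in _ --> X](subrr (Ex P (fun w => E * Ys w ^+ 2))).
by apply: cvgB; [exact: cvg_cst|exact: Ex_stopped].
Qed.

Let K0 : 0 <= K T.
Proof. by apply: incr_path_ge0 => //; rewrite in_itv/= T_ge0 lexx. Qed.

Let m_pm N : measurable_fun setT (path_modulus N).
Proof.
apply: measurable_funD.
  apply: (measurable_modulus T_ge0 _ cM) => t tT.
  by apply: measurable_funB.
by apply: measurable_funM => //; exact: (measurable_modulus T_ge0 mY cY).
Qed.

Let pm_le N w : path_modulus N w <= 2 * Ms w + 4 * Ys w.
Proof.
rewrite /path_modulus lerD//; first exact: (modulus_le T_ge0 _ (@cM w)).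
have := modulus_le T_ge0 (T / N.+1%:R) (@cY w); rewrite -/(Ys w); lra.
Qed.

Let s_coef q : SQ P (modulus_coef q).
Proof.
have sI := SQ_drift_total.
apply: SQD; last exact: SQZ.
apply: SQD; last exact: SQZ.
apply: SQD; last exact: SQ_cst.
apply: SQD; last exact: SQZ.
by apply: SQD; exact: SQZ.
Qed.

Let coef_ge0 q w : 0 <= q -> 0 <= modulus_coef q w.
Proof.
move=> q0; have I0 : 0 <= drift_total w by apply: Rintegral_ge0 => s sT; exact: Fb_ge0.
by rewrite !addr_ge0// !mulr_ge0// expR_ge0.
Qed.

Let s_D : SQ P (fun w => 2 * Ms w + 4 * Ys w).
Proof. by apply: SQD; exact: SQZ. Qed.

Lemma Ig_remainder N q : 0 <= q -> Ig P (remainder N q).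
Proof.
move=> q0.
have spm : SQ P (path_modulus N).
  by apply: (SQ_le (@m_pm N) _ s_D) => w; rewrite ger0_norm//; apply: le_trans (pm_le N w) (ler_norm _).
apply: (SQ_mul spm); apply: SQD; [exact: s_coef|exact: SQZ].
Qed.

(** Dominated convergence at fixed q: [path_modulus] tends to 0 along each path and never exceeds 2
    Ms + 4 Ys, which is square integrable. *)
Lemma Ex_remainder q : 0 <= q -> Ex P (remainder N q) @[N --> \oo] --> (0 : R).
Proof.
move=> q0; have a0 : 0 <= E + E * q + 1 by rewrite !addr_ge0 ?mulr_ge0 ?expR_ge0.
rewrite (_ : 0 = Ex P (fun=> 0)); last by rewrite Ex_cst.
apply: (@Ex_dominated _ _ _ P (fun N => remainder N q) (fun=> 0)
  (fun w => (2 * Ms w + 4 * Ys w) * (modulus_coef q w + (E + E * q + 1) * (2 * Ms w + 4 * Ys w)))).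
- by move=> N; exact: Ig_meas (Ig_remainder N q0).
- by [].
- by apply: SQ_mul => //; apply: SQD => //; exact: SQZ.
- move=> N w; have c0 := coef_ge0 w q0; have p0 := pm0 N w; have pl := pm_le N w.
  have r0 : 0 <= modulus_coef q w + (E + E * q + 1) * path_modulus N w.
    by rewrite addr_ge0 ?mulr_ge0.
  rewrite ger0_norm ?mulr_ge0//; apply: ler_pM => //.
  by rewrite lerD2l ler_wpM2l.
- move=> w; have p : path_modulus N w @[N --> \oo] --> (0 : R).
    rewrite -[X in _ --> X](addr0 (0 : R)) -[X in _ + X](mulr0 (2 : R)).
    apply: cvgD; first exact: (modulus_cvg0 T_ge0 (@cM w)).
    by apply: cvgM; [exact: cvg_cst|exact: (modulus_cvg0 T_ge0 (@cY w))].
  rewrite -[X in _ --> X](mul0r (modulus_coef q w + (E + E * q + 1) * 0)).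
  apply: cvgM => //; apply: cvgD; first exact: cvg_cst.
  by apply: cvgM; [exact: cvg_cst|exact: p].
Qed.

(** The expectation of [quadratic_bound], in which the martingale sum disappears. The limit in N
    removes the remainder and brings [lam] to 1, the one in q removes the cutoff. *)
Lemma energy_estimate :
  alpha * Ex P weighted_Y2 + Ex P weighted_Z2 <= Ex P energy_rhs.
Proof.
pose lam N : R := expR (- (alpha * (T / N.+1%:R))).
have clam : lam N @[N --> \oo] --> (1 : R) := cvg_expR_harmonic alpha T.
have ist (X : Omega -> R) q : Ig P X -> Ig P (fun w => stopped q T w * X w).
  by move=> iX; apply: (@Ig_bmul _ _ _ P _ _ 1) iX; [exact: m_stT|exact: st_abs].
have iaY : Ig P (fun w => alpha * weighted_Y2 w) by apply: IgZ; exact: Ig_weighted_Y2.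
have step N q : 0 <= q ->
    lam N * (Ex P (fun w => stopped q T w * (alpha * weighted_Y2 w)) +
             Ex P (fun w => stopped q T w * weighted_Z2 w)) <=
    Ex P energy_rhs + Ex P (late_energy q) + Ex P (remainder N q).
  move=> q0; have [iM eM] := Ex_martingale_sum N q; have [iQ eQ] := Ex_quadratic_sum N q.
  have eR : Ex P (fun w => energy_rhs w + late_energy q w + remainder N q w) =
      Ex P energy_rhs + Ex P (late_energy q) + Ex P (remainder N q).
    have iR : Ig P (fun w => energy_rhs w + late_energy q w).
      by apply: IgD; [exact: Ig_energy_rhs|exact: Ig_late_energy].
    rewrite ExD//; last exact: Ig_remainder.
    by rewrite ExD//; [exact: Ig_energy_rhs|exact: Ig_late_energy].
  rewrite -eR.
  have := @Ex_le_ae _ _ _ P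
    (fun w => quadratic_sum N q w + 2 * martingale_sum N q w + lam N * (stopped q T w * (alpha * weighted_Y2 w)))
    (fun w => energy_rhs w + late_energy q w + remainder N q w).
  move=> /(_ _ _ _)/wrap[|||].
  - apply: IgD; last by apply: IgZ; exact: ist.
    by apply: IgD => //; exact: IgZ.
  - apply: IgD; last exact: Ig_remainder.
    by apply: IgD; [exact: Ig_energy_rhs|exact: Ig_late_energy].
  - by apply: filterS quadratic_bound => w; apply.
  apply: le_trans; rewrite ExD; last 2 first.
  - by apply: IgD => //; exact: IgZ.
  - by apply: IgZ; exact: ist.
  rewrite ExD//; last exact: IgZ.
  rewrite !ExZ//; last exact: ist.
  by rewrite eM mulr0 addr0 mulrDr addrC lerD2r.
have stepq q : 0 <= q -> Ex P (fun w => stopped q T w * (alpha * weighted_Y2 w)) +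
             Ex P (fun w => stopped q T w * weighted_Z2 w) <=
    Ex P energy_rhs + Ex P (late_energy q).
  move=> q0; apply: ler_cvg (fun N => step N q q0).
    by rewrite -[X in _ --> X]mul1r; apply: cvgM => //; exact: cvg_cst.
  rewrite -[X in _ --> X]addr0; apply: cvgD; [exact: cvg_cst|exact: Ex_remainder].
rewrite -ExZ; last exact: Ig_weighted_Y2.
apply: ler_cvg (fun n => stepq n%:R (ler0n _ n)).
  by apply: cvgD; apply: Ex_stopped => //; exact: Ig_weighted_Z2.
by rewrite -[X in _ --> X]addr0; apply: cvgD; [exact: cvg_cst|exact: Ex_late_energy].
Qed.

(** The product in [sup_bound] is split as 8 Ys L <= Ys^2 / 4 + 64 L^2, and Doob's inequality gives
    E L^2 <= 4 E^2 times the weighted energy of Z; hence 256. *)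
Lemma sup_estimate :
  Ex P (fun w => Ys w ^+ 2) <=
  Ex P energy_rhs + 4^-1 * Ex P (fun w => Ys w ^+ 2) + 256 * E ^+ 2 * Ex P weighted_Z2.
Proof.
have iY2 := SQ_sqr sYs.
have step N q : 0 <= q -> Ex P (fun w => stopped q T w * Ys w ^+ 2) <=
    Ex P energy_rhs + Ex P (late_energy q) + Ex P (remainder N q)
    + (4^-1 * Ex P (fun w => Ys w ^+ 2) + 256 * E ^+ 2 * Ex P weighted_Z2).
  move=> q0; have [sL eL] := Ex_transform_max N q.
  have iL := SQ_sqr sL.
  apply: (@le_trans _ _ (Ex P (fun w => (energy_rhs w + late_energy q w + remainder N q w)
      + (4^-1 * Ys w ^+ 2 + 64 * transform_max N q w ^+ 2)))).
    apply: Ex_le_ae.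
    - by apply: (@Ig_bmul _ _ _ P _ _ 1) iY2; [exact: m_stT|exact: st_abs].
    - apply: IgD; last by apply: IgD; exact: IgZ.
      apply: IgD; last exact: Ig_remainder.
      by apply: IgD; [exact: Ig_energy_rhs|exact: Ig_late_energy].
    - apply: filterS sup_bound => w /(_ N q q0) h; apply: le_trans h _.
      rewrite lerD2l; have := sqr_ge0 (Ys w / 2 - 8 * transform_max N q w).
      have -> : (Ys w / 2 - 8 * transform_max N q w) ^+ 2 =
        4^-1 * Ys w ^+ 2 + 64 * transform_max N q w ^+ 2 - 8 * Ys w * transform_max N q w by field.
      by rewrite subr_ge0.
  rewrite ExD; last 2 first.
  - apply: IgD; last exact: Ig_remainder.
    by apply: IgD; [exact: Ig_energy_rhs|exact: Ig_late_energy].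
  - by apply: IgD; exact: IgZ.
  rewrite ExD; last 2 first.
  - by apply: IgD; [exact: Ig_energy_rhs|exact: Ig_late_energy].
  - exact: Ig_remainder.
  rewrite ExD; [|exact: Ig_energy_rhs|exact: Ig_late_energy].
  rewrite lerD2l ExD; [|exact: IgZ|exact: IgZ].
  rewrite !ExZ// lerD2l.
  have -> : 256 * E ^+ 2 * Ex P weighted_Z2 = 64 * (4 * E ^+ 2 * Ex P weighted_Z2) by ring.
  by rewrite ler_pM2l.
have stepq q : 0 <= q -> Ex P (fun w => stopped q T w * Ys w ^+ 2) <=
    Ex P energy_rhs + Ex P (late_energy q)
    + (4^-1 * Ex P (fun w => Ys w ^+ 2) + 256 * E ^+ 2 * Ex P weighted_Z2).
  move=> q0; apply: ler_cvg (fun N => step N q q0); first exact: cvg_cst.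
  apply: cvgD; last exact: cvg_cst.
  rewrite -[X in _ --> X]addr0; apply: cvgD; [exact: cvg_cst|exact: Ex_remainder].
rewrite -addrA; apply: ler_cvg (fun n => stepq n%:R (ler0n _ n)); first exact: Ex_stopped.
apply: cvgD; last exact: cvg_cst.
by rewrite -[X in _ --> X]addr0; apply: cvgD; [exact: cvg_cst|exact: Ex_late_energy].
Qed.

End estimates.

(** * Absorption of the drift and reflection terms *)

Definition young_constant (R : realType) (E alpha : R) : R :=
  4 / 3 * (2 + 2 * alpha + 512 * E ^+ 2).

(** Here aY stands for alpha times xY. It cancels against the bound on the drift J, and 3/4 xY + xZ
    / 2 remains on the left: this surplus is why alpha exceeds the drift coefficient 5/4 + 2 L + 8
    L^2 by 3/4. *)
Lemma absorb_energy (R : realFieldType) (e1 e2 e3 n J aY xY xZ : R) :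
  0 <= xY -> 0 <= xZ -> J <= e2 + (aY - 3 / 4 * xY) + xZ / 2 ->
  aY + xZ <= e1 + J + e3 + n ->
  xY <= 2 * (e1 + e2 + e3 + n) /\ xZ <= 2 * (e1 + e2 + e3 + n).
Proof. by split; lra. Qed.

(** Moving S / 4 to the left gives the factor 4/3. With aA and EA equal to 2 alpha and 512 E^2 times
    the sum e1 + e2 + e3 + n, the constant becomes [young_constant]. *)
Lemma absorb_sup (R : realFieldType) (e1 e2 e3 n J aY xY xZ aA EZ EA S : R) :
  0 <= xY -> J <= e2 + (aY - 3 / 4 * xY) + xZ / 2 ->
  S <= e1 + J + e3 + n + 4^-1 * S + EZ -> aY <= aA -> EZ <= EA ->
  xZ <= 2 * (e1 + e2 + e3 + n) ->
  S <= 4 / 3 * (2 * (e1 + e2 + e3 + n) + aA + EA).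
Proof. by move=> *; lra. Qed.

(** The reflection contributes n, linear in m = E sup |Y|, and m^2 <= S. Young's inequality leaves
    half of S on the right, which the left side absorbs; what remains is quadratic in K_T. *)
Lemma absorb_mean (R : realFieldType) (S xZ Q n m2 e1 e2 DQ Dn : R) :
  S <= DQ + Dn -> xZ <= 2 * (Q + n) -> m2 <= S -> Dn <= m2 / 2 + 2 * e1 ->
  2 * n <= m2 + 4 * e2 ->
  S + xZ <= 4 * DQ + 2 * Q + 8 * e1 + 4 * e2.
Proof. by move=> *; lra. Qed.

Lemma absorption (R : realType) (E al L c k S m xY xZ x phi a J : R) :
  let D := young_constant E al in
  0 <= E -> 0 <= L -> al = 2 + 2 * L + 8 * L ^+ 2 -> 0 <= c -> 0 <= xY -> 0 <= xZ ->
  0 <= x -> 0 <= phi -> 0 <= a -> m ^+ 2 <= S ->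
  J <= E * phi + (5 / 4 + 2 * L + 8 * L ^+ 2) * xY + xZ / 2 ->
  al * xY + xZ <= E * x + J + E * ((c + 1) * a) + 2 * E * k * m ->
  S <= E * x + J + E * ((c + 1) * a) + 2 * E * k * m + 4^-1 * S + 256 * E ^+ 2 * xZ ->
  S + xZ <= ((4 * D + 2) * (E * (c + 1)) + (8 * E ^+ 2 * D ^+ 2 + 4 * E ^+ 2)) *
            (x + phi + a + k ^+ 2).
Proof.
move=> D E0 L0 alE c0 xY0 xZ0 x0 p0 a0 mS hJ h1 h2.
have al0 : 0 <= al by rewrite alE !addr_ge0// mulr_ge0// sqr_ge0.
have E20 : 0 <= E ^+ 2 by exact: sqr_ge0.
have D0 : 0 <= D by move: al0 E20; rewrite /D /young_constant; clear; lra.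
have eJ : (5 / 4 + 2 * L + 8 * L ^+ 2) * xY = al * xY - 3 / 4 * xY by rewrite alE; field.
rewrite {}eJ in hJ.
have [hY hZ] := absorb_energy xY0 xZ0 hJ h1.
set A := _ + _ + _ + _ in hY hZ.
have hS := absorb_sup xY0 hJ h2 (ler_wpM2l al0 hY) (ler_wpM2l (mulr_ge0 (ler0n _ 256) E20) hZ) hZ.
pose Q := E * x + E * phi + E * ((c + 1) * a).
have {}hS : S <= D * Q + D * (2 * E * k * m).
  by apply: le_trans hS _; rewrite le_eqVlt; apply/orP; left; apply/eqP; rewrite /D /young_constant /Q /A; field.
clearbody D.
have y1 : D * (2 * E * k * m) <= m ^+ 2 / 2 + 2 * (E ^+ 2 * D ^+ 2 * k ^+ 2).
  have := sqr_ge0 (m - 2 * (D * E * k)).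
  have -> : (m - 2 * (D * E * k)) ^+ 2 = 2 * (m ^+ 2 / 2 + 2 * (E ^+ 2 * D ^+ 2 * k ^+ 2) - D * (2 * E * k * m)) by field.
  by rewrite pmulr_rge0// subr_ge0.
have y2 : 2 * (2 * E * k * m) <= m ^+ 2 + 4 * (E ^+ 2 * k ^+ 2).
  have := sqr_ge0 (m - 2 * (E * k)).
  have -> : (m - 2 * (E * k)) ^+ 2 = m ^+ 2 + 4 * (E ^+ 2 * k ^+ 2) - 2 * (2 * E * k * m) by ring.
  by rewrite subr_ge0.
apply: le_trans (absorb_mean hS hZ mS y1 y2) _.
have Q_le : Q <= E * (c + 1) * (x + phi + a).
  rewrite -subr_ge0; have -> : E * (c + 1) * (x + phi + a) - Q = E * c * x + E * c * phi by rewrite /Q; ring.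
  by rewrite addr_ge0// !mulr_ge0.
have k2 : 0 <= k ^+ 2 by exact: sqr_ge0.
have C1 : 0 <= 4 * D + 2 by rewrite addr_ge0// mulr_ge0.
have C3 : 0 <= E * (c + 1) by rewrite mulr_ge0// addr_ge0.
have C2 : 0 <= 8 * E ^+ 2 * D ^+ 2 + 4 * E ^+ 2.
  by apply: addr_ge0; rewrite mulr_ge0 ?mulr_ge0 ?sqr_ge0.
have -> : 4 * (D * Q) + 2 * Q + 8 * (E ^+ 2 * D ^+ 2 * k ^+ 2) + 4 * (E ^+ 2 * k ^+ 2) =
  (4 * D + 2) * Q + (8 * E ^+ 2 * D ^+ 2 + 4 * E ^+ 2) * k ^+ 2 by ring.
rewrite [leRHS]mulrDl; apply: lerD; last by rewrite ler_wpM2l// lerDr !addr_ge0.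
rewrite -mulrA; apply: (le_trans (ler_wpM2l C1 Q_le)).
by rewrite ler_wpM2l// ler_wpM2l// lerDl.
Qed.

(** The difference of the two sides is (f - y)^2 + (2 L y - z/2)^2 + (2 L y - r/2)^2. The
    coefficients 1/4 are small because r stands for the Wasserstein term, whose mean square feeds
    back into y and z. *)
Lemma young_drift (R : realType) (y f z r L : R) :
  2 * y * (f + L * (y + z + r)) <=
  f ^+ 2 + ((1 + 2 * L + 8 * L ^+ 2) * y ^+ 2 + (4^-1 * z ^+ 2 + 4^-1 * r ^+ 2)).
Proof.
have := sqr_ge0 (f - y); have := sqr_ge0 (2 * L * y - z / 2); have := sqr_ge0 (2 * L * y - r / 2).
rewrite -subr_ge0 => h1; rewrite -subr_ge0 => h2; rewrite -subr_ge0 => h3.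
rewrite -subr_ge0.
have -> : f ^+ 2 + ((1 + 2 * L + 8 * L ^+ 2) * y ^+ 2 + (4^-1 * z ^+ 2 + 4^-1 * r ^+ 2)) -
  2 * y * (f + L * (y + z + r)) =
  (f - y) ^+ 2 + (2 * L * y - z / 2) ^+ 2 + (2 * L * y - r / 2) ^+ 2 by field.
by rewrite !addr_ge0// sqr_ge0.
Qed.

(** Monotonicity against the point 0 gives 2 beta y^2 + 2 |y| p as a bound, and completing the
    square, (p + 2 beta |y|)^2 >= 0, turns it into p^2 / (2 |beta|). *)
Lemma monotone_growth (R : realType) (beta y gy g0 p : R) : beta < 0 ->
  (y - 0) * (gy - g0) <= beta * (y - 0) ^+ 2 -> `|g0| <= p ->
  2 * y * gy <= (- (2 * beta))^-1 * p ^+ 2.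
Proof.
move=> b0; rewrite !subr0 => h gp.
have b1 : 0 < - (2 * beta) by lra.
have h2 : 2 * y * gy <= 2 * beta * y ^+ 2 + 2 * (`|y| * p).
  have : y * g0 <= `|y| * p.
    by apply: le_trans (ler_norm _) _; rewrite normrM ler_wpM2l.
  by move: h; rewrite mulrBr; lra.
apply: le_trans h2 _; rewrite -(ler_pM2l b1) mulVKf ?gt_eqF//.
rewrite -[y ^+ 2]real_normK ?num_real//.
have := sqr_ge0 (p + 2 * beta * `|y|).
move=> h3; rewrite -subr_ge0; apply: etrans h3; congr (0 <= _).
have -> : (p + 2 * beta * `|y|) ^+ 2 = p ^+ 2 - - (2 * beta) * (2 * beta * `|y| ^+ 2 + 2 * (`|y| * p)) by ring.
by [].
Qed.

Section second_moment.
Context {R : realType} {dsp : measure_display} {Omega : measurableType dsp}.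
Context (P : probability Omega R) (T : R).
Variable X : R -> Omega -> R.
Hypothesis mX : jmeas T X.
Hypothesis X0 : nneg_on T X.

Lemma jmeas_fine_mean : jmeas T (fun s (_ : Omega) => fine (\int[P]_w (X s w)%:E)%E).
Proof.
apply: jmeas_time; have := @jmeas_integralP _ _ _ P T X `[0, T]%classic mX.
move=> /(_ _ _ _)/wrap[|||h]//.
by apply: measurableT_comp h.
Qed.

(** Tonelli's theorem, as an inequality because [fine] replaces an infinite mean by 0. *)
Lemma dint_fine_mean_le (e : R -> R) : measurable_fun (`[0, T]%classic : set (measurableTypeR R)) e ->
  (forall s, 0 <= e s) -> (forall s, s \in `[0, T] -> measurable_fun setT (X s)) ->
  (dint P T (fun s _ => e s * fine (\int[P]_w (X s w)%:E)%E)%R <=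
   dint P T (fun s w => e s * X s w)%R)%E.
Proof.
move=> me e0 mXs.
rewrite [leRHS]/dint -(jmeas_tonelli P (T := T) (X := fun s w => e s * X s w) (D := `[0, T]%classic))//; first last.
- by move=> r w rT; rewrite mulr_ge0// X0.
- by apply: jmeasM => //; exact: jmeas_time.
rewrite /dint integral_cst// [X in (_ * X)%E]probability_setT mule1.
apply: ge0_le_integral_lower => s sT.
  by rewrite lee_fin mulr_ge0// fine_ge0// integral_ge0// => w _; rewrite lee_fin X0.
have m0 : (0 <= \int[P]_w (X s w)%:E)%E by apply: integral_ge0 => w _; rewrite lee_fin X0.
have -> : (\int[P]_w (e s * X s w)%:E = (e s)%:E * \int[P]_w (X s w)%:E)%E.
  rewrite -ge0_integralZl//.
  - by apply/measurable_EFinP; exact: mXs.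
  - by move=> w _; rewrite lee_fin X0.
  - by rewrite lee_fin.
rewrite EFinM; apply: lee_wpmul2l; first by rewrite lee_fin.
have [h|h] := ltP (\int[P]_w (X s w)%:E)%E +oo%E; first by rewrite fineK// ge0_fin_numE.
by move: h; rewrite leye_eq => /eqP ->; rewrite leey.
Qed.

End second_moment.

Lemma vdist_vec0 (R : realType) d (z : d.-tuple R) : vdist z vec0 = vnorm z.
Proof.
by congr Num.sqrt; apply: eq_bigr => i _; rewrite tnth_mktuple subr0.
Qed.

Lemma sqr_Ex_le d (S : measurableType d) (R : realType) (P : probability S R) (X : S -> R) :
  SQ P X -> Ex P X ^+ 2 <= Ex P (fun w => X w ^+ 2).
Proof.
move=> sX; have iX := SQ_Ig sX; have iX2 := SQ_sqr sX.
have := @Ex_ge0 _ _ _ P _ (fun w => sqr_ge0 (X w - Ex P X)).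
have -> : (fun w => (X w - Ex P X) ^+ 2) = fun w => X w ^+ 2 + ((- (2 * Ex P X)) * X w + Ex P X ^+ 2).
  by apply/funext => w; ring.
rewrite ExD//; last by apply: IgD; [exact: IgZ|exact: Ig_cst].
rewrite ExD; [|exact: IgZ|exact: Ig_cst].
rewrite ExZ// Ex_cst => h; rewrite -subr_ge0; apply: etrans h; congr (0 <= _); ring.
Qed.

Lemma sqr_drift_le (R : realType) (f L y z r : R) :
  (f + L * (y + z + r)) ^+ 2 <= 2 * f ^+ 2 + 6 * L ^+ 2 * (y ^+ 2 + z ^+ 2 + r ^+ 2).
Proof.
rewrite -subr_ge0.
have -> : 2 * f ^+ 2 + 6 * L ^+ 2 * (y ^+ 2 + z ^+ 2 + r ^+ 2) - (f + L * (y + z + r)) ^+ 2 =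
  (f - L * (y + z + r)) ^+ 2 + 2 * ((L * (y - z)) ^+ 2 + (L * (z - r)) ^+ 2 + (L * (y - r)) ^+ 2) by ring.
by rewrite addr_ge0 ?sqr_ge0// mulr_ge0// addr_ge0 ?sqr_ge0// addr_ge0 ?sqr_ge0.
Qed.

Lemma dint_le_fin (R : realType) (dsp : measure_display) (Omega : measurableType dsp)
  (P : probability Omega R) (T : R) (a b c : R -> Omega -> R) (k1 k2 b0 c0 : R) :
  0 <= k1 -> 0 <= k2 -> jmeas T b -> jmeas T c -> nneg_on T a -> nneg_on T b -> nneg_on T c ->
  (forall s w, s \in `[0, T] -> a s w <= k1 * b s w + k2 * c s w) ->
  (dint P T b <= b0%:E)%E -> (dint P T c <= c0%:E)%E ->
  (dint P T a <= (k1 * b0 + k2 * c0)%:E)%E.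
Proof.
move=> k10 k20 mb mc a0 bb cc abc hb hc.
apply: (le_trans (dint_le_comb P k10 k20 mb mc a0 bb cc abc)).
by rewrite EFinD !EFinM; apply: leeD; apply: lee_wpmul2l.
Qed.

Lemma absorption_constant_gt0 (R : realFieldType) (E D c : R) : 0 < E -> 0 <= D -> 0 <= c ->
  0 < (4 * D + 2) * (E * (c + 1)) + (8 * E ^+ 2 * D ^+ 2 + 4 * E ^+ 2).
Proof.
move=> E0 D0 c0; apply: ltr_pwDl.
  apply: mulr_gt0; first by rewrite ltr_wpDl// mulr_ge0.
  by rewrite mulr_gt0// ltr_wpDl.
by apply: addr_ge0; apply: mulr_ge0; rewrite ?sqr_ge0// mulr_ge0 ?sqr_ge0.
Qed.

(** * A priori bound *)

Section a_priori.
Context {R : realType} {dsp : measure_display} {Omega : measurableType dsp}.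
Context (P : probability Omega R) {d : nat} (T Lf beta : R).
Hypothesis T_gt0 : 0 < T.
Hypothesis Lf_ge0 : 0 <= Lf.
Hypothesis beta_lt0 : beta < 0.
Variable B : R -> {RV P >-> d.-tuple R}.
Variables (kappa : Omega -> incr_path T) (K : incr_path T).
Variables (f : R -> Omega -> R -> d.-tuple R -> P2 R d -> R) (g : R -> Omega -> R -> R).
Variables (psi : R -> Omega -> R) (xi : {RV P >-> R}) (u : R -> R).
Variables (Y : R -> {RV P >-> R}) (Z : R -> {RV P >-> d.-tuple R}) (M : R -> {RV P >-> R}).
Hypothesis P_complete : measure_is_complete P.
Hypothesis hB : brownian T B.
Hypothesis kappa_adapted : adapted T B (fun t w => kappa w t).
Hypothesis A1 : assumption_A1 B kappa Lf f.
Hypothesis A2 : assumption_A2 B kappa beta psi g.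
Hypothesis A3 : assumption_A3 B kappa u xi.
Hypothesis hY : space_S2 T B Y.
Hypothesis hZ : space_H2 T B Z.
Hypothesis hM : ito_integral T B Z M.
Hypothesis eqn : {ae P, forall w, forall t, t \in `[0, T] ->
  Y t w = xi w
    + \int[lebesgue_measure]_(s in `[t, T]) f s w (Y s w) (Z s w) (joint_law (Y s) (Z s))
    + \int[stieltjes (kappa w)]_(s in `[t, T]) g s w (Y s w)
    - (M T w - M t w) + (K T - K t)}.
Variable Lg : R.
Hypothesis Lg_gt0 : 0 < Lg.
Hypothesis g_growth : forall t w, t \in `[0, T] -> forall y, `|g t w y| <= psi t w + Lg * `|y|.

Let T_ge0 : 0 <= T. Proof. exact: ltW. Qed.
Let alpha := 2 + 2 * Lf + 8 * Lf ^+ 2.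
Let c := (- (2 * beta))^-1.
Let E := expR (alpha * T).
Let f0 s w := `|f s w 0 vec0 delta0|.
(** At times where the second moment is infinite this is 0, in agreement with [joint_law], which is
    then the Dirac mass at the origin. *)
Let moment s := fine (\int[P]_w (Y s w ^+ 2 + vnorm (Z s w) ^+ 2)%:E)%E.
Let rho s (_ : Omega) := Num.sqrt (moment s).
Let Fb s w := f0 s w + Lf * (`|Y s w| + vnorm (Z s w) + rho s w).
Let F s w := f s w (Y s w) (Z s w) (joint_law (Y s) (Z s)).
Let G s w := g s w (Y s w).
(** The least process for which the growth bound holds at the two points where it is used, Y_s and
    0. It lies below psi and inherits joint measurability from g and Y. *)
Let pp s w := Num.max (`|G s w| - Lg * `|Y s w|) `|g s w 0|.

Let cY w : cont_on T (fun t => Y t w). Proof. by have [h _ _] := hY; exact: h. Qed.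

Let jY : jmeas T (fun t w => Y t w).
Proof. by apply: (jmeas_continuous T_gt0) => //. Qed.

Let jZ k : jmeas T (fun t w => tnth (Z t w) k).
Proof. by have [h _] := hZ; exact: jmeas_predictable h. Qed.

Let jnZ : jmeas T (fun t w => vnorm (Z t w)). Proof. exact: jmeas_vnorm. Qed.

Let jf0 : jmeas T f0.
Proof. by apply: jmeas_norm; apply: (jmeas_progressive P_complete T_gt0); exact: (A1_prog A1). Qed.

Let jg y : jmeas T (fun s w => g s w y).
Proof. by apply: (jmeas_progressive P_complete T_gt0); exact: (A2_prog A2). Qed.

Let jG : jmeas T G.
Proof.
have := @measurable_fun_caratheodory _ (measurableTypeR R * Omega)%type R
  (`[0, T]%classic `*` setT) (fun p => Y p.1 p.2) (fun y p => g p.1 p.2 y).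
move=> /(_ _ _ _ _)/wrap[||||]//.
- by apply: measurableX => //; exact: measurable_itv.
- by move=> p [pT _]; exact: (A2_cont A2).
Qed.

Let jYZ : jmeas T (fun s w => Y s w ^+ 2 + vnorm (Z s w) ^+ 2).
Proof. by apply: jmeasD; exact: jmeas_sqr. Qed.

Let nnYZ : nneg_on T (fun s w => Y s w ^+ 2 + vnorm (Z s w) ^+ 2).
Proof. by move=> s w _; rewrite addr_ge0 ?sqr_ge0. Qed.

Let jrho : jmeas T rho.
Proof. by apply: jmeas_sqrt; exact: jmeas_fine_mean. Qed.

Let rho_ge0 s w : 0 <= rho s w. Proof. exact: sqrtr_ge0. Qed.

Let rho2 s w : rho s w ^+ 2 = moment s.
Proof.
by rewrite sqr_sqrtr// fine_ge0// integral_ge0// => v _; rewrite lee_fin addr_ge0 ?sqr_ge0.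
Qed.

Let mYZ s : measurable_fun setT (fun w => Y s w ^+ 2 + vnorm (Z s w) ^+ 2).
Proof.
apply: measurable_funD; first exact: measurable_funX.
rewrite (_ : (fun w => _) = fun w => \sum_(i < d) tnth (Z s w) i ^+ 2).
  apply: measurable_sum => i; apply: measurable_funX.
  exact: (measurableT_comp (measurable_tnth i)).
by apply/funext => w; rewrite sqr_vnormE.
Qed.

Let rho_le (e : R -> R) : measurable_fun (`[0, T]%classic : set (measurableTypeR R)) e ->
  (forall s, 0 <= e s) ->
  (dint P T (fun s w => e s * rho s w ^+ 2)%R <=
   dint P T (fun s w => e s * (Y s w ^+ 2 + vnorm (Z s w) ^+ 2))%R)%E.
Proof.
move=> me e0; have := @dint_fine_mean_le _ _ _ P T _ jYZ nnYZ e me e0 (fun s _ => mYZ s).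
apply: le_trans.
rewrite le_eqVlt; apply/orP; left; apply/eqP.
by apply: eq_integral => w _; apply: eq_integral => s _; rewrite rho2.
Qed.

Let jFb : jmeas T Fb.
Proof.
apply: jmeasD => //; apply: jmeasM; first exact: jmeas_cst.
by apply: jmeasD => //; apply: jmeasD => //; exact: jmeas_norm.
Qed.

Let Fb_ge0 : nneg_on T Fb.
Proof.
by move=> s w _; rewrite /Fb addr_ge0 ?/f0// mulr_ge0// addr_ge0// addr_ge0// sqrtr_ge0.
Qed.

Let F_le s w : s \in `[0, T] -> `|F s w| <= Fb s w.
Proof.
move=> sT; have := A1_lip A1 w sT (Y s w) 0 (Z s w) vec0 (joint_law (Y s) (Z s)) delta0.
rewrite subr0 vdist_vec0 => h.
have W : W2 (joint_law (Y s) (Z s)) delta0 <= rho s w by exact: W2_delta0_le.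
have := ler_normD (f s w 0 vec0 delta0) (F s w - f s w 0 vec0 delta0).
rewrite addrC subrK => /le_trans; apply; rewrite lerD2l; apply: le_trans h _.
by rewrite ler_wpM2l// lerD2l.
Qed.

Let kappa_ge0 w t : t \in `[0, T] -> 0 <= kappa w t.
Proof. exact: incr_path_ge0. Qed.

(** At mu = 1 the exponentially weighted integrals of the assumptions dominate the unweighted ones,
    since kappa is nonnegative. *)
Let weight_ge1 w t (x : R) : t \in `[0, T] -> 0 <= x -> x <= expR (1 * kappa w t) * x.
Proof.
move=> tT x0; rewrite ler_peMl// mul1r -expR0 ler_expR; exact: kappa_ge0.
Qed.

Let f0_fin : dint_fin P T (fun s w => f0 s w ^+ 2).
Proof.
apply: le_lt_trans (A1_int A1 ltr01).
apply: ge0_le_integral_lower => w _; first by apply: integral_ge0 => s _; rewrite lee_fin sqr_ge0.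
apply: ge0_le_integral_lower => s sT; rewrite lee_fin ?sqr_ge0//.
by apply: weight_ge1 => //; exact: sqr_ge0.
Qed.

Let Z2_fin : dint_fin P T (fun s w => vnorm (Z s w) ^+ 2).
Proof. by have [_] := hZ. Qed.

Let sYs : SQ P (fun w => supnorm T (fun t => Y t w)).
Proof. exact: (SQ_solution_sup T_gt0 hY). Qed.

Let Y2_fin : dint_fin P T (fun s w => Y s w ^+ 2).
Proof. exact: (dint_solution_sqr_fin T_gt0 hY). Qed.

Let sxi : SQ P xi.
Proof.
apply: SQ_EFin => //; apply: le_lt_trans (A3_int A3 ltr01).
apply: ge0_le_integral_lower => w _; rewrite lee_fin ?sqr_ge0//.
rewrite real_normK ?num_real//; apply: weight_ge1; rewrite ?sqr_ge0// in_itv/= T_ge0 lexx//.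
Qed.

Let jsq (X : R -> Omega -> R) : jmeas T X -> jmeas T (fun s w => X s w ^+ 2).
Proof. exact: jmeas_sqr. Qed.

Let nn2 (X : R -> Omega -> R) : nneg_on T (fun s w => X s w ^+ 2).
Proof. by move=> s w _; exact: sqr_ge0. Qed.

Let YZ_fin : dint_fin P T (fun s w => Y s w ^+ 2 + vnorm (Z s w) ^+ 2).
Proof.
apply: (dint_comb_fin ler01 ler01 (jsq jY) (jsq jnZ) nnYZ (nn2 _) (nn2 _) _ Y2_fin Z2_fin).
by move=> s w _; rewrite !mul1r.
Qed.

Let rho2_fin : dint_fin P T (fun s w => rho s w ^+ 2).
Proof.
have := rho_le (e := fun=> 1) (measurable_cst _) (fun=> ler01).
under [X in (dint _ _ X <= _)%E]eq_fun do under eq_fun do rewrite mul1r.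
under [X in (_ <= dint _ _ X)%E]eq_fun do under eq_fun do rewrite mul1r.
by move=> h; apply: le_lt_trans h _; exact: YZ_fin.
Qed.

Let Fb2_fin : dint_fin P T (fun s w => Fb s w ^+ 2).
Proof.
have c0 : nneg_on T (fun s w => Y s w ^+ 2 + vnorm (Z s w) ^+ 2 + rho s w ^+ 2).
  by move=> s w _; rewrite addr_ge0 ?sqr_ge0// addr_ge0 ?sqr_ge0.
have cm : jmeas T (fun s w => Y s w ^+ 2 + vnorm (Z s w) ^+ 2 + rho s w ^+ 2).
  by apply: jmeasD => //; exact: jsq.
have cf : dint_fin P T (fun s w => Y s w ^+ 2 + vnorm (Z s w) ^+ 2 + rho s w ^+ 2).
  apply: (dint_comb_fin ler01 ler01 jYZ (jsq jrho) c0 nnYZ (nn2 _) _ YZ_fin rho2_fin).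
  by move=> s w _; rewrite !mul1r.
have k2 : 0 <= 6 * Lf ^+ 2 by rewrite mulr_ge0// sqr_ge0.
apply: (dint_comb_fin (ler0n R 2) k2 (jsq jf0) cm (nn2 _) (nn2 _) c0 _ f0_fin cf).
move=> s w _; apply: le_trans (sqr_drift_le _ _ _ _ _) _.
by rewrite [`|Y s w| ^+ 2]real_normK ?num_real.
Qed.

Let jpp : jmeas T pp.
Proof.
apply: jmeas_max; last exact: jmeas_norm.
apply: jmeasB; first exact: jmeas_norm.
by apply: jmeasM; [exact: jmeas_cst|exact: jmeas_norm].
Qed.

Let pp_ge0 : nneg_on T pp.
Proof. by move=> s w _; rewrite le_max normr_ge0 orbT. Qed.

Let pp_le_psi s w : s \in `[0, T] -> pp s w <= psi s w.
Proof.
move=> sT; rewrite ge_max lerBlDr g_growth//=.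
by have := g_growth w sT 0; rewrite normr0 mulr0 addr0.
Qed.

Let pp2_le : (\int[P]_w \int[stieltjes (kappa w)]_(s in `[0%R, T]) (pp s w ^+ 2)%:E <=
  \int[P]_w \int[stieltjes (kappa w)]_(s in `[0%R, T]) (`|psi s w| ^+ 2)%:E)%E.
Proof.
apply: ge0_le_integral_lower => w _; first by apply: integral_ge0 => s _; rewrite lee_fin sqr_ge0.
apply: ge0_le_integral_lower => s sT; rewrite lee_fin ?sqr_ge0//.
rewrite lerXn2r ?nnegrE ?pp_ge0//; apply: le_trans (pp_le_psi w sT) (ler_norm _).
Qed.

Let pp2_fin : (\int[P]_w \int[stieltjes (kappa w)]_(s in `[0%R, T]) (pp s w ^+ 2)%:E < +oo)%E.
Proof.
apply: le_lt_trans pp2_le _; apply: le_lt_trans (A2_psi_int A2 ltr01).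
apply: ge0_le_integral_lower => w _; first by apply: integral_ge0 => s _; rewrite lee_fin sqr_ge0.
apply: ge0_le_integral_lower => s sT; rewrite lee_fin ?sqr_ge0//.
by apply: weight_ge1 => //; exact: sqr_ge0.
Qed.

Let G_growth s w : s \in `[0, T] -> `|G s w| <= pp s w + Lg * `|Y s w|.
Proof. by move=> sT; rewrite -lerBlDr le_max lexx. Qed.

Let G_mono s w : s \in `[0, T] -> 2 * Y s w * G s w <= c * pp s w ^+ 2.
Proof.
move=> sT; apply: monotone_growth beta_lt0 (A2_mono A2 w sT (Y s w) 0) _.
by rewrite le_max lexx orbT.
Qed.

Let alpha_ge0 : 0 <= alpha.
Proof. by rewrite addr_ge0 ?addr_ge0 ?mulr_ge0// sqr_ge0. Qed.

Let c_ge0 : 0 <= c. Proof. by rewrite invr_ge0 oppr_ge0 pmulr_rle0// ltW. Qed.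

Let xY := Ex P (weighted_Y2 T Y alpha).
Let xZ := Ex P (weighted_Z2 T Z alpha).
Let xS := Ex P (fun w => supnorm T (fun t => Y t w) ^+ 2).
Let phi := fine (dint P T (fun s w => f0 s w ^+ 2)).
Let bdy := Ex P (boundary_energy kappa pp).
Let J := Ex P (drift_energy T Y Fb alpha).

Let phiE : (phi%:E = dint P T (fun s w => f0 s w ^+ 2)%R)%E.
Proof. by apply: fineK; rewrite ge0_fin_numE; [exact: f0_fin|exact: dint_ge0 (nn2 f0)]. Qed.

Let phi_ge : (dint P T (fun s w => f0 s w ^+ 2)%R <= phi%:E)%E.
Proof. exact: (@eq_ind _ (phi%:E) (fun z => (z <= phi%:E)%E) (lexx _) _ phiE). Qed.

Let phi_le : (phi%:E <= \int[P]_w \int[lebesgue_measure]_(s in `[0%R, T])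
  (`|f s w 0%R vec0 delta0| ^+ 2)%:E)%E.
Proof. exact: (@eq_ind _ (phi%:E) (fun z => (phi%:E <= z)%E) (lexx _) _ phiE). Qed.

Let phi_ge0 : 0 <= phi. Proof. exact: fine_ge0 (dint_ge0 P (nn2 f0)). Qed.

Let wt s := expR (alpha * s).

Let mwt : measurable_fun (`[0, T]%classic : set (measurableTypeR R)) wt.
Proof. exact: measurable_expR_scale. Qed.

Let jwt : jmeas T (fun s (_ : Omega) => wt s). Proof. exact: jmeas_time. Qed.

Let nnw (X : R -> Omega -> R) : nneg_on T X -> nneg_on T (fun s w => wt s * X s w).
Proof. by move=> X0 s w sT; rewrite mulr_ge0 ?expR_ge0 ?X0. Qed.

(** [young_drift] integrated against exp(alpha s), the weight being replaced by E in front of f^2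
    only. A quarter of rho^2 passes to a quarter of Y^2 and of |Z|^2 by [rho_le], so 1 becomes 5/4
    and 1/4 becomes 1/2. *)
Let drift_le : J <= E * phi + (5 / 4 + 2 * Lf + 8 * Lf ^+ 2) * xY + xZ / 2.
Proof.
have eY : (dint P T (fun s w => wt s * Y s w ^+ 2)%R <= xY%:E)%E.
  by rewrite -(Ex_weighted_Y2 T_gt0 hY alpha_ge0).
have eZ : (dint P T (fun s w => wt s * vnorm (Z s w) ^+ 2)%R <= xZ%:E)%E.
  by rewrite -(Ex_weighted_Z2 jZ Z2_fin alpha_ge0).
have jwY := jmeasM jwt (jsq jY); have jwZ := jmeasM jwt (jsq jnZ); have jwr := jmeasM jwt (jsq jrho).
have nY := nnw (nn2 (fun s w => Y s w)); have nZ := nnw (nn2 (fun s w => vnorm (Z s w))).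
have nr := nnw (nn2 rho).
have er : (dint P T (fun s w => wt s * rho s w ^+ 2)%R <= (1 * xY + 1 * xZ)%:E)%E.
  apply: (le_trans (rho_le mwt (fun s => expR_ge0 _))).
  apply: (dint_le_fin ler01 ler01 jwY jwZ (nnw nnYZ) nY nZ _ eY eZ) => s w _.
  by rewrite !mul1r mulrDr.
have q0 : 0 <= 4^-1 :> R by rewrite invr_ge0.
have k0 : 0 <= 1 + 2 * Lf + 8 * Lf ^+ 2 by rewrite addr_ge0 ?addr_ge0 ?mulr_ge0// sqr_ge0.
pose c2 s w := wt s * (4^-1 * vnorm (Z s w) ^+ 2 + 4^-1 * rho s w ^+ 2).
have n2 : nneg_on T c2.
  by apply: nnw => s w _; apply: addr_ge0; rewrite mulr_ge0 ?sqr_ge0.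
have j2 : jmeas T c2.
  by apply: jmeasM => //; apply: jmeasD; apply: jmeasM; (exact: jmeas_cst || exact: jsq).
have e2 := dint_le_fin (P := P) (a := c2) q0 q0 jwZ jwr n2 nZ nr _ eZ er.
have {}e2 : (dint P T c2 <= (4^-1 * xZ + 4^-1 * (1 * xY + 1 * xZ))%:E)%E.
  by apply: e2 => s w _; rewrite /c2 mulrDr; lra.
pose c1 s w := wt s * ((1 + 2 * Lf + 8 * Lf ^+ 2) * Y s w ^+ 2 + (4^-1 * vnorm (Z s w) ^+ 2 + 4^-1 * rho s w ^+ 2)).
have n1 : nneg_on T c1.
  move=> s w sT; rewrite /c1 mulrDr; apply: addr_ge0; last exact: n2.
  by rewrite mulr_ge0 ?expR_ge0// mulr_ge0 ?sqr_ge0.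
have j1 : jmeas T c1.
  have -> : c1 = fun s w => wt s * ((1 + 2 * Lf + 8 * Lf ^+ 2) * Y s w ^+ 2) + c2 s w.
    by apply/funext => s; apply/funext => w; rewrite /c1 mulrDr.
  apply: jmeasD => //; apply: jmeasM => //; apply: jmeasM; [exact: jmeas_cst|exact: jsq].
have e1 := dint_le_fin (P := P) (a := c1) k0 ler01 jwY j2 n1 nY n2 _ eY e2.
have {}e1 : (dint P T c1 <= ((1 + 2 * Lf + 8 * Lf ^+ 2) * xY + 1 * (4^-1 * xZ + 4^-1 * (1 * xY + 1 * xZ)))%:E)%E.
  by apply: e1 => s w _; rewrite /c1 /c2 mul1r mulrDr mulrCA.
have nJ : nneg_on T (fun s w => 2 * expR (alpha * s) * `|Y s w| * Fb s w).
  by move=> s w sT; rewrite mulr_ge0 ?Fb_ge0// mulr_ge0// mulr_ge0 ?expR_ge0.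
have eJ := dint_le_fin (P := P) (expR_ge0 (alpha * T)) ler01 (jsq jf0) j1 nJ (nn2 f0) n1 _ phi_ge e1.
have {}eJ : (J%:E <= (E * phi + 1 * ((1 + 2 * Lf + 8 * Lf ^+ 2) * xY + 1 * (4^-1 * xZ + 4^-1 * (1 * xY + 1 * xZ))))%:E)%E.
  rewrite (Ex_drift_energy T_gt0 hY alpha_ge0 jFb Fb_ge0 Fb2_fin); apply: eJ => s w sT.
  have -> : 2 * expR (alpha * s) * `|Y s w| * Fb s w = wt s * (2 * `|Y s w| * Fb s w) by rewrite /wt; ring.
  apply: (le_trans (ler_wpM2l (expR_ge0 _) (young_drift _ _ _ _ _))).
  rewrite mulrDr [`|Y s w| ^+ 2]real_normK ?num_real// mul1r lerD2r ler_wpM2r ?sqr_ge0//.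
  by rewrite ler_expR ler_wpM2l//; move: sT; rewrite in_itv/= => /andP[].
by move: eJ; rewrite lee_fin => /le_trans; apply; rewrite le_eqVlt; apply/orP; left; apply/eqP; field.
Qed.

Lemma a_priori_expectation :
  xS + xZ <= ((4 * young_constant E alpha + 2) * (E * (c + 1))
    + (8 * E ^+ 2 * young_constant E alpha ^+ 2 + 4 * E ^+ 2)) *
    (Ex P (fun w => xi w ^+ 2) + phi + bdy + K T ^+ 2).
Proof.
have Z2 : (norm2_H2 P T (fun t => Z t : Omega -> d.-tuple R) < +oo)%E := Z2_fin.
have eqn' : {ae P, forall w, forall t, t \in `[0, T] ->
  Y t w = xi w + \int[lebesgue_measure]_(s in `[t, T]) F s w
    + \int[stieltjes (kappa w)]_(s in `[t, T]) G s w - (M T w - M t w) + (K T - K t)} := eqn.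
have h1 := energy_estimate P_complete hB T_gt0 kappa_adapted hY jZ Z2 hM alpha_ge0 c_ge0 (ltW Lg_gt0)
  jFb Fb_ge0 Fb2_fin F_le jG jpp pp_ge0 pp2_fin G_growth G_mono sxi eqn'.
have h2 := sup_estimate P_complete hB T_gt0 kappa_adapted hY jZ Z2 hM alpha_ge0 c_ge0 (ltW Lg_gt0)
  jFb Fb_ge0 Fb2_fin F_le jG jpp pp_ge0 pp2_fin G_growth G_mono sxi eqn'.
rewrite (Ex_energy_rhs P_complete T_gt0 K kappa_adapted hY c alpha_ge0 jFb Fb_ge0 Fb2_fin jpp pp2_fin sxi) in h1 h2.
apply: (absorption (expR_ge0 _) Lf_ge0 erefl c_ge0 _ _ _ _ _ (sqr_Ex_le sYs) drift_le h1 h2).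
- by apply: Ex_ge0 => w; apply: Rintegral_ge0 => s _; rewrite mulr_ge0 ?expR_ge0 ?sqr_ge0.
- by apply: Ex_ge0 => w; apply: Rintegral_ge0 => s _; rewrite mulr_ge0 ?expR_ge0 ?sqr_ge0.
- by apply: Ex_ge0 => w; exact: sqr_ge0.
- exact: phi_ge0.
- by apply: Ex_ge0 => w; apply: Rintegral_ge0 => s _; exact: sqr_ge0.
Qed.

Let C := (4 * young_constant E alpha + 2) * (E * (c + 1))
  + (8 * E ^+ 2 * young_constant E alpha ^+ 2 + 4 * E ^+ 2).

Lemma a_priori_bound : 0 <= C ->
  (\int[P]_w
     (ereal_sup [set (`|Y t w| ^+ 2)%:E | t in `[0%R, T]%classic]
      + \int[lebesgue_measure]_(s in `[0%R, T]) (vnorm (Z s w) ^+ 2)%:E)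
   <= C%:E *
      (\int[P]_w (`|xi w| ^+ 2)%:E
       + \int[P]_w \int[lebesgue_measure]_(s in `[0%R, T])
           (`|f s w 0%R vec0 delta0| ^+ 2)%:E
       + \int[P]_w \int[stieltjes (kappa w)]_(s in `[0%R, T])
           (`|psi s w| ^+ 2)%:E
       + (K T ^+ 2)%:E))%E.
Proof.
move=> C0.
have iS := SQ_sqr sYs.
have IZ0 w : (0 <= \int[lebesgue_measure]_(s in `[0%R, T]) (vnorm (Z s w) ^+ 2)%:E)%E.
  by apply: integral_ge0 => s _; rewrite lee_fin sqr_ge0.
rewrite (eq_integral (fun w => (supnorm T (fun t => Y t w) ^+ 2)%:E +
    \int[lebesgue_measure]_(s in `[0%R, T]) (vnorm (Z s w) ^+ 2)%:E)%E); last first.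
  by move=> w _; rewrite (ereal_sup_sqr T_ge0 cY).
rewrite ge0_integralD//; last 3 first.
- by move=> w _; rewrite lee_fin sqr_ge0.
- by apply/measurable_EFinP; exact: Ig_meas iS.
- by apply: (jmeas_integral (jsq jnZ)) => // s w _; exact: sqr_ge0.
have hZx : (\int[P]_w \int[lebesgue_measure]_(s in `[0%R, T]) (vnorm (Z s w) ^+ 2)%:E <= xZ%:E)%E.
  rewrite /xZ (Ex_weighted_Z2 jZ Z2_fin alpha_ge0).
  apply: ge0_le_integral_lower => w _ //.
  apply: ge0_le_integral_lower => s sT; rewrite lee_fin ?sqr_ge0//.
  rewrite ler_peMl ?sqr_ge0// -expR0 ler_expR mulr_ge0//.
  by move: sT; rewrite /= in_itv/= => /andP[].
rewrite -(Ex_EFin iS).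
apply: (@le_trans _ _ (xS + xZ)%:E); first by rewrite EFinD leeD2l.
apply: (@le_trans _ _ (C * (Ex P (fun w => xi w ^+ 2) + phi + bdy + K T ^+ 2))%:E).
  by rewrite lee_fin; exact: a_priori_expectation.
rewrite EFinM; apply: lee_wpmul2l; first by rewrite lee_fin.
rewrite EFinD; apply: leeD => //; rewrite EFinD; apply: leeD; last first.
  by rewrite /bdy (Ex_boundary_energy P_complete T_gt0 kappa_adapted jpp pp2_fin); exact: pp2_le.
rewrite EFinD; apply: leeD; last exact: phi_le.
rewrite (Ex_EFin (SQ_sqr sxi)) le_eqVlt; apply/orP; left; apply/eqP.
by apply: eq_integral => w _; rewrite real_normK ?num_real.
Qed.

End a_priori.

Theorem lemma3p1 (R : realType) (T Lf beta : R)
  (T_gt0 : 0 < T) (Lf_ge0 : 0 <= Lf) (beta_lt0 : beta < 0) :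
  exists2 C : R, 0 < C &
  forall (dsp : measure_display) (Omega : measurableType dsp)
    (P : probability Omega R) (d : nat) (B : R -> {RV P >-> d.-tuple R})
    (kappa : Omega -> incr_path T)
    (f : R -> Omega -> R -> d.-tuple R -> P2 R d -> R)
    (g : R -> Omega -> R -> R) (psi : R -> Omega -> R)
    (xi : {RV P >-> R}) (u : R -> R)
    (Y : R -> {RV P >-> R}) (Z : R -> {RV P >-> d.-tuple R})
    (K : incr_path T),
  measure_is_complete P ->
  brownian T B ->
  adapted T B (fun t w => kappa w t) ->
  assumption_A1 B kappa Lf f ->
  assumption_A2 B kappa beta psi g ->
  assumption_A3 B kappa u xi ->
  assumption_A4 T u ->
  mean_reflected_solution B kappa f g xi u Y Z K ->
  (\int[P]_w
     (ereal_sup [set (`|Y t w| ^+ 2)%:E | t in `[0%R, T]%classic]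
      + \int[lebesgue_measure]_(s in `[0%R, T]) (vnorm (Z s w) ^+ 2)%:E)
   <= C%:E *
      (\int[P]_w (`|xi w| ^+ 2)%:E
       + \int[P]_w \int[lebesgue_measure]_(s in `[0%R, T])
           (`|f s w 0%R vec0 delta0| ^+ 2)%:E
       + \int[P]_w \int[stieltjes (kappa w)]_(s in `[0%R, T])
           (`|psi s w| ^+ 2)%:E
       + (K T ^+ 2)%:E))%E.
Proof.
(* All constants are built from Lf, beta and T before the probability space is introduced. The
   growth constant Lg occurs only in the remainders that vanish with the mesh, so C does not depend
   on it. *)
pose alpha := 2 + 2 * Lf + 8 * Lf ^+ 2; pose E := expR (alpha * T).
pose c := (- (2 * beta))^-1; pose D := young_constant E alpha.
have E0 : 0 < E by exact: expR_gt0.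
have al0 : 0 <= alpha by rewrite addr_ge0 ?addr_ge0 ?mulr_ge0// sqr_ge0.
have c0 : 0 <= c by rewrite invr_ge0 oppr_ge0 pmulr_rle0// ltW.
have D0 : 0 <= D by have := sqr_ge0 E; move: al0; rewrite /D /young_constant; clear; lra.
have C0 : 0 < (4 * D + 2) * (E * (c + 1)) + (8 * E ^+ 2 * D ^+ 2 + 4 * E ^+ 2).
  exact: absorption_constant_gt0.
eexists; first exact: C0.
move=> dsp Omega P d B kappa f g psi xi u Y Z K P_complete hB hkappa hA1 hA2 hA3 _ [hY hZ [M hM eqn] _ _].
have [Lg Lg0 g_growth] := A2_growth hA2.
exact: (a_priori_bound T_gt0 Lf_ge0 beta_lt0 P_complete hB hkappa hA1 hA2 hA3 hY hZ hM eqn Lg0 g_growth (ltW C0)).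
Qed.
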